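(* Let $\lambda$ be a nonempty self-conjugate partition and let $\ell=\ell(\lambda)$ be its length. Let $\{X_{i,j}: i,j\ge 1\}$ be i.i.d. complex random variables on a common probability space with $\mathbb{E}X_{i,j}=0$ and $\mathbb{E}|X_{i,j}|^2=1$. For $N\ge 1$ let $X_N$ be the $(N\ell)\times(N\ell)$ random matrix whose $(i,j)$-entry is $X_{i,j}$ if $(i,j)\in N\lambda$ and $0$ otherwise, let $W_N=\frac{1}{N\ell}X_NX_N^*$, and let $F_N$ be the empirical distribution function of the eigenvalues of $W_N$. Then there is a deterministic probability distribution $F^{\lambda}$ on $[0,\infty)$ whose moments are $$\int_0^\infty x^k\,\mathrm{d}F^{\lambda}(x)=\frac{C_k^{\lambda}}{\ell^{k+1}},\qquad k\ge 0,$$ and, almost surely, $F_N$ converges (weakly, as a sequence of distribution functions) to $F^{\lambda}$ as $N\to\infty$. Here $C_k^{\lambda}$ denotes the number of $\lambda$-plane trees on $k+1$ vertices.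
   Context: A partition is a sequence $\lambda=(\lambda_1\ge\lambda_2\ge\cdots)$ of nonnegative integers, eventually zero; its length is $\ell(\lambda)=\min\{i\ge 0:\lambda_{i+1}=0\}$. It is identified with its Young diagram $\{(i,j)\in\mathbb{Z}^2: 1\le i\le \ell(\lambda),\ 1\le j\le\lambda_i\}$. The partition is self-conjugate if this set is invariant under $(i,j)\mapsto(j,i)$. For $N\ge1$ the dilation $N\lambda$ is the partition in which each part $\lambda_i$ is replaced by $N$ copies of $N\lambda_i$ (equivalently, each box of $\lambda$ is replaced by an $N\times N$ grid of boxes). If $x_1^{(N)}\le\cdots\le x_{N\ell}^{(N)}$ are the eigenvalues of $W_N$ (with multiplicity), then $F_N(x)=\frac{1}{N\ell}\#\{j\in\{1,\dots,N\ell\}: x^{(N)}_j\le x\}$ for $x\in\mathbb{R}$. A plane tree is a rooted tree in which the children of every vertex are linearly ordered. For $\lambda$ self-conjugate of length $\ell$, a $\lambda$-plane tree is a pair $(T,c)$, where $T$ is a plane tree with vertex set $V$ and edge set $E$ and $c:V\to\{1,\dots,\ell\}$ is a labelling such that $(c(u),c(v))\in\lambda$ whenever $\{u,v\}\in E$. Plane trees are counted up to isomorphism preserving root, order of children, and labels. *)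

(* Defs.v *)
From HB Require Import structures.
From mathcomp Require Import all_boot all_order all_algebra finmap.
From mathcomp Require Import all_classical all_reals all_analysis.
From mathcomp Require Import complex.

Set Implicit Arguments.
Unset Strict Implicit.
Unset Printing Implicit Defensive.

Import Order.TTheory GRing.Theory Num.Theory.
Import numFieldNormedType.Exports.

Local Open Scope classical_set_scope.
Local Open Scope ring_scope.

(* Rows, columns, labels and matrix indices are all numbered from 0, so that
   part la i is the (i+1)-st part of la. *)
Record int_partition := IntPartition {
  part :> nat -> nat;
  part_noninc : forall i j, (i <= j)%N -> (part j <= part i)%N;
  part_finite : exists n, forall i, (n <= i)%N -> part i = 0%N }.

Lemma part_vanishes (la : int_partition) : exists n, la n == 0%N.
Proof. by have [n la0] := part_finite la; exists n; rewrite la0. Qed.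

Definition plength (la : int_partition) : nat := ex_minn (part_vanishes la).

Definition in_diagram (la : int_partition) (i j : nat) : bool :=
  (i < plength la)%N && (j < la i)%N.

Definition self_conjugate (la : int_partition) : Prop :=
  forall i j, in_diagram la i j = in_diagram la j i.

Section Dilation.
Variables (N : nat) (la : int_partition).

Definition dilate_part (i : nat) : nat := (N * la (i %/ N))%N.

Lemma dilate_noninc i j : (i <= j)%N -> (dilate_part j <= dilate_part i)%N.
Proof. by move=> ij; rewrite leq_mul2l part_noninc ?orbT// leq_div2r. Qed.

Lemma dilate_finite : exists n, forall i, (n <= i)%N -> dilate_part i = 0%N.
Proof.
have [n la0] := part_finite la; exists (n * N)%N => i ni; rewrite /dilate_part.
by have [->//|N0] := posnP N; rewrite la0 ?muln0// leq_divRL.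
Qed.

Definition dilate : int_partition := IntPartition dilate_noninc dilate_finite.

End Dilation.

(* A plane tree with a label of type A at every vertex, given as the label of
   its root and the ordered list of the subtrees hanging from the root.
   Equality of terms is isomorphism preserving root, order and labels. *)
Inductive ptree (A : Type) : Type := PNode of A & seq (ptree A).

HB.instance Definition _ (A : Type) := gen_eqMixin (ptree A).
HB.instance Definition _ (A : Type) := gen_choiceMixin (ptree A).

Definition root_label (A : Type) (t : ptree A) : A := let: PNode a _ := t in a.

Fixpoint nvertices (A : Type) (t : ptree A) : nat :=
  let: PNode _ s := t in (sumn [seq nvertices u | u <- s]).+1.

(* Edges are unordered, so both orders of the two labels are required to lie
   in the diagram (this is redundant when la is self-conjugate). *)
Fixpoint lambda_tree (la : int_partition) (t : ptree 'I_(plength la)) : bool :=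
  let: PNode a s := t in
  all (fun u : ptree 'I_(plength la) =>
    [&& in_diagram la a (root_label u), in_diagram la (root_label u) a
      & @lambda_tree la u]) s.

Definition lambda_trees (la : int_partition) (n : nat) :
  set (ptree 'I_(plength la)) := [set t | lambda_tree t /\ nvertices t = n].
Arguments lambda_trees la n : clear implicits.

Lemma finite_seqs (T : eqType) (S : set T) m : finite_set S ->
  finite_set [set s : seq T | (size s <= m)%N /\ forall u, u \in s -> S u].
Proof.
move=> fS; elim: m => [|m IH].
  by apply: sub_finite_set (finite_set1 [::]) => -[|x s] /= [].
apply: (@sub_finite_set _ _ ([set [::]] `|`
   [set x.1 :: x.2 | x in S `*` [set s : seq T |
     (size s <= m)%N /\ forall u, u \in s -> S u]])); last first.
  by rewrite finite_setU; split=> //; apply: finite_image; exact: finite_setX.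
move=> [|x s] /= [sm sS]; first by left.
right; exists (x, s) => //=; split; first by apply: sS; rewrite mem_head.
by split=> // u us; apply: sS; rewrite in_cons us orbT.
Qed.

Lemma finite_nvertices (A : finType) n :
  finite_set [set t : ptree A | (nvertices t <= n)%N].
Proof.
elim: n => [|n IH].
  by apply: sub_finite_set (finite_set0 _) => -[a s].
apply: (@sub_finite_set _ _ [set PNode x.1 x.2 | x in [set: A] `*`
   [set s : seq (ptree A) | (size s <= n)%N /\
      forall u, u \in s -> (nvertices u <= n)%N]]); last first.
  apply: finite_image; apply: finite_setX; first exact: finite_finset.
  exact: finite_seqs IH.
move=> [a s] /=; rewrite ltnS => sn; exists (a, s) => //=; do 2!split => //.
  apply: leq_trans sn; elim: s => //= -[b r] s IHs /=.
  by rewrite addSn ltnS (leq_trans IHs)// leq_addl.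
move=> u us; apply: leq_trans sn.
elim: s us => //= x s IHs; rewrite in_cons => /orP[/eqP->|/IHs us].
  exact: leq_addr.
exact: leq_trans us (leq_addl _ _).
Qed.

(* fset_set below is only meaningful on finite sets. *)
Lemma finite_lambda_trees (la : int_partition) n : finite_set (lambda_trees la n).
Proof.
by apply: sub_finite_set (@finite_nvertices 'I_(plength la) n) => t [_ /= ->].
Qed.

Definition num_lambda_trees (la : int_partition) (k : nat) : nat :=
  #|` fset_set (lambda_trees la k.+1)|.

Definition mutually_independent d d' (T : measurableType d)
    (T' : measurableType d') (R : realType) (P : probability T R)
    (I : choiceType) (X : I -> T -> T') : Prop :=
  forall (J : {fset I}) (B : I -> set T'), (forall i, measurable (B i)) ->
    P (\bigcap_(i in [set` J]) (X i @^-1` B i)) =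
    (\prod_(i <- J) P (X i @^-1` B i))%E.

Definition identically_distributed d d' (T : measurableType d)
    (T' : measurableType d') (R : realType) (P : probability T R)
    (I : Type) (X : I -> T -> T') : Prop :=
  forall i j (B : set T'), measurable B -> P (X i @^-1` B) = P (X j @^-1` B).

Definition iid d d' (T : measurableType d) (T' : measurableType d')
    (R : realType) (P : probability T R) (I : choiceType) (X : I -> T -> T') :
    Prop :=
  [/\ forall i, measurable_fun [set: T] (X i), mutually_independent P X &
      identically_distributed P X].

(* The Borel sigma-algebra of R[i] is that of R * R transported along this. *)
Definition complex_pair (R : realType) (z : R[i]) : R * R :=
  (complex.Re z, complex.Im z).

Definition random_matrix (R : realType) (T : Type) (la : int_partition)
    (X : nat -> nat -> T -> R[i]) (N : nat) (w : T) :
    'M[R[i]]_(N * plength la) :=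
  \matrix_(i, j) if in_diagram (dilate N la) i j then X i j w else 0.

Definition wishart_matrix (R : realType) (T : Type) (la : int_partition)
    (X : nat -> nat -> T -> R[i]) (N : nat) (w : T) :
    'M[R[i]]_(N * plength la) :=
  let XN := random_matrix la X N w in
  ((N * plength la)%:R)^-1 *: (XN *m (map_mx Num.conj XN)^T).

Definition eigenvalues (F : closedFieldType) (n : nat) (A : 'M[F]_n) : seq F :=
  sval (closed_field_poly_normal (char_poly A)).

(* The order of R[i] makes z <= x%:C false unless z is real; the matrices to
   which this is applied are Hermitian, so all their eigenvalues are real. *)
Definition empirical_df (R : realType) (n : nat) (A : 'M[R[i]]_n) (x : R) : R :=
  (n%:R)^-1 * (count (fun z => z <= x%:C%C) (eigenvalues A))%:R.

Definition distribution_function (R : realType)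
    (mu : probability R R) (x : R) : R :=
  fine (mu `]-oo, x]%classic).

Definition weak_cvg_df (R : realType) (F_ : nat -> R -> R) (F : R -> R) : Prop :=
  forall x, {for x, continuous F} -> F_ n x @[n --> \oo] --> F x.

(* Main.v *)
From HB Require Import structures.
Require Import Defs.
From mathcomp Require Import all_boot all_order all_algebra finmap.
From mathcomp Require Import all_classical all_reals all_analysis.
From mathcomp Require Import measurable_realfun spectral complex ring lra.

Set Implicit Arguments.
Unset Strict Implicit.
Unset Printing Implicit Defensive.

Import Order.TTheory GRing.Theory Num.Theory.
Import numFieldNormedType.Exports.

Local Open Scope classical_set_scope.
Local Open Scope ring_scope.

(** The law of the spectrum is studied through the resolvent trace, the average
  of [1 / (z + t)] over the eigenvalues [z], at countably many points [t >= 2].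

  Convergence of the trace.  Put [n = N l] and [tau = n t]. Splitting off row
  [i] of the matrix [X] is a rank-one change of [X^* X], and it gives
  [f_i (1 + q_i) = 1], where [f_i] is [tau] times the [i]-th diagonal entry of
  [(X X^* + tau)^-1] and [q_i] is the quadratic form of row [i] in the
  resolvent of the other rows ([gres_adj_diag]). Row [i] is independent of
  that resolvent, so [q_i] is close to the partial trace of
  [(X^* X + tau)^-1] over the columns [j] of row [i] that lie in the diagram
  ([quad_dev_var]). Rows and columns together thus nearly solve
  [T_i (1 + tau^-1 sum_(j ~ i) T_j) = 1], which for [t >= 2] is a contraction
  and therefore stable ([trace_dist]). Its solution is constant on the blocks
  of the dilated diagram, so that only the equation
  [T_a (1 + (l t)^-1 sum_(b ~ a) T_b) = 1] over the [l] labels remains. That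
  is the functional equation satisfied by the generating functions of the
  labelled plane trees with root label [a], because a tree is cut into two by
  removing the first subtree of its root ([num_rootedS]). Consequently the
  limit [g t = (l t)^-1 sum_a T_a] has the asymptotic expansion
  [sum_k (-1)^k m_k / t^(k+1)] in which [m_k] is the number of trees on [k+1]
  vertices divided by [l^(k+1)] ([tree_transform_expansion]).

  Almost sure convergence with two moments.  The trace is stable under changes
  of the entries that are small in mean square ([gres_trace_perturb]). The
  entries may thus be replaced by finitely valued ones with mean square error
  [4^-N], and by a fixed bounded approximation where only an expectation is at
  stake. On the resulting finite product space the trace moves by at most
  [1 / tau] when a row changes, and the bounded differences inequality gives
  exponential concentration ([upper_tail]); the Borel-Cantelli lemma concludes
  ([ae_trace_cvg]).

  From traces to laws.  Differences of the functions [1 / (x + t)] near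
  [t = 2] produce the powers of [1 / (x + 2)], and polynomials in
  [1 / (x + 2)] approximate steps. So any two sequences of point sets on the
  half line with the same limits of traces have asymptotically interlacing
  distribution functions ([edf_interlace]). A single good outcome then defines
  a law to which the spectra of all good outcomes converge, the transform of
  that law is [g], and its moments are read off the expansion of [g] at
  infinity ([integral_moment]). *)

(** * Resolvents of Gram matrices *)

Section Resolvent.
Variable C : numClosedFieldType.
Implicit Types (m n : nat) (t : C).

Definition adjmx m n (A : 'M[C]_(m, n)) : 'M[C]_(n, m) := (map_mx Num.conj A)^T.

Lemma adjmxE m n (A : 'M[C]_(m, n)) i j : adjmx A i j = (A j i)^*.
Proof. by rewrite !mxE. Qed.

Lemma adjmxK m n (A : 'M[C]_(m, n)) : adjmx (adjmx A) = A.
Proof. by apply/matrixP => i j; rewrite !adjmxE conjCK. Qed.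

Lemma adjmxM m n p (A : 'M[C]_(m, n)) (B : 'M[C]_(n, p)) :
  adjmx (A *m B) = adjmx B *m adjmx A.
Proof. by rewrite /adjmx map_mxM trmx_mul. Qed.

Lemma adjmxD m n (A B : 'M[C]_(m, n)) : adjmx (A + B) = adjmx A + adjmx B.
Proof. by rewrite /adjmx map_mxD linearD. Qed.

Lemma adjmxB m n (A B : 'M[C]_(m, n)) : adjmx (A - B) = adjmx A - adjmx B.
Proof. by rewrite /adjmx map_mxB linearB. Qed.

Lemma adjmx_scalar n t : t^* = t -> adjmx (t%:M : 'M[C]_n) = t%:M.
Proof. by move=> tt; rewrite /adjmx map_scalar_mx /= tr_scalar_mx tt. Qed.

Definition sqnorm n (u : 'rV[C]_n) : C := \sum_j `|u 0 j| ^+ 2.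

Lemma sqnorm_ge0 n (u : 'rV[C]_n) : 0 <= sqnorm u.
Proof. by apply: sumr_ge0 => j _; rewrite exprn_ge0. Qed.

Lemma sqnormE n (u : 'rV[C]_n) : (u *m adjmx u) 0 0 = sqnorm u.
Proof. by rewrite mxE; apply: eq_bigr => j _; rewrite adjmxE -normCK. Qed.

Lemma sqnorm_eq0 n (u : 'rV[C]_n) : sqnorm u = 0 -> u = 0.
Proof.
move/eqP; rewrite psumr_eq0 => [/allP u0|j _]; last by rewrite exprn_ge0.
apply/rowP => j; rewrite mxE; apply/eqP.
by have := u0 j (mem_index_enum _); rewrite sqrf_eq0 normr_eq0.
Qed.

Definition gram t m n (A : 'M[C]_(m, n)) : 'M[C]_n := adjmx A *m A + t%:M.

(** The resolvent of [adjmx A *m A] at the point [- t]. *)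
Definition gres t m n (A : 'M[C]_(m, n)) : 'M[C]_n := invmx (gram t A).

Section Gram.
Variables (t : C) (m n : nat) (A : 'M[C]_(m, n)).
Hypothesis t0 : 0 < t.

Let tJ : t^* = t. Proof. by apply: conj_Creal; rewrite gtr0_real. Qed.

Lemma gram_herm : adjmx (gram t A) = gram t A.
Proof. by rewrite adjmxD adjmxM adjmxK adjmx_scalar. Qed.

Lemma gram_form (w : 'rV[C]_n) :
  (w *m gram t A *m adjmx w) 0 0 = sqnorm (w *m adjmx A) + t * sqnorm w.
Proof.
rewrite mulmxDr mulmxDl mul_mx_scalar -scalemxAl [LHS]mxE [X in _ + X]mxE.
by rewrite sqnormE -(sqnormE (w *m _)) adjmxM adjmxK !mulmxA.
Qed.

Lemma gram_unit : gram t A \in unitmx.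
Proof.
rewrite -row_free_unit; apply: inj_row_free => w wA; apply: sqnorm_eq0.
have := gram_form w; rewrite wA mul0mx mxE => /esym/eqP.
rewrite paddr_eq0 ?sqnorm_ge0// ?mulr_ge0 ?sqnorm_ge0 ?ltW//.
by case/andP=> _; rewrite mulf_eq0 gt_eqF//= => /eqP.
Qed.

Lemma gres_mulV : gres t A *m gram t A = 1%:M.
Proof. exact: mulVmx gram_unit. Qed.

Lemma gres_mulC : gram t A *m gres t A = 1%:M.
Proof. exact: mulmxV gram_unit. Qed.

Lemma gres_uniq (H : 'M[C]_n) : gram t A *m H = 1%:M -> H = gres t A.
Proof. by move=> AH; rewrite -[H]mul1mx -gres_mulV -mulmxA AH mulmx1. Qed.

Lemma gres_herm : adjmx (gres t A) = gres t A.
Proof.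
apply: gres_uniq; rewrite -[in LHS]gram_herm -adjmxM gres_mulV.
by rewrite adjmx_scalar ?conjC1.
Qed.

Lemma gres_form (a : 'rV[C]_n) : (a *m gres t A *m adjmx a) 0 0 =
  sqnorm (a *m gres t A *m adjmx A) + t * sqnorm (a *m gres t A).
Proof.
rewrite -gram_form adjmxM gres_herm -(mulmxA _ (gram t A)).
by rewrite (mulmxA (gram t A)) gres_mulC mul1mx.
Qed.

Lemma gres_form_ge0 (a : 'rV[C]_n) : 0 <= (a *m gres t A *m adjmx a) 0 0.
Proof.
by rewrite gres_form addr_ge0 ?sqnorm_ge0// mulr_ge0 ?sqnorm_ge0// ltW.
Qed.

Lemma gres_form_ge (a : 'rV[C]_n) :
  t * sqnorm (a *m gres t A) <= (a *m gres t A *m adjmx a) 0 0.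
Proof. by rewrite gres_form lerDr sqnorm_ge0. Qed.

Lemma delta_form (H : 'M[C]_n) j :
  (delta_mx (0 : 'I_1) j *m H *m adjmx (delta_mx (0 : 'I_1) j)) 0 0 = H j j.
Proof.
rewrite -rowE mxE (bigD1 j)//= big1 => [|k kj].
  by rewrite adjmxE !mxE !eqxx conjC1 mulr1 addr0.
by rewrite adjmxE !mxE eqxx (negPf kj) conjC0 mulr0.
Qed.

(** The norm part of [gres_form], evaluated at a basis vector. *)
Lemma gres_row_le j :
  t * \sum_k `|gres t A j k| ^+ 2 <= gres t A j j.
Proof.
rewrite -(delta_form (gres t A) j); apply: le_trans (gres_form_ge _).
by rewrite -rowE /sqnorm ler_pM2l// ler_sum// => k _; rewrite !mxE.
Qed.

Lemma gres_diag_ge0 j : 0 <= gres t A j j.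
Proof. by rewrite -(delta_form (gres t A) j) gres_form_ge0. Qed.

(** [gres_row_le] gives [t * H_jj ^+ 2 <= H_jj] for the resolvent [H]. *)
Lemma gres_diag_le j : t * gres t A j j <= 1.
Proof.
have H0 := gres_diag_ge0 j; have := gres_row_le j.
rewrite (bigD1 j)//= ger0_norm// => Hj.
have {Hj} : t * gres t A j j ^+ 2 <= gres t A j j.
  apply: le_trans Hj; rewrite ler_pM2l// lerDl.
  by apply: sumr_ge0 => k _; rewrite exprn_ge0.
move: H0; rewrite le_eqVlt => /orP[/eqP <-|H0]; first by rewrite mulr0 ler01.
by rewrite expr2 mulrA -[leRHS]mul1r ler_pM2r.
Qed.

Lemma gres_row_sqnorm j : \sum_k `|gres t A j k| ^+ 2 <= t ^- 2.
Proof.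
rewrite expr2 invfM ler_pdivlMl// (le_trans (gres_row_le j))//.
by rewrite -(ler_pM2l t0) mulfV ?gt_eqF// gres_diag_le.
Qed.

(** Multiplication by [A^* A + t] expands norms by at least [t]. *)
Lemma gres_contract (v : 'rV[C]_n) : t ^+ 2 * sqnorm (v *m gres t A) <= sqnorm v.
Proof.
set w := v *m gres t A.
have -> : v = w *m adjmx A *m A + t *: w.
  by rewrite -mul_mx_scalar -mulmxA -mulmxDr /w -mulmxA gres_mulV mulmx1.
set z := w *m adjmx A *m A.
have -> : sqnorm (z + t *: w) =
    sqnorm z + t ^+ 2 * sqnorm w + t * (sqnorm (w *m adjmx A) *+ 2).
  have zw : (z *m adjmx w) 0 0 = sqnorm (w *m adjmx A).
    by rewrite -sqnormE adjmxM adjmxK /z !mulmxA.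
  have wz : (w *m adjmx z) 0 0 = sqnorm (w *m adjmx A).
    by rewrite -sqnormE /z !adjmxM adjmxK !mulmxA.
  have tw : adjmx (t *: w) = t *: adjmx w.
    by apply/matrixP => i j; rewrite !mxE rmorphM/= tJ.
  rewrite -(sqnormE (_ + _)) adjmxD tw mulmxDl !mulmxDr -!scalemxAl -!scalemxAr.
  have add00 (X Y : 'M[C]_1) : (X + Y) 0 0 = X 0 0 + Y 0 0 by rewrite mxE.
  have scale00 k (X : 'M[C]_1) : (k *: X) 0 0 = k * X 0 0 by rewrite mxE.
  rewrite !add00 !scale00 zw wz !sqnormE; ring.
rewrite -addrA addrC -addrA lerDl addr_ge0 ?sqnorm_ge0//.
by rewrite mulr_ge0 ?mulrn_wge0 ?sqnorm_ge0 ?ltW.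
Qed.

End Gram.

Section RankOne.
Variables (t : C) (m m' n : nat) (A : 'M[C]_(m, n)) (B : 'M[C]_(m', n)).
Variable a : 'rV[C]_n.
Hypothesis t0 : 0 < t.
Hypothesis AB : adjmx A *m A = adjmx B *m B + adjmx a *m a.

Let q := (a *m gres t B *m adjmx a) 0 0.

Let q0 : 0 <= q. Proof. exact: gres_form_ge0. Qed.

Let q1 : 1 + q != 0. Proof. by rewrite gt_eqF// ltr_wpDr. Qed.

(** The Sherman-Morrison formula. *)
Lemma gres_rank_one : gres t A =
  gres t B - (1 + q)^-1 *: (gres t B *m adjmx a *m (a *m gres t B)).
Proof.
apply/esym/gres_uniq => //.
have -> : gram t A = gram t B + adjmx a *m a by rewrite /gram AB addrAC.
set H := gres t B; set b := a *m H.
have qE : a *m (H *m adjmx a) = q%:M by rewrite mulmxA [LHS]mx11_scalar.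
rewrite mulmxBr -scalemxAr mulmxDl gres_mulC// mulmxDl.
have -> : gram t B *m (H *m adjmx a *m b) = adjmx a *m b.
  by rewrite !mulmxA gres_mulC// mul1mx.
have -> : adjmx a *m a *m (H *m adjmx a *m b) = q *: (adjmx a *m b).
  rewrite -!mulmxA [a *m _]mulmxA [a *m _ *m _]mulmxA -(mulmxA a) qE.
  by rewrite mul_scalar_mx -scalemxAr.
rewrite -mulmxA -/b scalerDr scalerA -scalerDl -{1}(mulr1 (1 + q)^-1) -mulrDr.
by rewrite mulVf// scale1r addrK.
Qed.

Lemma gres_rank_one_diag j :
  gres t B j j - gres t A j j = (1 + q)^-1 * `|(a *m gres t B) 0 j| ^+ 2.
Proof.
set b := a *m gres t B.
have -> : gres t A j j =
    gres t B j j - (1 + q)^-1 * (gres t B *m adjmx a *m b) j j.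
  by rewrite gres_rank_one 3!mxE.
rewrite opprB addrCA subrr addr0; congr (_ * _).
have -> : gres t B *m adjmx a = adjmx b by rewrite adjmxM gres_herm.
by rewrite mxE big_ord1 adjmxE mulrC -normCK.
Qed.

Lemma gres_rank_one_form : (a *m gres t A *m adjmx a) 0 0 = q / (1 + q).
Proof.
rewrite gres_rank_one mulmxBr mulmxBl -scalemxAr -scalemxAl.
have -> : a *m (gres t B *m adjmx a *m (a *m gres t B)) *m adjmx a =
    q%:M *m q%:M by rewrite -[q%:M]mx11_scalar !mulmxA.
rewrite -scalar_mxM [LHS]mxE [X in _ + X]mxE -/q [X in _ - X]mxE.
by rewrite mxE eqxx mulr1n; field.
Qed.

(** [t] times the sum of all [`|(a H)_j| ^+ 2] is at most [q] by
    [gres_form_ge], and [q / (1 + q) <= 1]. *)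
Lemma gres_rank_one_sum (J : pred 'I_n) :
  0 <= \sum_(j | J j) (gres t B j j - gres t A j j) <= t^-1.
Proof.
have q10 : 0 < 1 + q by rewrite ltr_wpDr.
under eq_bigr do rewrite gres_rank_one_diag.
rewrite -mulr_sumr; apply/andP; split.
  apply: mulr_ge0; first by rewrite invr_ge0 ltW.
  by apply: sumr_ge0 => j _; rewrite exprn_ge0.
rewrite ler_pdivrMl// -(ler_pM2l t0) mulrCA mulfV ?gt_eqF// mulr1.
apply: le_trans (_ : q <= _); last by rewrite lerDr.
apply: le_trans (gres_form_ge _ _ _) => //; rewrite ler_pM2l// /sqnorm.
rewrite [leRHS](bigID J)/= lerDl; apply: sumr_ge0 => j _.
by rewrite exprn_ge0.
Qed.

Lemma gres_rank_one_trace : 0 <= \tr (gres t B) - \tr (gres t A) <= t^-1.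
Proof. by have := gres_rank_one_sum xpredT; rewrite sumrB. Qed.

End RankOne.

Section PushThrough.
Variables (t : C) (m n : nat) (A : 'M[C]_(m, n)).
Hypothesis t0 : 0 < t.

(** The push-through identity between the resolvents of [A^* A] and [A A^*]. *)
Lemma gres_adj : t *: gres t (adjmx A) = 1%:M - A *m gres t A *m adjmx A.
Proof.
have E : gram t (adjmx A) *m (1%:M - A *m gres t A *m adjmx A) = t%:M.
  rewrite mulmxBr mulmx1 /gram adjmxK.
  have -> : (A *m adjmx A + t%:M) *m (A *m gres t A *m adjmx A) =
      A *m (gram t A *m gres t A) *m adjmx A.
    rewrite /gram mulmxDl mulmxDl mul_scalar_mx mulmxDr mulmxDl !mulmxA.
    by rewrite mul_mx_scalar -!scalemxAl.
  by rewrite gres_mulC// mulmx1 addrAC subrr add0r.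
have := congr1 (mulmx (gres t (adjmx A))) E.
by rewrite mulmxA gres_mulV// mul1mx mul_mx_scalar => ->.
Qed.

Lemma gres_adj_trace : t * \tr (gres t (adjmx A)) + n%:R = t * \tr (gres t A) + m%:R.
Proof.
rewrite -!mxtraceZ gres_adj linearB/= mxtrace1 -mulmxA mxtrace_mulC -mulmxA.
have -> : adjmx A *m A = gram t A - t%:M by rewrite addrK.
rewrite mulmxBr gres_mulV// linearB/= mxtrace1 mul_mx_scalar mxtraceZ; ring.
Qed.

End PushThrough.

Lemma gres_adj_trace_square t n (A : 'M[C]_n) : 0 < t ->
  \tr (gres t (adjmx A)) = \tr (gres t A).
Proof.
move=> t0; have /addIr /mulfI -> // := gres_adj_trace A t0.
by rewrite gt_eqF.
Qed.

Section RowRemoval.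
Variables (t : C) (m n : nat).
Hypothesis t0 : 0 < t.

Definition zero_row i (A : 'M[C]_(m, n)) : 'M[C]_(m, n) :=
  \matrix_(k, j) if k == i then 0 else A k j.

Lemma gram_zero_row i (A : 'M[C]_(m, n)) : adjmx A *m A =
  adjmx (zero_row i A) *m zero_row i A + adjmx (row i A) *m row i A.
Proof.
apply/matrixP => j k; rewrite !mxE (bigD1 i)//= addrC; congr (_ + _).
  rewrite [RHS](bigD1 i)//= !mxE eqxx conjC0 mul0r add0r.
  by apply: eq_bigr => l li; rewrite !mxE (negPf li).
by rewrite big_ord1 !mxE.
Qed.

(** The identity on which the self-consistent equation rests: row [i] is a
    rank-one part of [A^* A], and the resolvent in [q] does not contain it. *)
Lemma gres_adj_diag i (A : 'M[C]_(m, n)) :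
  let q := (row i A *m gres t (zero_row i A) *m adjmx (row i A)) 0 0 in
  t * gres t (adjmx A) i i * (1 + q) = 1.
Proof.
move=> q.
have q0 : 0 <= q by exact: gres_form_ge0.
have -> : t * gres t (adjmx A) i i = 1 - q / (1 + q).
  have := congr1 (fun M : 'M[C]_m => M i i) (gres_adj A t0).
  rewrite [LHS]mxE => ->; rewrite 3!mxE eqxx; congr (_ - _).
  rewrite -(gres_rank_one_form t0 (gram_zero_row i A)) -row_mul.
  by rewrite !mxE; apply: eq_bigr => j _; rewrite !mxE.
by field; rewrite gt_eqF// ltr_wpDr.
Qed.

(** Both traces lie within [t^-1] below the one obtained by zeroing row [i]. *)
Lemma gres_row_change i (A B : 'M[C]_(m, n)) :
  (forall k j, k != i -> A k j = B k j) ->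
  `|\tr (gres t A) - \tr (gres t B)| <= t^-1.
Proof.
move=> AB.
have zAB : zero_row i A = zero_row i B.
  by apply/matrixP => k j; rewrite !mxE; case: eqVneq => // /AB.
have /andP[A0 A1] := gres_rank_one_trace t0 (gram_zero_row i A).
have /andP[B0 B1] := gres_rank_one_trace t0 (gram_zero_row i B).
move: A0 A1 B0 B1; rewrite zAB; set z := \tr (gres t (zero_row _ _)).
set x := \tr (gres t A); set y := \tr (gres t B) => x0 x1 y0 y1.
have -> : x - y = (z - y) - (z - x) by ring.
have rl : (z - y) - (z - x) \is Num.real by rewrite realB// ger0_real.
rewrite (real_ler_norml _ rl); apply/andP; split.
  by rewrite -[leLHS]add0r lerB.
by rewrite -[leRHS]subr0 lerB.
Qed.

End RowRemoval.

(** * Perturbation of the resolvent trace *)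

Section Perturbation.
Variables (t k : C) (m n : nat).
Hypotheses (t0 : 0 < t) (k0 : 0 < k).

Definition frob p q (A : 'M[C]_(p, q)) : C := \sum_i \sum_j `|A i j| ^+ 2.

Lemma frob_rows p q (A : 'M[C]_(p, q)) : frob A = \sum_i sqnorm (row i A).
Proof. by apply: eq_bigr => i _; apply: eq_bigr => j _; rewrite mxE. Qed.

Lemma frob_adj p q (A : 'M[C]_(p, q)) : frob (adjmx A) = frob A.
Proof.
rewrite /frob exchange_big; apply: eq_bigr => i _; apply: eq_bigr => j _ /=.
by rewrite adjmxE norm_conjC.
Qed.

Lemma trace_mul_le p q (A : 'M[C]_(p, q)) (B : 'M[C]_(q, p)) :
  `|\tr (A *m B)| *+ 2 <= k * frob A + k^-1 * frob B.
Proof.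
have amgm (x y : C) : `|x * y| *+ 2 <= k * `|x| ^+ 2 + k^-1 * `|y| ^+ 2.
  rewrite normrM -subr_ge0.
  have -> : k * `|x| ^+ 2 + k^-1 * `|y| ^+ 2 - `|x| * `|y| *+ 2 =
    k^-1 * (k * `|x| - `|y|) ^+ 2 by field; rewrite gt_eqF.
  apply: mulr_ge0; first by rewrite invr_ge0 ltW.
  rewrite -realEsqr; apply: realB; last exact: normr_real.
  by apply: realM; [exact: gtr0_real|exact: normr_real].
rewrite -(frob_adj B) /frob /mxtrace.
apply: le_trans (_ : (\sum_i \sum_j `|A i j * B j i|) *+ 2 <= _).
  rewrite lerMn2r/=; apply: le_trans (ler_norm_sum _ _ _) _.
  by apply: ler_sum => i _; rewrite mxE; exact: ler_norm_sum.
rewrite 2!mulr_sumr -big_split/= -sumrMnl; apply: ler_sum => i _.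
rewrite 2!mulr_sumr -big_split/= -sumrMnl; apply: ler_sum => j _.
by rewrite adjmxE norm_conjC amgm.
Qed.

Lemma gres_frob (A : 'M[C]_(m, n)) : t * frob (A *m gres t A) <= n%:R.
Proof.
rewrite -frob_adj adjmxM gres_herm// frob_rows mulr_sumr.
rewrite -[n in leRHS]card_ord -sumr_const ler_sum// => j _.
apply: le_trans (gres_diag_le A t0 j); rewrite ler_pM2l//.
rewrite -(delta_form (gres t A) j) gres_form// -rowE row_mul lerDl.
by apply: mulr_ge0; [exact: ltW|exact: sqnorm_ge0].
Qed.

Lemma frob_mul_gres p (A : 'M[C]_(m, n)) (Z : 'M[C]_(p, n)) :
  t ^+ 2 * frob (Z *m gres t A) <= frob Z.
Proof.
rewrite !frob_rows mulr_sumr ler_sum// => i _; rewrite row_mul.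
exact: gres_contract.
Qed.

(** The resolvent identity, the difference of the Gram matrices being split so
    that each term carries exactly one factor [A - B]. *)
Lemma gres_diff (A B : 'M[C]_(m, n)) : gres t A - gres t B =
  - (gres t A *m adjmx A *m (A - B) *m gres t B +
     gres t A *m adjmx (A - B) *m (B *m gres t B)).
Proof.
have -> : gres t A *m adjmx A *m (A - B) *m gres t B +
     gres t A *m adjmx (A - B) *m (B *m gres t B) =
   gres t A *m (gram t A - gram t B) *m gres t B.
  rewrite /gram opprD addrACA subrr addr0 adjmxB !mulmxBr !mulmxBl !mulmxA.
  by rewrite addrA subrK.
by rewrite mulmxBr mulmxBl gres_mulV// mul1mx -mulmxA gres_mulC// mulmx1 opprB.
Qed.

(** The parameter [k] balances the two factors in the arithmetic-geometric
    inequality. With [t] of order [n] and [k] of order [n ^- 2], a Frobenius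
    distance of order less than [n ^+ 2] suffices: the entries only have to be
    close in mean square. *)
Lemma gres_trace_perturb (A B : 'M[C]_(m, n)) :
  `|\tr (gres t A) - \tr (gres t B)| <= k * frob (A - B) + n%:R / (k * t ^+ 3).
Proof.
have Z (X Y : 'M[C]_(m, n)) : frob (X *m gres t X *m gres t Y) <= n%:R / t ^+ 3.
  rewrite exprS invfM mulrA ler_pdivlMr ?exprn_gt0// mulrC.
  apply: le_trans (frob_mul_gres _ _) _; rewrite ler_pdivlMr// mulrC.
  exact: gres_frob.
have Z1 : k^-1 * frob (gres t B *m gres t A *m adjmx A) <= n%:R / (k * t ^+ 3).
  rewrite invfM mulrCA ler_pM2l ?invr_gt0// -frob_adj !adjmxM adjmxK !gres_herm//.
  by rewrite mulmxA Z.
have Z2 : k^-1 * frob (B *m gres t B *m gres t A) <= n%:R / (k * t ^+ 3).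
  by rewrite invfM mulrCA ler_pM2l ?invr_gt0//.
rewrite -linearB/= gres_diff// linearN/= normrN linearD/=.
suff: (`|\tr (gres t A *m adjmx A *m (A - B) *m gres t B)| +
    `|\tr (gres t A *m adjmx (A - B) *m (B *m gres t B))|) *+ 2 <=
    (k * frob (A - B) + n%:R / (k * t ^+ 3)) *+ 2.
  by rewrite lerMn2r/=; apply: le_trans; exact: ler_normD.
have -> : \tr (gres t A *m adjmx A *m (A - B) *m gres t B) =
    \tr ((A - B) *m (gres t B *m gres t A *m adjmx A)).
  by rewrite -!mulmxA mulmxA mxtrace_mulC !mulmxA.
have -> : \tr (gres t A *m adjmx (A - B) *m (B *m gres t B)) =
    \tr (adjmx (A - B) *m (B *m gres t B *m gres t A)).
  by rewrite -!mulmxA mxtrace_mulC !mulmxA.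
rewrite mulrnDl [leRHS]mulr2n; apply: lerD.
  by apply: le_trans (trace_mul_le _ _) _; rewrite lerD2l.
by apply: le_trans (trace_mul_le _ _) _; rewrite frob_adj lerD2l.
Qed.

End Perturbation.
End Resolvent.

(** * Finite product spaces *)

Section Product.
Variables (K : numDomainType) (I U : finType) (p : U -> K).
Implicit Types (w : {ffun I -> U}) (f g : {ffun I -> U} -> K) (i : I).

Definition weight w : K := \prod_i p (w i).
Definition expect f : K := \sum_w weight w * f w.
Definition upd w i (u : U) : {ffun I -> U} := [ffun j => if j == i then u else w j].
Definition avg i f w : K := \sum_u p u * f (upd w i u).
Definition free_of i f := forall w u, f (upd w i u) = f w.

Lemma updE w i u j : upd w i u j = if j == i then u else w j.
Proof. by rewrite ffunE. Qed.

Lemma upd_upd w i u v : upd (upd w i u) i v = upd w i v.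
Proof. by apply/ffunP => j; rewrite !updE; case: eqP. Qed.

Lemma upd_id w i : upd w i (w i) = w.
Proof. by apply/ffunP => j; rewrite updE; case: eqP => // ->. Qed.

Lemma updC w i j u v : i != j -> upd (upd w i u) j v = upd (upd w j v) i u.
Proof.
move=> ij; apply/ffunP => k; rewrite !updE.
by case: (eqVneq k j) => [->|//]; rewrite eq_sym (negPf ij).
Qed.

Lemma expectD f g : expect (fun w => f w + g w) = expect f + expect g.
Proof. by rewrite /expect -big_split/=; apply: eq_bigr => w _; rewrite mulrDr. Qed.

Lemma expectZ k f : expect (fun w => k * f w) = k * expect f.
Proof. by rewrite /expect mulr_sumr; apply: eq_bigr => w _; rewrite mulrCA. Qed.

Lemma expect_sum (J : Type) (r : seq J) (P : pred J) (F : J -> {ffun I -> U} -> K) :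
  expect (fun w => \sum_(j <- r | P j) F j w) = \sum_(j <- r | P j) expect (F j).
Proof.
by rewrite /expect exchange_big/=; apply: eq_bigr => w _; rewrite mulr_sumr.
Qed.

Lemma eq_expect f g : f =1 g -> expect f = expect g.
Proof. by move=> fg; apply: eq_bigr => w _; rewrite fg. Qed.

Hypothesis p0 : forall u, 0 <= p u.

Lemma weight_ge0 w : 0 <= weight w.
Proof. by apply: prodr_ge0. Qed.

Lemma expect_ge0 f : (forall w, 0 <= f w) -> 0 <= expect f.
Proof. by move=> f0; apply: sumr_ge0 => w _; rewrite mulr_ge0 ?weight_ge0. Qed.

Lemma le_expect f g : (forall w, f w <= g w) -> expect f <= expect g.
Proof. by move=> fg; apply: ler_sum => w _; rewrite ler_wpM2l ?weight_ge0. Qed.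

Lemma norm_expect f : `|expect f| <= expect (fun w => `|f w|).
Proof.
apply: le_trans (ler_norm_sum _ _ _) _; apply: ler_sum => w _.
by rewrite normrM (ger0_norm (weight_ge0 w)).
Qed.

Hypothesis p1 : \sum_u p u = 1.

Lemma weight_sum : \sum_w weight w = 1.
Proof. by rewrite -(bigA_distr_bigA (fun _ => p)) big1. Qed.

Lemma expect_cst k : expect (fun=> k) = k.
Proof. by rewrite /expect -mulr_suml weight_sum mul1r. Qed.

Lemma weight_upd w i u : weight w * p u = weight (upd w i u) * p (w i).
Proof.
rewrite /weight (bigD1 i)//= [in RHS](bigD1 i)//= updE eqxx.
rewrite [in RHS](eq_bigr (fun j => p (w j))) => [|j ji].
  by rewrite mulrAC [RHS]mulrAC (mulrC (p u)) -!mulrA; congr (_ * _); rewrite mulrC.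
by rewrite updE (negPf ji).
Qed.

(** Exchanging the value of coordinate [i] with an independent copy preserves the
    weight. *)
Lemma expect_avg i f : expect (avg i f) = expect f.
Proof.
transitivity (\sum_(wu : {ffun I -> U} * U)
    weight wu.1 * p wu.2 * f (upd wu.1 i wu.2)).
  rewrite -(pair_bigA _ (fun w u => weight w * p u * f (upd w i u)))/=.
  by apply: eq_bigr => w _; rewrite mulr_sumr; apply: eq_bigr => u _; rewrite mulrA.
pose h (wu : {ffun I -> U} * U) := (upd wu.1 i wu.2, wu.1 i).
have hK : involutive h.
  by case=> w u; rewrite /h/= upd_upd upd_id updE eqxx.
rewrite (reindex_inj (inv_inj hK))/=.
under eq_bigr do rewrite -weight_upd upd_upd upd_id.
rewrite -(pair_bigA _ (fun w u => weight w * p u * f w))/=.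
apply: eq_bigr => w _; rewrite -mulr_suml -mulr_sumr p1 mulr1 //.
Qed.

Lemma free_avg i f : free_of i (avg i f).
Proof. by move=> w u; apply: eq_bigr => v _; rewrite upd_upd. Qed.

Lemma free_avg_neq i j f : free_of i f -> free_of i (avg j f).
Proof.
move=> fi; case: (eqVneq j i) => [->|ji]; first exact: free_avg.
by move=> w u; apply: eq_bigr => v _; rewrite updC ?fi// eq_sym.
Qed.

(** Independence of coordinate [i] from a function that is free of it. *)
Lemma expect_factor i (g : U -> K) f : free_of i f ->
  expect (fun w => g (w i) * f w) = (\sum_u p u * g u) * expect f.
Proof.
move=> fi; rewrite -(expect_avg i) -expectZ; apply: eq_expect => w.
by rewrite /avg mulr_suml; apply: eq_bigr => u _; rewrite fi updE eqxx mulrA.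
Qed.

End Product.

(** * Bounded differences *)

Section BoundedDifferences.
Variables (R : realType) (I U : finType) (p : U -> R).
Hypothesis p0 : forall u, 0 <= p u.
Hypothesis p1 : \sum_u p u = 1.
Implicit Types (f g : {ffun I -> U} -> R).

Lemma expR_le_quad (x : R) : `|x| <= 2^-1 -> expR x <= 1 + x + 2 * x ^+ 2.
Proof.
rewrite ler_norml => /andP[xl xr].
have x1 : 0 < 1 - x by lra.
have : 1 - x <= expR (- x) by exact: expR_ge1Dx.
rewrite expRN -(ler_pV2 (x := (expR x)^-1)) ?inE ?unitfE; last 2 first.
- by rewrite invr_gt0 expR_gt0 gt_eqF ?invr_gt0 ?expR_gt0.
- by rewrite x1 gt_eqF.
rewrite invrK => /le_trans; apply; rewrite -[leLHS]mul1r ler_pdivrMr//.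
have : 0 <= x ^+ 2 * (1 - 2 * x) by rewrite mulr_ge0 ?sqr_ge0//; lra.
lra.
Qed.

Lemma avg_diff (c : R) f : (forall i w u v, `|f (upd w i u) - f (upd w i v)| <= c) ->
  forall i w u, `|f (upd w i u) - avg p i f w| <= c.
Proof.
move=> fc i w u; rewrite -[f _ in X in X <= _]mul1r -p1 mulr_suml /avg -sumrB.
apply: le_trans (ler_norm_sum _ _ _) _; rewrite -[leRHS]mul1r -p1 mulr_suml.
by apply: ler_sum => v _; rewrite -mulrBr normrM (ger0_norm (p0 v)) ler_wpM2l.
Qed.

Lemma avg_osc (c : R) i f : (forall i w u v, `|f (upd w i u) - f (upd w i v)| <= c) ->
  forall j w u v, `|avg p i f (upd w j u) - avg p i f (upd w j v)| <= c.
Proof.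
move=> fc j w u v.
have c0 : 0 <= c by apply: le_trans (normr_ge0 _) (fc j w u v).
case: (eqVneq i j) => [->|ij].
  by rewrite !free_avg subrr normr0.
rewrite /avg -sumrB; apply: le_trans (ler_norm_sum _ _ _) _.
rewrite -[leRHS]mul1r -p1 mulr_suml; apply: ler_sum => x _.
have ji : j != i by rewrite eq_sym.
by rewrite -mulrBr normrM (ger0_norm (p0 x)) ler_wpM2l// !(updC _ _ _ ji).
Qed.

(** Averaging one coordinate after the other yields the Doob martingale of [f],
    which ends at the expectation ([expect_avgs_enum]). *)
Definition avgs (s : seq I) f := foldl (fun g i => avg p i g) f s.

Lemma free_avgs i s f : free_of i f -> free_of i (avgs s f).
Proof. by elim: s f => //= j s IH f fi; apply/IH/free_avg_neq. Qed.

Lemma free_avgs_mem i s f : i \in s -> free_of i (avgs s f).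
Proof.
elim: s f => //= j s IH f; rewrite inE => /orP[/eqP->|/IH]; last exact.
exact/free_avgs/free_avg.
Qed.

Lemma expect_avgs s f : expect p (avgs s f) = expect p f.
Proof. by elim: s f => //= i s IH f; rewrite IH expect_avg. Qed.

Lemma free_all_cst f : (forall i, free_of i f) -> forall w w', f w = f w'.
Proof.
move=> fi w w'.
pose mix s := foldr (fun i v => upd v i (w i)) w' s.
have fmix s : f (mix s) = f w' by elim: s => //= i s IH; rewrite fi.
have mixE s j : mix s j = if j \in s then w j else w' j.
  elim: s => //= i s IH; rewrite updE inE IH.
  by case: eqVneq => // ->.
rewrite -(fmix (enum I)); congr f; apply/ffunP => j.
by rewrite mixE mem_enum.
Qed.

Lemma expect_avgs_enum f w : avgs (enum I) f w = expect p f.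
Proof.
rewrite -(expect_avgs (enum I)) -[LHS](expect_cst I p1); apply: eq_expect => w'.
by apply: free_all_cst => i; apply: free_avgs_mem; rewrite mem_enum.
Qed.

(** A centred martingale increment bounded by [c] has exponential moment at most
    [1 + 2 (s c)^2], since the linear term of [expR_le_quad] averages out. *)
Lemma exp_moment_avgs (c s : R) r f : 0 <= s -> s * c <= 2^-1 ->
  (forall i w u v, `|f (upd w i u) - f (upd w i v)| <= c) ->
  expect p (fun w => expR (s * (f w - avgs r f w))) <=
    (1 + 2 * (s * c) ^+ 2) ^+ size r.
Proof.
move=> s0 sc; elim: r f => [|i r IH] f fc.
  rewrite /= expr0 (eq_expect _ (g := fun=> 1)) ?expect_cst// => w.
  by rewrite subrr mulr0 expR0.
have c0 (w : {ffun I -> U}) : 0 <= c by apply: le_trans (normr_ge0 _) (fc i w (w i) (w i)).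
pose g := avg p i f.
pose h w := expR (s * (g w - avgs r g w)).
have hi : free_of i h.
  move=> w u; rewrite /h /g (free_avg p i f w u) (_ : avgs r _ (upd w i u) = avgs r g w)//.
  by apply: free_avgs; exact: free_avg.
rewrite [size _]/= exprS.
apply: le_trans (_ : (1 + 2 * (s * c) ^+ 2) * expect p h <= _); last first.
  apply: ler_wpM2l; last by apply: IH; exact: avg_osc.
  by rewrite addr_ge0// mulr_ge0// sqr_ge0.
rewrite -expectZ -(expect_avg p1 i); apply: le_expect => // w.
have -> : avg p i (fun w => expR (s * (f w - avgs (i :: r) f w))) w =
    (\sum_u p u * expR (s * (f (upd w i u) - g w))) * h w.
  rewrite /avg mulr_suml; apply: eq_bigr => u _.
  rewrite -mulrA -[h w](hi w u) -expRD -mulrDr; congr (_ * expR (_ * _)).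
  by rewrite /= /g (free_avg p i f w u); ring.
rewrite ler_wpM2r ?expR_ge0//.
have fg u : `|f (upd w i u) - g w| <= c by exact: avg_diff.
apply: le_trans (_ : \sum_u p u * (1 + 2 * (s * c) ^+ 2 + s * (f (upd w i u) - g w)) <= _).
  apply: ler_sum => u _; rewrite ler_wpM2l//.
  have sfg : `|s * (f (upd w i u) - g w)| <= s * c.
    by rewrite normrM (ger0_norm s0) ler_wpM2l.
  apply: le_trans (expR_le_quad (le_trans sfg sc)) _.
  rewrite addrAC lerD2r lerD2l ler_pM2l// -[leLHS]real_normK ?num_real//.
  by rewrite lerXn2r ?nnegrE// mulr_ge0 ?(c0 w).
under eq_bigr do rewrite mulrDr; rewrite big_split/= -mulr_suml p1 mul1r.
rewrite -[leRHS]addr0 lerD2l; under eq_bigr do rewrite mulrCA.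
rewrite -mulr_sumr; under eq_bigr do rewrite mulrBr.
by rewrite sumrB -mulr_suml p1 mul1r subrr mulr0.
Qed.

(** The bounded differences inequality, by the exponential Markov bound. *)
Lemma upper_tail (c s e : R) f : 0 <= s -> s * c <= 2^-1 ->
  (forall i w u v, `|f (upd w i u) - f (upd w i v)| <= c) ->
  \sum_(w | e <= f w - expect p f) weight p w <=
    expR (#|I|%:R * (2 * (s * c) ^+ 2) - s * e).
Proof.
move=> s0 sc fc.
apply: le_trans (_ : expR (- (s * e)) *
  expect p (fun w => expR (s * (f w - avgs (enum I) f w))) <= _).
  rewrite -expectZ /expect [leRHS](bigID (fun w => e <= f w - expect p f))/=.
  rewrite -[leLHS]addr0; apply: lerD.
    apply: ler_sum => w ew; rewrite -[leLHS]mulr1 ler_wpM2l ?weight_ge0//.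
    rewrite -expRD expect_avgs_enum; apply: le_trans (expR_ge1Dx _).
    by rewrite lerDl addrC subr_ge0 ler_wpM2l.
  by apply: sumr_ge0 => w _; rewrite !mulr_ge0 ?weight_ge0 ?expR_ge0.
rewrite addrC expRD ler_pM2l ?expR_gt0//.
apply: le_trans (exp_moment_avgs _ s0 sc fc) _.
rewrite -cardE expRM_natl lerXn2r ?nnegrE ?expR_ge0 ?expR_ge1Dx//.
by rewrite addr_ge0// mulr_ge0// sqr_ge0.
Qed.

End BoundedDifferences.

(** * Quadratic forms in independent entries *)

Section QuadraticForm.
Variables (C : numClosedFieldType) (V : finType) (p : V -> C) (n : nat).
Variables (y : V -> C) (B s2 : C) (mask : pred 'I_n) (H : 'M[C]_n).
Hypothesis p0 : forall v, 0 <= p v.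
Hypothesis p1 : \sum_v p v = 1.
Hypothesis y_le : forall v, `|y v| <= B.
Hypothesis y_mean : \sum_v p v * y v = 0.
Hypothesis y_var : \sum_v p v * `|y v| ^+ 2 = s2.
Hypothesis H_herm : forall j k, H k j = (H j k)^*.

Local Notation Om := {ffun 'I_n -> V}.
Implicit Types (u : Om) (j k l m : 'I_n).

Definition random_row u : 'rV[C]_n := \row_j if mask j then y (u j) else 0.

Local Notation a := random_row.

Definition quad_dev u : C :=
  (a u *m H *m adjmx (a u)) 0 0 - s2 * \sum_(j | mask j) H j j.

Let xi j k u : C :=
  a u 0 j * (a u 0 k)^* - (if (j == k) && mask j then s2 else 0).

Let quad_devE u : quad_dev u = \sum_(e : 'I_n * 'I_n) H e.1 e.2 * xi e.1 e.2 u.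
Proof.
rewrite -(pair_bigA _ (fun j k => H j k * xi j k u))/=.
under [RHS]eq_bigr do (under eq_bigr do rewrite mulrBr; rewrite sumrB).
rewrite sumrB; congr (_ - _).
  rewrite mxE; under eq_bigr do rewrite mxE mulr_suml.
  rewrite exchange_big; apply: eq_bigr => j _; apply: eq_bigr => k _ /=.
  by rewrite [adjmx _ _ _]adjmxE mulrCA mulrA.
rewrite mulr_sumr big_mkcond; apply: eq_bigr => j _.
rewrite (bigD1 j)//= eqxx/= big1 ?addr0 => [|k kj].
  by case: ifP => _; rewrite ?mulr0// mulrC.
by rewrite eq_sym (negPf kj) mulr0.
Qed.

Let y2 : s2 = \sum_v p v * (y v * (y v)^*).
Proof. by rewrite -y_var; apply: eq_bigr => v _; rewrite normCK. Qed.

Let y_meanJ : \sum_v p v * (y v)^* = 0.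
Proof.
have /(congr1 Num.conj) := y_mean; rewrite rmorph_sum rmorph0 => E.
rewrite -[RHS]E.
apply: eq_bigr => v _; rewrite rmorphM/=; congr (_ * _).
by apply/esym/conj_Creal; rewrite ger0_real.
Qed.

Let a_upd j k u v : k != j -> a (upd u j v) 0 k = a u 0 k.
Proof. by move=> kj; rewrite !mxE updE (negPf kj). Qed.

Let xi_upd j k l u v : k != j -> l != j -> xi k l (upd u j v) = xi k l u.
Proof. by move=> kj lj; rewrite /xi !a_upd. Qed.

Let decor_a j (f : Om -> C) : free_of j f -> expect p (fun u => a u 0 j * f u) = 0.
Proof.
move=> fj; rewrite (eq_expect _ (g := fun u => (if mask j then y (u j) else 0) * f u)).
  rewrite (expect_factor p1 (fun v => if mask j then y v else 0))//.
  by case: (mask j); rewrite ?y_mean ?mul0r// big1 ?mul0r// => v _; rewrite mulr0.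
by move=> u; rewrite mxE.
Qed.

Let decor_aJ j (f : Om -> C) :
  free_of j f -> expect p (fun u => (a u 0 j)^* * f u) = 0.
Proof.
move=> fj; rewrite (eq_expect _ (g := fun u => (if mask j then (y (u j))^* else 0) * f u)).
  rewrite (expect_factor p1 (fun v => if mask j then (y v)^* else 0))//.
  by case: (mask j); rewrite ?y_meanJ ?mul0r// big1 ?mul0r// => v _; rewrite mulr0.
by move=> u; rewrite mxE; case: ifP; rewrite ?conjC0.
Qed.

Let decor_xi j (f : Om -> C) : free_of j f -> expect p (fun u => xi j j u * f u) = 0.
Proof.
move=> fj; pose g v := if mask j then y v * (y v)^* - s2 else 0.
rewrite (eq_expect _ (g := fun u => g (u j) * f u)).
  rewrite (expect_factor p1 g)// /g; case: (mask j); last first.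
    by rewrite big1 ?mul0r// => v _; rewrite mulr0.
  under eq_bigr do rewrite mulrBr.
  by rewrite sumrB -mulr_suml p1 mul1r -y2 subrr mul0r.
by move=> u; rewrite /xi /g !mxE eqxx; case: (mask j); rewrite ?mul0r ?subr0 ?mul0r.
Qed.

Let xiJ j k u : (xi j k u)^* = xi k j u.
Proof.
rewrite /xi rmorphB rmorphM/= conjCK mulrC eq_sym; congr (_ - _).
case: eqP => [->|]/=; last by rewrite conjC0.
case: ifP => _; last by rewrite conjC0.
apply: conj_Creal; rewrite -y_var ger0_real// sumr_ge0// => v _.
by rewrite mulr_ge0 ?exprn_ge0.
Qed.

(* Unless the two pairs coincide up to order, some index occurs in only one
   centred factor, whose expectation splits off and vanishes. *)
Let xi_decor j k l m : (l, m) != (j, k) -> (l, m) != (k, j) ->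
  expect p (fun u => xi j k u * xi m l u) = 0.
Proof.
have off j' k' (f : Om -> C) : j' != k' -> free_of j' f ->
    expect p (fun u => xi j' k' u * f u) = 0.
  move=> jk fj; rewrite -(@decor_a j' (fun u => (a u 0 k')^* * f u)).
    by apply: eq_expect => u; rewrite /xi (negPf jk)/= subr0 mulrA.
  by move=> u v; rewrite fj a_upd// eq_sym.
have off' j' k' (f : Om -> C) : j' != k' -> free_of k' f ->
    expect p (fun u => xi j' k' u * f u) = 0.
  move=> jk fj; rewrite -(@decor_aJ k' (fun u => (a u 0 j') * f u)).
    by apply: eq_expect => u; rewrite /xi (negPf jk)/= subr0 mulrCA mulrA.
  by move=> u v; rewrite fj a_upd.
have sw : expect p (fun u => xi j k u * xi m l u) =
    expect p (fun u => xi m l u * xi j k u).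
  by apply: eq_expect => u; rewrite mulrC.
have fr i i' i'' : i != i'' -> i' != i'' -> free_of i'' (xi i i').
  by move=> h1 h2 u v; rewrite xi_upd.
have hj : l != j -> m != j -> expect p (fun u => xi j k u * xi m l u) = 0.
  move=> lj mj; have [jk|jk] := eqVneq j k; last by rewrite off//; exact: fr.
  by rewrite -jk decor_xi//; exact: fr.
have hk : l != k -> m != k -> expect p (fun u => xi j k u * xi m l u) = 0.
  move=> lj mj; have [jk|jk] := eqVneq j k; last by rewrite off'//; exact: fr.
  by rewrite jk decor_xi//; exact: fr.
have hl : l != j -> l != k -> expect p (fun u => xi j k u * xi m l u) = 0.
  rewrite ![l == _]eq_sym sw => lj lk; have [ml|ml] := eqVneq m l.
    by rewrite ml decor_xi//; exact: fr.
  by rewrite off'//; exact: fr.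
have hm : m != j -> m != k -> expect p (fun u => xi j k u * xi m l u) = 0.
  rewrite ![m == _]eq_sym sw => lj lk; have [ml|ml] := eqVneq m l.
    by rewrite -ml decor_xi//; exact: fr.
  by rewrite off//; exact: fr.
rewrite !xpair_eqE.
have [lj|lj] := eqVneq l j; have [mj|mj] := eqVneq m j;
  have [lk|lk] := eqVneq l k; have [mk|mk] := eqVneq m k => //= _ _;
  by [exact: hj|exact: hk|exact: hl|exact: hm].
Qed.

Let B0 (v : V) : 0 <= B. Proof. exact: le_trans (normr_ge0 _) (y_le v). Qed.

Let s2_le (v : V) : s2 <= B ^+ 2.
Proof.
rewrite -y_var -[leRHS]mul1r -p1 mulr_suml; apply: ler_sum => x _.
by rewrite ler_wpM2l// lerXn2r ?nnegrE ?(B0 v).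
Qed.

Let xi_le j k u : `|xi j k u| <= B ^+ 2 *+ 2.
Proof.
have v := u j; have B0' := B0 v.
have a_le i : `|a u 0 i| <= B by rewrite mxE; case: ifP => _; rewrite ?normr0.
apply: le_trans (ler_normB _ _) _; rewrite mulr2n; apply: lerD.
  by rewrite normrM norm_conjC expr2 ler_pM.
case: ifP => _; last by rewrite normr0 exprn_ge0.
rewrite ger0_norm ?(s2_le v)// -y_var sumr_ge0// => x _.
by rewrite mulr_ge0 ?exprn_ge0.
Qed.

(** After expanding the square, only the terms whose two index pairs agree up to
    order survive, so that the sum of the squared entries of [H] remains. *)
Lemma quad_dev_var : expect p (fun u => `|quad_dev u| ^+ 2) <=
  8 * B ^+ 4 * \sum_j \sum_k `|H j k| ^+ 2.
Proof.
pose c (e e' : 'I_n * 'I_n) := expect p (fun u => xi e.1 e.2 u * xi e'.2 e'.1 u).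
pose sw (e : 'I_n * 'I_n) := (e.2, e.1).
pose h (e : 'I_n * 'I_n) := H e.1 e.2.
have E : expect p (fun u => `|quad_dev u| ^+ 2) =
    \sum_e \sum_e' h e * (h e')^* * c e e'.
  rewrite (eq_expect _ (g := fun u => \sum_e \sum_e'
     h e * (h e')^* * (xi e.1 e.2 u * xi e'.2 e'.1 u))) => [|u].
    rewrite expect_sum; apply: eq_bigr => e _.
    by rewrite expect_sum; apply: eq_bigr => e' _; rewrite expectZ.
  rewrite normCK quad_devE rmorph_sum mulr_suml; apply: eq_bigr => e _.
  rewrite mulr_sumr; apply: eq_bigr => e' _.
  by rewrite rmorphM/= xiJ /h; ring.
have c_le e e' : `|c e e'| <= B ^+ 4 *+ 4 * ((e' == e)%:R + (e' == sw e)%:R).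
  have c4 : `|c e e'| <= B ^+ 4 *+ 4.
    apply: le_trans (norm_expect p0 _) _.
    rewrite -[leRHS](expect_cst 'I_n p1); apply: le_expect => // u.
    rewrite normrM; apply: le_trans (ler_pM _ _ (xi_le _ _ _) (xi_le _ _ _)) _ => //.
    by rewrite mulrnAl mulrnAr -mulrnA -exprD.
  have B4 : 0 <= B ^+ 4 *+ 4 by exact: le_trans (normr_ge0 _) c4.
  have [_|e1] := eqVneq e' e.
    apply: le_trans c4 _; rewrite -[leLHS]mulr1 ler_wpM2l//.
    by rewrite lerDl ler0n.
  have [_|e2] := eqVneq e' (sw e); first by rewrite add0r mulr1.
  rewrite addr0 mulr0 normr_le0; apply/eqP.
  by case: e e' e1 e2 {c4} => [j k] [l m] /= e1 e2; exact: xi_decor.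
have hsw e : `|h (sw e)| = `|h e| by rewrite /h/= H_herm norm_conjC.
have E0 : 0 <= expect p (fun u => `|quad_dev u| ^+ 2).
  by apply: expect_ge0 => // u; rewrite exprn_ge0.
rewrite -(ger0_norm E0) E (pair_bigA _ (fun j k => `|H j k| ^+ 2))/= mulr_sumr.
apply: le_trans (ler_norm_sum _ _ _) _; apply: ler_sum => e _.
apply: le_trans (ler_norm_sum _ _ _) _.
apply: le_trans (_ : \sum_e' `|h e| * `|h e'| *
    (B ^+ 4 *+ 4 * ((e' == e)%:R + (e' == sw e)%:R)) <= _).
  by apply: ler_sum => e' _; rewrite 2!normrM norm_conjC ler_wpM2l ?mulr_ge0.
under eq_bigr do rewrite !mulrDr; rewrite big_split/=.
rewrite (bigD1 e)//= [X in _ + X + _]big1 ?addr0 => [|e' /negPf->]; last first.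
  by rewrite !mulr0.
rewrite (bigD1 (sw e))//= [X in _ + (_ + X)]big1 ?addr0 => [|e' /negPf->]; last first.
  by rewrite !mulr0.
rewrite !eqxx hsw /h le_eqVlt; apply/orP; left; apply/eqP.
by rewrite mulr1; ring.
Qed.

End QuadraticForm.

(** * The self-consistent equation *)

Section SelfConsistency.
Variables (C : numClosedFieldType) (n : nat) (mask : rel 'I_n) (t : C).
Hypothesis t0 : 0 < t.
Implicit Types (M : 'M[C]_n).

Definition scaled_diag M i : C := t * gres t M i i.

Lemma scaled_diag_ge0 M i : 0 <= scaled_diag M i.
Proof. by apply: mulr_ge0; [exact: ltW|exact: gres_diag_ge0]. Qed.

Lemma scaled_diag_le1 M i : scaled_diag M i <= 1.
Proof. exact: gres_diag_le. Qed.

(** The defect of the self-consistent equation: the diagonal of the resolvent of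
    [M M^*] is expressed by that of the resolvent of [M^* M]. *)
Definition self_err M i : C := `|scaled_diag (adjmx M) i *
  (1 + t^-1 * \sum_(j | mask i j) scaled_diag M j) - 1|.

(** [1 + q] of [gres_adj_diag] minus its expected value over row [i], for entries
    of variance [s2]. *)
Definition row_dev (s2 : C) M i : C :=
  (row i M *m gres t (zero_row i M) *m adjmx (row i M)) 0 0 -
  s2 * \sum_(j | mask i j) gres t (zero_row i M) j j.

(** Besides the fluctuation of the quadratic form, zeroing row [i] changes the
    partial trace by at most [t^-1], and the variance [s2] may differ from 1. *)
Lemma self_err_le s2 M i : s2 \is Num.real ->
  self_err M i <= `|row_dev s2 M i| + t^-1 + `|1 - s2| * (n%:R / t).
Proof.
move=> s2r.
rewrite /self_err /scaled_diag -mulr_sumr mulrA mulVf ?gt_eqF// mul1r.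
have fi := gres_adj_diag t0 i M; move: fi => /=.
rewrite /row_dev; set q := (_ *m _) 0 0 => fi.
set S := \sum_(j | mask i j) gres t M j j.
set S0 := \sum_(j | mask i j) gres t (zero_row i M) j j.
have S01 : `|S0 - S| <= t^-1.
  have /andP[h0 h1] := gres_rank_one_sum t0 (gram_zero_row i M) (mask i).
  by move: h0 h1; rewrite sumrB => h0 h1; rewrite ger0_norm.
have S0n : `|S0| <= n%:R / t.
  rewrite -[n in leRHS]card_ord -sumr_const mulr_suml.
  rewrite (bigID (mask i) xpredT)/= -[leLHS]addr0; apply: lerD; last first.
    by apply: sumr_ge0 => j _; rewrite mul1r invr_ge0 ltW.
  apply: le_trans (ler_norm_sum _ _ _) _; apply: ler_sum => j _.
  by rewrite ger0_norm ?gres_diag_ge0// ler_pdivlMr// mulrC gres_diag_le.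
rewrite -[X in _ - X]fi -mulrBr.
have -> : 1 + S - (1 + q) = - (q - s2 * S0) - (S0 - S) + (1 - s2) * S0 by ring.
rewrite normrM -[leRHS]mul1r ler_pM//.
  by rewrite ger0_norm ?scaled_diag_le1// scaled_diag_ge0.
apply: le_trans (ler_normD _ _) _; apply: lerD; last first.
  by rewrite normrM ler_wpM2l.
apply: le_trans (ler_normB _ _) _; rewrite normrN; exact: lerD.
Qed.

Variable T : 'I_n -> C.
Hypothesis T01 : forall i, 0 <= T i <= 1.
Hypothesis T_fix : forall i, T i * (1 + t^-1 * \sum_(j | mask i j) T j) = 1.

Definition diag_dist M : C := \sum_i `|scaled_diag M i - T i|.

Lemma diag_dist_ge0 M : 0 <= diag_dist M.
Proof. by apply: sumr_ge0. Qed.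

(** Stability: subtracting the equation of [T] from that of the resolvents leaves
    the defect and the distance of the other family, damped by [n / t]. *)
Lemma diag_dist_adj M : diag_dist (adjmx M) <=
  \sum_i self_err M i + n%:R / t * diag_dist M.
Proof.
rewrite -[n in n%:R]card_ord -sumr_const mulr_suml mulr_suml -big_split/=.
apply: ler_sum => i _; rewrite mul1r.
set f := scaled_diag (adjmx M) i; set S := \sum_(j | mask i j) scaled_diag M j.
have S0 : 0 <= t^-1 * S.
  apply: mulr_ge0; first by rewrite invr_ge0 ltW.
  by apply: sumr_ge0 => j _; exact: scaled_diag_ge0.
apply: le_trans (_ : `|(f - T i) * (1 + t^-1 * S)| <= _).
  rewrite normrM -[leLHS]mulr1 ler_wpM2l// ger0_norm ?lerDl// addr_ge0//.
have -> : (f - T i) * (1 + t^-1 * S) = (f * (1 + t^-1 * S) - 1) +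
    T i * (t^-1 * (\sum_(j | mask i j) T j - S)).
  by rewrite mulrBl -[in X in _ - X + _](T_fix i); ring.
apply: le_trans (ler_normD _ _) _; rewrite lerD2l.
have /andP[Ti0 Ti1] := T01 i.
rewrite normrM (ger0_norm Ti0) -[leRHS]mul1r ler_pM// normrM.
rewrite gtr0_norm ?invr_gt0// ler_pM2l ?invr_gt0// -sumrB.
apply: le_trans (ler_norm_sum _ _ _) _.
rewrite /diag_dist [leRHS](bigID (mask i))/= -[leLHS]addr0; apply: lerD.
  by apply: ler_sum => j _; rewrite distrC.
by apply: sumr_ge0.
Qed.

(** The two inequalities of [diag_dist_adj], for [M] and for its adjoint, close
    up when [n / t <= 2^-1]. *)
Lemma trace_dist M : n%:R / t <= 2^-1 ->
  t * `|\tr (gres t (adjmx M)) - t^-1 * \sum_i T i| <=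
  2 * (\sum_i self_err M i + \sum_i self_err (adjmx M) i).
Proof.
move=> nt.
apply: le_trans (_ : diag_dist (adjmx M) <= _).
  rewrite -[t in t * _]gtr0_norm// -normrM mulrBr mulrA mulfV ?gt_eqF// mul1r.
  by rewrite /mxtrace mulr_sumr -sumrB; exact: ler_norm_sum.
have h1 := diag_dist_adj M; have := diag_dist_adj (adjmx M); rewrite adjmxK => h2.
have nt' x y : 0 <= x -> y <= n%:R / t * x -> y <= 2^-1 * x.
  by move=> x0 /le_trans; apply; rewrite ler_wpM2r.
set a := \sum_i _ in h1 *; set b := \sum_i _ in h2 *.
have {h1} : diag_dist (adjmx M) - a <= 2^-1 * diag_dist M.
  by apply: nt'; rewrite ?diag_dist_ge0// lerBlDl.
have {h2} : diag_dist M - b <= 2^-1 * diag_dist (adjmx M).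
  by apply: nt'; rewrite ?diag_dist_ge0// lerBlDl.
move: (diag_dist_ge0 M); set x := diag_dist M; set z := diag_dist (adjmx M).
move=> x0 h2 h1.
apply: le_trans (_ : z + x <= _); first by rewrite lerDl.
have := lerD h1 h2; rewrite -subr_ge0.
have -> : 2^-1 * x + 2^-1 * z - (z - a + (x - b)) = 2^-1 * (2 * (a + b) - (z + x)).
  by field.
by rewrite pmulr_rge0 ?invr_gt0 ?ltr0n// subr_ge0.
Qed.

End SelfConsistency.

Section RandomMatrix.
Variables (C : numClosedFieldType) (V : finType) (p : V -> C) (n : nat).
Variables (mask : rel 'I_n) (t : C).
Hypothesis p0 : forall v, 0 <= p v.
Hypothesis p1 : \sum_v p v = 1.
Hypothesis t0 : 0 < t.

Local Notation Row := {ffun 'I_n -> V}.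
Local Notation Om := {ffun 'I_n -> Row}.
Local Notation E := (expect (weight p : Row -> C)).

Definition array_mx (y : V -> C) (w : Om) : 'M[C]_n :=
  \matrix_(i, j) if mask i j then y (w i j) else 0.

Let P0 : forall u : Row, 0 <= weight p u. Proof. exact: weight_ge0. Qed.
Let P1 : \sum_(u : Row) weight p u = 1. Proof. exact: weight_sum. Qed.

Lemma array_mx_zero_row y i w u :
  zero_row i (array_mx y (upd w i u)) = zero_row i (array_mx y w).
Proof. by apply/matrixP => k j; rewrite !mxE updE; case: eqP. Qed.

Lemma bound_ge0 (y : V -> C) B : (forall v, `|y v| <= B) -> 0 <= B.
Proof.
move=> yB; case: (pickP (fun _ : V => true)) => [v _|V0].
  exact: le_trans (normr_ge0 _) (yB v).
by move: p1; rewrite big_pred0// => /esym/eqP; rewrite oner_eq0.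
Qed.

Section Moments.
Variables (y : V -> C) (B s2 eta : C).
Hypothesis y_le : forall v, `|y v| <= B.
Hypothesis y_mean : \sum_v p v * y v = 0.
Hypothesis y_var : \sum_v p v * `|y v| ^+ 2 = s2.
Hypothesis eta0 : 0 < eta.

(** Given the other rows, row [i] is a random row independent of the resolvent in
    [row_dev]; then [`|q| <= eta + `|q| ^+ 2 / eta]. *)
Lemma expect_row_dev i : E (fun w => `|row_dev mask t s2 (array_mx y w) i|) <=
  eta + 8 * B ^+ 4 * n%:R / t ^+ 2 / eta.
Proof.
rewrite -(expect_avg P1 i) -[leRHS](expect_cst 'I_n P1); apply: le_expect => // w.
pose H := gres t (zero_row i (array_mx y w)).
have -> : avg (weight p) i (fun w => `|row_dev mask t s2 (array_mx y w) i|) w =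
    expect p (fun u : Row => `|quad_dev y s2 (mask i) H u|).
  apply: eq_bigr => u _; rewrite /row_dev array_mx_zero_row /quad_dev -/H.
  have -> // : row i (array_mx y (upd w i u)) = random_row y (mask i) u.
  by apply/rowP => j; rewrite !mxE updE eqxx.
have Hh j k : H k j = (H j k)^*.
  by rewrite -adjmxE /H gres_herm.
have := @quad_dev_var _ _ p n y B s2 (mask i) H p0 p1 y_le y_mean y_var Hh.
set q := quad_dev _ _ _ _ => q_var.
apply: le_trans (_ : expect p (fun u => eta + eta^-1 * `|q u| ^+ 2) <= _).
  apply: le_expect => // u; rewrite -(ler_pM2l eta0) mulrDr mulrA mulfV ?gt_eqF//.
  rewrite mul1r -subr_ge0.
  have -> : eta * eta + `|q u| ^+ 2 - eta * `|q u| =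
    (eta - `|q u|) ^+ 2 + eta * `|q u| by ring.
  apply: addr_ge0; last by apply: mulr_ge0; [exact: ltW|].
  by rewrite -realEsqr realB// gtr0_real.
rewrite expectD expect_cst// expectZ lerD2l mulrC ler_pM2r ?invr_gt0//.
apply: le_trans q_var _; rewrite -(mulrA (8 * B ^+ 4)).
have B4 : 0 <= 8 * B ^+ 4 by rewrite mulr_ge0// exprn_ge0// (bound_ge0 y_le).
rewrite ler_wpM2l//.
rewrite -[n in leRHS]card_ord -sumr_const mulr_suml; apply: ler_sum => j _.
by rewrite mul1r gres_row_sqnorm.
Qed.

Lemma expect_self_err i : E (fun w => self_err mask t (array_mx y w) i) <=
  eta + 8 * B ^+ 4 * n%:R / t ^+ 2 / eta + t^-1 + `|1 - s2| * (n%:R / t).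
Proof.
have s2r : s2 \is Num.real.
  rewrite -y_var ger0_real// sumr_ge0// => v _.
  by rewrite mulr_ge0 ?exprn_ge0.
apply: le_trans (le_expect P0 (fun w => self_err_le mask t0 _ i s2r)) _.
under eq_expect do rewrite -addrA.
by rewrite expectD expect_cst// addrA !lerD2r expect_row_dev.
Qed.

End Moments.

Definition tr_array (w : Om) : Om := [ffun i => [ffun j => w j i]].

(** Transposition preserves the law of the array, which turns the estimate for
    rows into the one for columns. *)
Lemma expect_tr f : E (fun w => f (tr_array w)) = E f.
Proof.
have trK : involutive tr_array.
  by move=> w; apply/ffunP => i; apply/ffunP => j; rewrite !ffunE.
rewrite [RHS]/expect (reindex_inj (inv_inj trK)); apply: eq_bigr => w _ /=.
congr (_ * _); rewrite /weight exchange_big; apply: eq_bigr => i _ /=.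
by apply: eq_bigr => j _; rewrite !ffunE.
Qed.

Hypothesis mask_sym : symmetric mask.

Lemma array_mx_adj y w :
  adjmx (array_mx y w) = array_mx (fun v => (y v)^*) (tr_array w).
Proof.
apply/matrixP => i j; rewrite !mxE mask_sym !ffunE.
by case: ifP => _; rewrite ?conjC0.
Qed.

Section Mean.
Variables (y : V -> C) (B s2 eta : C) (T : 'I_n -> C).
Hypothesis y_le : forall v, `|y v| <= B.
Hypothesis y_mean : \sum_v p v * y v = 0.
Hypothesis y_var : \sum_v p v * `|y v| ^+ 2 = s2.
Hypothesis eta0 : 0 < eta.
Hypothesis T01 : forall i, 0 <= T i <= 1.
Hypothesis T_fix : forall i, T i * (1 + t^-1 * \sum_(j | mask i j) T j) = 1.
Hypothesis nt : n%:R / t <= 2^-1.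

Lemma expect_trace_dist :
  E (fun w => `|\tr (gres t (array_mx y w)) - t^-1 * \sum_i T i|) <=
  2 * (eta + 8 * B ^+ 4 * n%:R / t ^+ 2 / eta + t^-1 + `|1 - s2| * (n%:R / t)).
Proof.
set eps := (X in 2 * X).
have eps0 : 0 <= eps.
  have B0 := bound_ge0 y_le.
  by rewrite !addr_ge0 ?invr_ge0 ?mulr_ge0 ?invr_ge0 ?exprn_ge0 ?ler0n// ltW.
have e1 i : E (fun w => self_err mask t (array_mx y w) i) <= eps.
  exact: expect_self_err.
have e2 i : E (fun w => self_err mask t (adjmx (array_mx y w)) i) <= eps.
  under eq_expect do rewrite array_mx_adj.
  rewrite (expect_tr (fun w => self_err mask t (array_mx _ w) i)).
  apply: expect_self_err => // [v||].
  - by rewrite norm_conjC.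
  - have /(congr1 Num.conj) := y_mean; rewrite rmorph_sum rmorph0 => E0.
    rewrite -[RHS]E0; apply: eq_bigr => v _; rewrite rmorphM/=; congr (_ * _).
    by apply/esym/conj_Creal; rewrite ger0_real.
  - by rewrite -y_var; apply: eq_bigr => v _; rewrite norm_conjC.
rewrite -(ler_pM2l t0) -expectZ.
apply: le_trans (_ : E (fun w => 2 * (\sum_i self_err mask t (array_mx y w) i +
   \sum_i self_err mask t (adjmx (array_mx y w)) i)) <= _).
  apply: le_expect => // w; rewrite -gres_adj_trace_square//.
  exact: trace_dist.
rewrite expectZ expectD !expect_sum.
apply: le_trans (_ : 2 * (\sum_(i : 'I_n) eps + \sum_(i : 'I_n) eps) <= _).
  by rewrite ler_pM2l ?ltr0n// lerD//; apply: ler_sum.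
rewrite sumr_const card_ord -mulr2n -mulrnA mulrCA ler_pM2l ?ltr0n//.
rewrite -mulr_natl ler_wpM2r// natrM.
by move: nt; rewrite ler_pdivrMr// mulrC ler_pdivlMr ?ltr0n.
Qed.

End Mean.
End RandomMatrix.

(** * Real-valued form *)

Section RealForm.
Variables (R : realType) (V : finType) (p : V -> R) (n : nat) (mask : rel 'I_n).
Hypothesis p0 : forall v, 0 <= p v.
Hypothesis p1 : \sum_v p v = 1.
Hypothesis n0 : (0 < n)%N.
Variables t tau : R.
Hypothesis t2 : 2 <= t.
Hypothesis tauE : tau = n%:R * t.

Local Notation C := R[i].
Local Notation Row := {ffun 'I_n -> V}.
Local Notation Om := {ffun 'I_n -> Row}.
Local Notation E := (expect (weight p : Row -> R)).
Local Notation pC := (fun v => (p v)%:C%C : C).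
Local Notation EC := (expect (weight pC : Row -> C)).

Lemma norm_real_complex (x : R) : `|x%:C%C| = (`|x|)%:C%C :> C.
Proof. by rewrite normc_def /= expr0n addr0 sqrtr_sqr. Qed.

Lemma weight_complex (w : Om) : weight (weight pC : Row -> C) w = (weight (weight p : Row -> R) w)%:C%C.
Proof.
rewrite /weight rmorph_prod; apply: eq_bigr => i _.
by rewrite rmorph_prod.
Qed.

Lemma expect_complex (f : Om -> R) : EC (fun w => (f w)%:C%C) = (E f)%:C%C.
Proof.
rewrite /expect rmorph_sum; apply: eq_bigr => w _.
by rewrite weight_complex rmorphM.
Qed.

Let t0 : 0 < t. Proof. by apply: lt_le_trans t2; rewrite ltr0n. Qed.
Let tau0 : 0 < tau. Proof. by rewrite tauE mulr_gt0// ltr0n. Qed.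
Let tauC0 : 0 < tau%:C%C :> C. Proof. by rewrite ltcR. Qed.
Let pC0 v : 0 <= pC v. Proof. by rewrite lecR. Qed.
Let pC1 : \sum_v pC v = 1. Proof. by rewrite -rmorph_sum p1. Qed.
Let P0 : forall u : Row, 0 <= weight p u. Proof. exact: weight_ge0. Qed.
Let P1 : \sum_(u : Row) weight p u = 1. Proof. exact: weight_sum. Qed.

Definition resolvent_trace (A : 'M[C]_n) : R := complex.Re (\tr (gres tau%:C%C A)).

Lemma resolvent_traceE A : (resolvent_trace A)%:C%C = \tr (gres tau%:C%C A).
Proof.
apply: RRe_real; rewrite ger0_real// sumr_ge0// => i _.
exact: gres_diag_ge0.
Qed.

Lemma resolvent_traceB A B : (`|resolvent_trace A - resolvent_trace B|)%:C%C =
  `|\tr (gres tau%:C%C A) - \tr (gres tau%:C%C B)|.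
Proof. by rewrite -(resolvent_traceE A) -(resolvent_traceE B) -rmorphB norm_real_complex. Qed.

Definition array_trace (y : V -> C) (w : Om) : R := resolvent_trace (array_mx mask y w).

Lemma array_trace_osc y (i : 'I_n) (w : Om) (u v : Row) :
  `|array_trace y (upd w i u) - array_trace y (upd w i v)| <= tau^-1.
Proof.
rewrite -lecR resolvent_traceB fmorphV/=.
apply: (gres_row_change tauC0 (i := i)) => k j ki.
by rewrite !mxE !updE (negPf ki).
Qed.

Lemma array_trace_concentration y (e : R) : 0 < e -> e <= 1 ->
  \sum_(w : Om | e <= `|array_trace y w - E (array_trace y)|) weight (weight p : Row -> R) w <=
    2 * expR (- (e ^+ 2 / 8)) ^+ n.
Proof.
move=> e0 e1; have t2' := t2; have t0' := t0.
(* This exponent makes the quadratic term n (s / tau)^2 smaller than s e. *)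
pose s := n%:R * (e / 4).
have s0 : 0 <= s by rewrite mulr_ge0// divr_ge0// ltW.
have sc : s * tau^-1 = e / (4 * t).
  by rewrite /s tauE; field; rewrite ?gt_eqF ?ltr0n.
have sc2 : s * tau^-1 <= 2^-1.
  rewrite sc ler_pdivrMr ?mulr_gt0//; lra.
have expo : #|'I_n|%:R * (2 * (s * tau^-1) ^+ 2) - s * e <= - (e ^+ 2 / 8) * n%:R.
  rewrite card_ord sc /s.
  have -> : n%:R * (2 * (e / (4 * t)) ^+ 2) - n%:R * (e / 4) * e =
     n%:R * e ^+ 2 * (8^-1 * t ^- 2 - 4^-1) by field; rewrite gt_eqF.
  have -> : - (e ^+ 2 / 8) * n%:R = n%:R * e ^+ 2 * - 8^-1 by ring.
  have ne0 : 0 <= n%:R * e ^+ 2 by rewrite mulr_ge0 ?sqr_ge0.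
  rewrite ler_wpM2l//.
  have t21 : t ^- 2 <= 1 by rewrite invf_le1 ?exprn_gt0// exprn_ege1//; lra.
  lra.
have tail f : (forall i (w : Om) (u v : Row), `|f (upd w i u) - f (upd w i v)| <= tau^-1) ->
   \sum_(w : Om | e <= f w - E f) weight (weight p : Row -> R) w <= expR (- (e ^+ 2 / 8)) ^+ n.
  move=> fc; apply: le_trans (upper_tail P0 P1 e s0 sc2 fc) _.
  by rewrite -expRM_natr ler_expR.
have h1 := tail (array_trace y) (array_trace_osc y).
have h2 : \sum_(w : Om | e <= - array_trace y w - E (fun w => - array_trace y w))
    weight (weight p : Row -> R) w <= expR (- (e ^+ 2 / 8)) ^+ n.
  apply: tail => i w u v; rewrite -opprD normrN; exact: array_trace_osc.
have EN : E (fun w => - array_trace y w) = - E (array_trace y).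
  by rewrite /expect -sumrN; apply: eq_bigr => w _; rewrite mulrN.
rewrite mulr_natl mulr2n; apply: le_trans (lerD h1 h2).
rewrite big_mkcond [X in _ <= X + _]big_mkcond [X in _ <= _ + X]big_mkcond -big_split/=.
apply: ler_sum => w _; have w0 := weight_ge0 P0 w.
rewrite EN opprK; case: ifPn => [|_]; last by case: ifP; case: ifP; rewrite ?addr0 ?add0r// addr_ge0.
rewrite ler_normr => /orP[->|]; first by rewrite lerDl; case: ifP.
by rewrite opprB [- array_trace y w + _]addrC => ->; rewrite lerDr; case: ifP.
Qed.

Section Mean.
Variables (y z : V -> C) (B s2 dl eta k : R) (T : 'I_n -> R).
Hypothesis z_le : forall v, `|z v| <= B%:C%C.
Hypothesis z_mean : \sum_v pC v * z v = 0.
Hypothesis z_var : \sum_v p v * Normc.normc (z v) ^+ 2 = s2.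
Hypothesis yz : \sum_v p v * Normc.normc (y v - z v) ^+ 2 <= dl.
Hypotheses (eta0 : 0 < eta) (k0 : 0 < k).
Hypothesis T01 : forall i, 0 <= T i <= 1.
Hypothesis T_fix : forall i, T i * (1 + tau^-1 * \sum_(j | mask i j) T j) = 1.
Hypothesis mask_sym : symmetric mask.

Let normcE (x : C) : (Normc.normc x)%:C%C = `|x|. Proof. by []. Qed.

Lemma expect_entry (g : V -> R) i j : E (fun w : Om => g (w i j)) = \sum_v p v * g v.
Proof.
rewrite (eq_expect _ (g := fun w : Om => (fun u : Row => g (u j)) (w i) * 1)) => [|w]; last by rewrite mulr1.
rewrite (@expect_factor _ _ _ _ P1 i (fun u : Row => g (u j)) (fun=> 1))//.
rewrite expect_cst// mulr1.
rewrite -/(expect p (fun u : Row => g (u j))).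
rewrite (eq_expect _ (g := fun u : Row => g (u j) * 1)) => [|w]; last by rewrite mulr1.
by rewrite (@expect_factor _ _ _ _ p1 j g (fun=> 1))// expect_cst// mulr1.
Qed.

Lemma expect_array_trace_diff :
  E (fun w => `|array_trace y w - array_trace z w|) <=
  k * (n%:R ^+ 2 * dl) + n%:R / (k * tau ^+ 3).
Proof.
pose D (w : Om) := \sum_i \sum_j (if mask i j then Normc.normc (y (w i j) - z (w i j)) ^+ 2 else 0 : R).
apply: le_trans (_ : E (fun w => k * D w + n%:R / (k * tau ^+ 3)) <= _).
  apply: le_expect => // w; rewrite -lecR resolvent_traceB.
  have kC0 : 0 < k%:C%C :> C by rewrite ltcR.
  have := gres_trace_perturb tauC0 kC0 (array_mx mask y w) (array_mx mask z w).
  move=> h; apply: le_trans h _.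
  rewrite [leRHS]rmorphD !rmorphM/= fmorphV/= rmorphM rmorphXn/= rmorph_nat.
  rewrite lerD2r ler_pM2l// /frob /D rmorph_sum; apply: ler_sum => i _.
  rewrite rmorph_sum; apply: ler_sum => j _; rewrite !mxE; case: ifP => _.
    by rewrite rmorphXn/= normcE.
  by rewrite subrr normr0 expr0n.
rewrite expectD expect_cst// lerD2r expectZ ler_pM2l//.
rewrite expect_sum; apply: le_trans (_ : \sum_(i : 'I_n) (n%:R * dl) <= _); last first.
  by rewrite sumr_const card_ord -[_ *+ n]mulr_natl mulrA expr2.
apply: ler_sum => i _; rewrite expect_sum.
apply: le_trans (_ : \sum_(j : 'I_n) dl <= _); last first.
  by rewrite sumr_const card_ord -[_ *+ n]mulr_natl.
apply: ler_sum => j _; have dl0 : 0 <= dl.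
  by apply: le_trans yz; apply: sumr_ge0 => v _; rewrite mulr_ge0// sqr_ge0.
case: (mask i j); last by rewrite expect_cst.
by rewrite (expect_entry (fun v => Normc.normc (y v - z v) ^+ 2)).
Qed.

Lemma expect_array_trace_limit :
  E (fun w => `|array_trace z w - tau^-1 * \sum_i T i|) <=
  2 * (eta + 8 * B ^+ 4 * n%:R / tau ^+ 2 / eta + tau^-1 + `|1 - s2| * (n%:R / tau)).
Proof.
rewrite -lecR -expect_complex.
have z_varC : \sum_v pC v * `|z v| ^+ 2 = s2%:C%C.
  rewrite -z_var rmorph_sum; apply: eq_bigr => v _.
  by rewrite rmorphM rmorphXn.
have etaC0 : 0 < eta%:C%C :> C by rewrite ltcR.
have TC01 i : 0 <= ((T i)%:C%C : C) <= 1.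
  by have /andP[a b] := T01 i; rewrite lecR a -[1]/(1%:C%C) lecR b.
have TC_fix i : (T i)%:C%C * (1 + (tau%:C%C)^-1 * \sum_(j | mask i j) (T j)%:C%C) = 1 :> C.
  by rewrite -fmorphV/= -rmorph_sum -rmorphM -[1]/(1%:C%C) -rmorphD -rmorphM T_fix.
have nt : n%:R / (tau%:C%C : C) <= 2^-1.
  rewrite -(rmorph_nat (real_complex R)) -fmorphV -rmorphM /=.
  rewrite -(rmorph_nat (real_complex R)) -fmorphV/= lecR tauE invfM mulrA mulfV ?mul1r; last first.
    by rewrite pnatr_eq0 -lt0n.
  by rewrite lef_pV2 ?posrE.
have := expect_trace_dist pC0 pC1 tauC0 mask_sym z_le z_mean z_varC etaC0 TC01 TC_fix nt.
move=> h; apply: le_trans (le_trans _ h) _.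
  rewrite le_eqVlt; apply/orP; left; apply/eqP; apply: eq_expect => w.
  rewrite -norm_real_complex rmorphB/= resolvent_traceE rmorphM fmorphV/= rmorph_sum //.
rewrite le_eqVlt; apply/orP; left; apply/eqP.
rewrite rmorphM !rmorphD !rmorphM !fmorphV/= !rmorphXn/= !rmorph_nat -norm_real_complex.
by rewrite rmorphB rmorph1.
Qed.

(** The mean is estimated through the values [z], which are bounded by [B]; it
    passes to the values [y] because they are close to [z] in mean square. *)
Lemma array_trace_bias :
  `|E (array_trace y) - tau^-1 * \sum_i T i| <=
  k * (n%:R ^+ 2 * dl) + n%:R / (k * tau ^+ 3) +
  2 * (eta + 8 * B ^+ 4 * n%:R / tau ^+ 2 / eta + tau^-1 + `|1 - s2| * (n%:R / tau)).
Proof.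
apply: le_trans (lerD expect_array_trace_diff expect_array_trace_limit).
have -> : E (array_trace y) - tau^-1 * \sum_i T i =
    E (fun w => array_trace y w - tau^-1 * \sum_i T i).
  by rewrite (expectD _ (array_trace y) (fun=> - (tau^-1 * \sum_i T i))) expect_cst.
rewrite -expectD.
apply: le_trans (norm_expect P0 _) _; apply: le_expect => // w.
apply: le_trans (ler_normD _ _).
by rewrite addrA subrK.
Qed.

End Mean.
End RealForm.

(** * Counting trees *)

Section TreeCount.
Variable la : int_partition.
Local Notation l := (plength la).
Local Notation tree := (ptree 'I_l).
Implicit Types (a b : 'I_l) (t u : tree).

Definition linked a b := in_diagram la a b && in_diagram la b a.

Definition rooted_trees a n : set tree :=
  [set t | [/\ lambda_tree t, root_label t = a & nvertices t = n]].

Lemma finite_rooted_trees a n : finite_set (rooted_trees a n).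
Proof. by apply: sub_finite_set (finite_lambda_trees la n) => t [? _ ?]. Qed.

(** Indexed by the number [k] of edges. *)
Definition num_rooted a k : nat := #|` fset_set (rooted_trees a k.+1)|.

(** A common range of summation for trees of all the sizes that occur. *)
Definition small_trees n : seq tree :=
  fset_set [set t : tree | (nvertices t <= n)%N].

Lemma small_treesP n t : t \in small_trees n = (nvertices t <= n)%N.
Proof.
rewrite /small_trees in_fset_set; last exact: finite_nvertices.
by apply/idP/idP; rewrite inE.
Qed.

Lemma uniq_small_trees n : uniq (small_trees n). Proof. exact: fset_uniq. Qed.

Definition is_rooted a k t :=
  [&& lambda_tree t, root_label t == a & nvertices t == k.+1].

Lemma card_fset_set_seq (X : choiceType) (S : set X) (s : seq X) : finite_set S ->
  uniq s -> (forall x, (x \in s) <-> S x) -> #|` fset_set S| = size s.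
Proof.
move=> fS us sS; apply: perm_size; apply: uniq_perm => // x.
rewrite in_fset_set//; apply/idP/idP; rewrite inE; first by move/sS.
by move=> xs; apply/sS.
Qed.

Lemma num_rootedE a k n : (k < n)%N ->
  num_rooted a k = (\sum_(t <- small_trees n) is_rooted a k t)%N.
Proof.
move=> kn; rewrite /num_rooted (@card_fset_set_seq _ _ [seq t <- small_trees n | is_rooted a k t]).
- by rewrite size_filter -sum1_count big_mkcond; apply: eq_bigr => t _; case: (is_rooted _ _ _).
- exact: finite_rooted_trees.
- exact/filter_uniq/uniq_small_trees.
move=> t; rewrite mem_filter small_treesP; split.
  by case/andP => /and3P[? /eqP ? /eqP ?] _.
by case=> h1 h2 h3; rewrite /is_rooted h1 h2 h3 !eqxx.
Qed.

Lemma num_lambda_treesE k : num_lambda_trees la k = (\sum_a num_rooted a k)%N.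
Proof.
under eq_bigr do rewrite (num_rootedE _ (ltnSn k)).
rewrite exchange_big/= /num_lambda_trees.
rewrite (@card_fset_set_seq _ _
  [seq t <- small_trees k.+1 | lambda_tree t && (nvertices t == k.+1)]).
- rewrite size_filter -sum1_count big_mkcond/=; apply: eq_bigr => t _.
  rewrite (bigD1 (root_label t))//= /is_rooted eqxx/= big1 ?addn0.
    by case: (_ && _).
  by move=> b; rewrite eq_sym => /negPf->; rewrite /= andbF.
- exact: finite_lambda_trees.
- exact/filter_uniq/uniq_small_trees.
move=> t; rewrite mem_filter small_treesP; split.
  by case/andP => /andP[h1 /eqP h2] _.
by case=> h1 h2; rewrite h1 h2 !eqxx leqnn.
Qed.

Lemma nvertices_gt0 t : (0 < nvertices t)%N. Proof. by case: t. Qed.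

Lemma num_rooted0 a : num_rooted a 0 = 1%N.
Proof.
rewrite /num_rooted (@card_fset_set_seq _ _ [:: PNode a [::]])//.
  exact: finite_rooted_trees.
move=> t; rewrite inE; split=> [/eqP->//|].
case: t => b [|u s] [/= _ -> //] [] /eqP; rewrite addn_eq0.
by rewrite -leqn0 leqNgt nvertices_gt0.
Qed.

Definition graft (tu : tree * tree) : tree :=
  let: PNode a s := tu.1 in PNode a (tu.2 :: s).

Lemma graft_inj : injective graft.
Proof. by move=> [[a s] u] [[b r] v] [-> -> ->]. Qed.

Lemma lambda_tree_graft t u : lambda_tree (graft (t, u)) =
  [&& linked (root_label t) (root_label u), lambda_tree u & lambda_tree t].
Proof. by case: t => a s /=; rewrite -!andbA. Qed.

Lemma nvertices_graft t u : nvertices (graft (t, u)) = (nvertices t + nvertices u)%N.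
Proof. by case: t => a s /=; rewrite addSn addnC. Qed.

(** Cutting off the first subtree [u] of the root, the inverse of [graft], is a
    bijection onto the pairs [(t, u)] whose root labels are linked. *)
Lemma num_rootedS a k : num_rooted a k.+1 =
  (\sum_(i < k.+1) \sum_(b | linked a b) num_rooted a i * num_rooted b (k - i))%N.
Proof.
pose n := k.+1; pose A := small_trees n.
pose ok (tu : tree * tree) := is_rooted a k.+1 (graft tu).
have -> : num_rooted a k.+1 = size [seq graft tu | tu <- [seq tu <- [seq (t, u) | t <- A, u <- A] | ok tu]].
  apply: card_fset_set_seq; first exact: finite_rooted_trees.
    rewrite map_inj_uniq; last exact: graft_inj.
    apply: filter_uniq; apply: allpairs_uniq; try exact: uniq_small_trees.
    by move=> [? ?] [? ?] _ _ [-> ->].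
  move=> t; split.
    by case/mapP => -[x y]; rewrite mem_filter => /andP[/and3P[? /eqP ? /eqP ?] _] ->.
  case: t => b [|u s] [h1 h2 h3] //.
  have hs : (nvertices (PNode b s) + nvertices u = k.+2)%N.
    by rewrite -nvertices_graft.
  apply/mapP; exists (PNode b s, u) => //; rewrite mem_filter /ok; apply/andP; split.
    by rewrite /is_rooted; apply/and3P; split; [exact: h1|exact/eqP|exact/eqP].
  apply/allpairsP; exists (PNode b s, u); split => //.
    by rewrite small_treesP -ltnS -hs -[ltnLHS]addn0 ltn_add2l nvertices_gt0.
  by rewrite small_treesP -ltnS -hs -[ltnLHS]add0n ltn_add2r nvertices_gt0.
rewrite size_map size_filter -sum1_count big_mkcond big_allpairs.
rewrite [RHS](eq_bigr (fun i : 'I_k.+1 => \sum_(t <- A) \sum_(u <- A)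
    \sum_(b | linked a b) is_rooted a i t * is_rooted b (k - i) u)%N); last first.
  move=> i _; rewrite [RHS](eq_bigr (fun t => \sum_(b | linked a b) \sum_(u <- A)
    is_rooted a i t * is_rooted b (k - i) u)%N) => [|t _]; last exact: exchange_big.
  rewrite [RHS]exchange_big; apply: eq_bigr => b _.
  rewrite (num_rootedE a (ltn_ord i)) -/A.
  by rewrite (@num_rootedE b (k - i) n) ?ltnS ?leq_subr// -/A big_distrlr.
rewrite [RHS]exchange_big/=; apply: eq_bigr => t _.
rewrite [RHS]exchange_big/=; apply: eq_bigr => u _.
rewrite /ok /is_rooted lambda_tree_graft nvertices_graft.
have -> : root_label (graft (t, u)) = root_label t by case: (t).
have [t0 u0] := (nvertices_gt0 t, nvertices_gt0 u).
transitivity ((linked (root_label t) (root_label u) && lambda_tree u && lambda_tree t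
  && (root_label t == a)) && ((nvertices t + nvertices u)%N == k.+2) : nat).
  by rewrite -!andbA; case: ifP => // _.
have [tu|tu] := eqVneq (nvertices t + nvertices u)%N k.+2; last first.
  rewrite andbF big1// => i _; rewrite big1// => b _.
  have [ti|/negPf ti] := eqVneq (nvertices t) i.+1; last by rewrite !andbF.
  have [ui|/negPf ui] := eqVneq (nvertices u) (k - i).+1; last by rewrite !andbF muln0.
  by move: tu; rewrite ti ui addSn addnS subnKC ?eqxx// -ltnS; exact: ltn_ord.
have tk : ((nvertices t).-1 < k.+1)%N.
  by rewrite prednK// -ltnS -tu -[ltnLHS]addn0 ltn_add2l.
rewrite andbT (bigD1 (Ordinal tk))//= [X in (_ + X)%N]big1 ?addn0 => [|i it].
  rewrite big_mkcond (bigD1 (root_label u))//= [X in (_ + X)%N]big1 ?addn0 => [|b bu].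
    rewrite prednK// !eqxx.
    have -> : nvertices u == (k - (nvertices t).-1).+1.
      by rewrite -subSn// -(subSS (nvertices t).-1) prednK// -tu addKn.
    have [->|] := eqVneq (root_label t) a; last by rewrite !andbF; case: ifP.
    by case: (linked _ _); case: (lambda_tree u); case: (lambda_tree t).
  by rewrite [root_label u == b]eq_sym (negPf bu) /= andbF muln0; case: ifP.
rewrite big1// => b _; have [ti|/negPf ti] := eqVneq (nvertices t) i.+1.
  by move: it; rewrite -val_eqE/= ti eqxx.
by rewrite !andbF.
Qed.

End TreeCount.

(** * Generating functions of trees *)

(* Joins completeness to the normed module structure of matrices. *)
HB.instance Definition _ (R : realType) m n := Complete.on 'M[R]_(m, n).

Section FixedPoint.
Variables (R : realType) (l : nat) (adj : rel 'I_l).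

Lemma row_normE (v : 'rV[R]_l) :
  `|v| = \big[Num.max/0]_ij `|v ij.1 ij.2|.
Proof. exact: mx_normrE. Qed.

Lemma mx_norm_row_le (v : 'rV[R]_l) (c : R) : 0 <= c ->
  (forall a, `|v 0 a| <= c) -> `|v| <= c.
Proof.
move=> c0 vc; rewrite row_normE; apply: bigmax_le => // -[i a] _ /=.
by rewrite ord1.
Qed.

Lemma row_le_mx_norm (v : 'rV[R]_l) a : `|v 0 a| <= `|v|.
Proof. by rewrite row_normE (le_bigmax _ (fun ij => `|v ij.1 ij.2|) (0, a)). Qed.

Definition tree_map (x : R) (v : 'rV[R]_l) : 'rV[R]_l :=
  \row_a (1 + x * \sum_(b | adj a b) v 0 b)^-1.

Definition nonneg_rows : set 'rV[R]_l := [set v | forall a, 0 <= v 0 a].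

Lemma tree_map_bounds x v a : 0 <= x -> nonneg_rows v -> 0 <= tree_map x v 0 a <= 1.
Proof.
move=> x0 v0; rewrite mxE.
have s0 : 1 <= 1 + x * \sum_(b | adj a b) v 0 b.
  by rewrite lerDl mulr_ge0// sumr_ge0.
by rewrite invr_ge0 (le_trans ler01 s0) invf_le1// (lt_le_trans ltr01 s0).
Qed.

(** [tree_map x] contracts the sup norm on nonnegative vectors by [x * l]. *)
Lemma tree_fixed_point (x : R) : 0 <= x -> x * l%:R <= 2^-1 ->
  exists T : 'I_l -> R, (forall a, 0 <= T a <= 1) /\
    forall a, T a * (1 + x * \sum_(b | adj a b) T b) = 1.
Proof.
move=> x0 xl.
have fU : set_fun nonneg_rows nonneg_rows (tree_map x).
  by move=> v v0 a; have /andP[] := tree_map_bounds a x0 v0.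
pose f := mkfun fU.
have ctr : is_contraction f.
  exists (2^-1)%:nng; split; first by rewrite /=; lra.
  move=> [v w] [/= v0 w0]; rewrite /f/=.
  apply: mx_norm_row_le => [|a]; first by rewrite mulr_ge0// invr_ge0.
  have /andP[fv0 fv1] := tree_map_bounds a x0 v0.
  have /andP[fw0 fw1] := tree_map_bounds a x0 w0.
  have s0 u : nonneg_rows u -> 1 + x * \sum_(b | adj a b) u 0 b != 0.
    by move=> u0; rewrite gt_eqF// ltr_wpDr// mulr_ge0// sumr_ge0.
  have -> : (tree_map x v - tree_map x w) 0 a =
     tree_map x v 0 a * (tree_map x w 0 a *
       (x * (\sum_(b | adj a b) (w 0 b - v 0 b)))).
    rewrite !mxE sumrB.
    field.
    by rewrite !s0.
  rewrite normrM ger0_norm// -[leRHS]mul1r ler_pM// normrM ger0_norm//.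
  rewrite -[leRHS]mul1r ler_pM// normrM (ger0_norm x0).
  apply: le_trans (_ : x * (l%:R * `|v - w|) <= _); last first.
    by rewrite mulrA ler_wpM2r.
  rewrite ler_wpM2l//; apply: le_trans (ler_norm_sum _ _ _) _.
  rewrite -[X in X%:R * _]card_ord -sumr_const mulr_suml.
  rewrite [leRHS](bigID (adj a))/= -[leLHS]addr0; apply: lerD; last first.
    by apply: sumr_ge0 => b _; rewrite mul1r.
  apply: ler_sum => b _; rewrite mul1r distrC.
  by have := row_le_mx_norm (v - w) b; rewrite !mxE.
have cl : closed nonneg_rows.
  have -> : nonneg_rows = \bigcap_(a in [set: 'I_l]) [set v : 'rV[R]_l | 0 <= v 0 a].
    by apply/seteqP; split=> v /= v0 a; [move=> _; exact: v0|exact: (v0 a I)].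
  apply: closed_bigI => a _.
  apply: (closed_comp _ (@closed_ge R 0)) => v _.
  exact: coord_continuous.
have [|T T0 TE] := banach_fixed_point ctr cl.
  by exists 0 => a; rewrite mxE.
have TEa a : T 0 a = tree_map x T 0 a := congr1 (fun v : 'rV_l => v 0 a) TE.
exists (T 0); split=> [a|a].
  by rewrite TEa; exact: tree_map_bounds.
by rewrite [X in X * _]TEa mxE mulVf// gt_eqF// ltr_wpDr// mulr_ge0// sumr_ge0.
Qed.

Variable c : 'I_l -> nat -> nat.
Hypothesis c0 : forall a, c a 0 = 1%N.
Hypothesis cS : forall a k, c a k.+1 =
  (\sum_(i < k.+1) \sum_(b | adj a b) c a i * c b (k - i))%N.

(** Iterates of the equation in the form [T = 1 - x T (sum T)], as polynomials in
    [x]: in this form they have the signed tree numbers as coefficients. *)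
Fixpoint picard K : 'I_l -> {poly R} :=
  if K is K'.+1 then
    fun a => 1 - 'X * (picard K' a * \sum_(b | adj a b) picard K' b)
  else fun=> 1.

Lemma coef_picard K a k : (k <= K)%N -> (picard K a)`_k = (-1) ^+ k * (c a k)%:R.
Proof.
elim: K a k => [|K IH] a [|k] kK //=.
- by rewrite coef1 c0 expr0 mul1r.
- by rewrite coefB coefXM coef1 c0 expr0 mul1r subr0.
rewrite coefB coefXM coef1 sub0r/= coefM cS natr_sum mulr_sumr -sumrN.
apply: eq_bigr => i _; rewrite IH; last by rewrite (leq_trans (ltnSE (ltn_ord i))).
rewrite coef_sum natr_sum !mulr_sumr -sumrN; apply: eq_bigr => b _.
rewrite IH; last by rewrite (leq_trans (leq_subr _ _)).
have -> : (-1) ^+ k.+1 = - ((-1) ^+ i * (-1) ^+ (k - i)) :> R.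
  by rewrite exprS mulN1r -exprD subnKC// ltnSE.
rewrite natrM; ring.
Qed.

Lemma horner_bounded (p : {poly R}) :
  exists2 M, 0 <= M & forall x, 0 <= x <= 1 -> `|p.[x]| <= M.
Proof.
exists (\sum_(i < size p) `|p`_i|); first exact: sumr_ge0.
move=> x /andP[x0 x1]; rewrite horner_coef; apply: le_trans (ler_norm_sum _ _ _) _.
apply: ler_sum => i _; rewrite normrM -[leRHS]mulr1 ler_wpM2l//.
by rewrite ger0_norm ?exprn_ge0// exprn_ile1.
Qed.

(** Each iteration gains a factor [x]. *)
Lemma picard_dist K : exists2 M, 0 <= M & forall (x : R) (T : 'I_l -> R),
  0 <= x <= 1 -> (forall a, 0 <= T a <= 1) ->
  (forall a, T a * (1 + x * \sum_(b | adj a b) T b) = 1) ->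
  forall a, `|T a - (picard K a).[x]| <= M * x ^+ K.+1.
Proof.
elim: K => [|K [M M0 IH]].
  exists l%:R => // x T /andP[x0 x1] T01 Tfix a; rewrite /= hornerE expr1.
  have S0 : 0 <= \sum_(b | adj a b) T b by apply: sumr_ge0 => b _; case/andP: (T01 b).
  have -> : T a - 1 = - (T a * (\sum_(b | adj a b) T b) * x).
    by rewrite -[in LHS](Tfix a); ring.
  have /andP[Ta0 Ta1] := T01 a.
  rewrite normrN normrM (ger0_norm x0) ler_wpM2r// normrM !ger0_norm//.
  rewrite -[leRHS]mul1r ler_pM// -[l in leRHS]card_ord -sumr_const.
  rewrite [leRHS](bigID (adj a))/= -[leLHS]addr0; apply: lerD; last first.
    by apply: sumr_ge0.
  by apply: ler_sum => b _; case/andP: (T01 b).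
have /(_ _)/cid2 pb a := horner_bounded (picard K a).
pose N := \sum_a sval (pb a).
have Na a x : 0 <= x <= 1 -> `|(picard K a).[x]| <= N.
  move=> x01; apply: le_trans (_ : sval (pb a) <= _); first exact: (s2valP' (pb a)).
  rewrite /N (bigD1 a)//= lerDl; apply: sumr_ge0 => b _; exact: (s2valP (pb b)).
have N0 : 0 <= N by apply: sumr_ge0 => b _; exact: (s2valP (pb b)).
exists (M * (l%:R + N * l%:R)); first by rewrite mulr_ge0// addr_ge0// mulr_ge0.
move=> x T x01 T01 Tfix a; have /andP[x0 x1] := x01.
have -> : (picard K.+1 a).[x] =
    1 - x * ((picard K a).[x] * \sum_(b | adj a b) (picard K b).[x]).
  by rewrite /= hornerD hornerN !hornerM hornerX horner_sum -polyC1 hornerC.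
have -> : T a - (1 - x * ((picard K a).[x] * \sum_(b | adj a b) (picard K b).[x])) =
  - x * ((T a - (picard K a).[x]) * \sum_(b | adj a b) T b +
   (picard K a).[x] * \sum_(b | adj a b) (T b - (picard K b).[x])).
  by rewrite sumrB -[in LHS](Tfix a); ring.
rewrite normrM normrN (ger0_norm x0) exprS mulrCA ler_wpM2l//.
have suml (F : 'I_l -> R) B : 0 <= B -> (forall b, `|F b| <= B) ->
    `|\sum_(b | adj a b) F b| <= B * l%:R.
  move=> B0 FB; apply: le_trans (ler_norm_sum _ _ _) _.
  rewrite -[l in leRHS]card_ord mulr_natr -sumr_const.
  rewrite [leRHS](bigID (adj a))/= -[leLHS]addr0; apply: lerD; last first.
    by apply: sumr_ge0.
  exact: ler_sum.
have xK : 0 <= x ^+ K.+1 by rewrite exprn_ge0.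
have -> : M * (l%:R + N * l%:R) * x ^+ K.+1 =
  M * x ^+ K.+1 * (1 * l%:R) + N * (M * x ^+ K.+1 * l%:R) by ring.
apply: le_trans (ler_normD _ _) _; rewrite !normrM; apply: lerD; apply: ler_pM => //.
- exact: IH.
- by apply: suml => // b; rewrite ger0_norm; case/andP: (T01 b).
- exact: Na.
- by apply: suml => [|b]; [rewrite mulr_ge0|exact: IH].
Qed.

End FixedPoint.

(** * Empirical measures and their Stieltjes transforms *)

Section Averages.
Variable R : realType.
Implicit Types (s : seq R) (f h : R -> R).

Definition avg_pts s f : R := (size s)%:R^-1 * \sum_(x <- s) f x.

Definition edf s x : R := avg_pts s (fun y => (y <= x)%R%:R).

Lemma avg_ptsD s f h : avg_pts s (fun x => f x + h x) = avg_pts s f + avg_pts s h.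
Proof. by rewrite /avg_pts big_split mulrDr. Qed.

Lemma avg_ptsZ s c f : avg_pts s (fun x => c * f x) = c * avg_pts s f.
Proof. by rewrite /avg_pts -mulr_sumr mulrCA. Qed.

Lemma avg_pts_sum s (I : Type) (r : seq I) (P : pred I) (F : I -> R -> R) :
  avg_pts s (fun x => \sum_(i <- r | P i) F i x) = \sum_(i <- r | P i) avg_pts s (F i).
Proof. by rewrite /avg_pts exchange_big/= mulr_sumr. Qed.

Lemma le_avg_pts s f h : (forall x, x \in s -> f x <= h x) ->
  avg_pts s f <= avg_pts s h.
Proof.
move=> fh; rewrite /avg_pts ler_wpM2l ?invr_ge0//.
rewrite big_seq [leRHS]big_seq; exact: ler_sum.
Qed.

Lemma eq_avg_pts s f h : {in s, f =1 h} -> avg_pts s f = avg_pts s h.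
Proof. by move=> fh; congr (_ * _); exact: eq_big_seq. Qed.

Lemma avg_pts_cst s c : (0 < size s)%N -> avg_pts s (fun=> c) = c.
Proof.
move=> s0; rewrite /avg_pts big_const_seq count_predT iter_addr addr0 -[c *+ _]mulr_natl.
by rewrite mulrA mulVf ?mul1r// pnatr_eq0 -lt0n.
Qed.

Lemma norm_avg_pts s f c : (0 < size s)%N -> (forall x, x \in s -> `|f x| <= c) ->
  `|avg_pts s f| <= c.
Proof.
move=> s0 fc; rewrite ler_norml -(avg_pts_cst (- c) s0) -[X in _ <= _ <= X](avg_pts_cst c s0).
by apply/andP; split; apply: le_avg_pts => x /fc; rewrite ler_norml => /andP[].
Qed.

Lemma edf_ge0 s x : 0 <= edf s x.
Proof. by rewrite mulr_ge0 ?invr_ge0// sumr_ge0. Qed.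

Lemma edf_le1 s x : edf s x <= 1.
Proof.
have [s0|s0] := posnP (size s); first by rewrite /edf /avg_pts s0 invr0 mul0r.
by rewrite -(avg_pts_cst 1 s0); apply: le_avg_pts => y _; case: (y <= x).
Qed.

Lemma edfN s x : (forall y, y \in s -> 0 <= y) -> x < 0 -> edf s x = 0.
Proof.
move=> s0 x0; rewrite /edf (@eq_avg_pts _ _ (fun=> 0 * 0)).
  by rewrite avg_ptsZ mul0r.
by move=> y ys; rewrite mul0r leNgt (lt_le_trans x0) ?s0.
Qed.

Definition stieltjes s t := avg_pts s (fun x => (x + t)^-1).

(** The points accumulate at 2 ([i = 1]) and are unbounded ([j = 0]); the
    former identify the law, the latter give its mass and moments. *)
Definition test_pt (i j : nat) : R := 2 + i%:R / j.+1%:R.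

Record good_seq (g : R -> R) (s_ : nat -> seq R) := GoodSeq {
  good_size : forall N, (0 < size (s_ N))%N;
  good_ge0 : forall N x, x \in s_ N -> 0 <= x;
  good_cvg : forall i j,
    stieltjes (s_ N) (test_pt i j) @[N --> \oo] --> g (test_pt i j) }.

Lemma geometric_remainder (v d : R) K : v != 0 -> v + d != 0 ->
  (v + d)^-1 = \sum_(k < K) (- d) ^+ k * v^-1 ^+ k.+1
     + (- d) ^+ K * v^-1 ^+ K / (v + d).
Proof.
move=> v0 vd0; elim: K => [|K IH]; first by rewrite big_ord0 expr0 add0r !mul1r.
rewrite big_ord_recr/= {1}IH -addrA; congr (_ + _).
rewrite !exprS; field.
by rewrite v0 vd0.
Qed.

End Averages.

Arguments good_cvg {R g s_} _ i j.

Section TwoGoodSequences.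
Variables (R : realType) (g : R -> R) (s_ z_ : nat -> seq R).
Hypothesis gs : good_seq g s_.
Hypothesis gz : good_seq g z_.

Local Notation FF := (filter_prod \oo \oo).

(** The two indices tend to infinity independently, so that one sequence can be
    compared with a fixed late element of the other. *)
Definition merging (f : R -> R) :=
  avg_pts (s_ NM.1) f - avg_pts (z_ NM.2) f @[NM --> FF] --> (0 : R).

Lemma merging_stieltjes i j : merging (fun x => (x + test_pt R i j)^-1).
Proof.
rewrite /merging -[X in _ --> X](subrr (g (test_pt R i j))); apply: cvgB.
  exact: (cvg_comp _ _ cvg_fst (good_cvg gs i j)).
exact: (cvg_comp _ _ cvg_snd (good_cvg gz i j)).
Qed.

Lemma eq_merging (f : R -> R) (D : nat * nat -> R) :
  (forall NM, avg_pts (s_ NM.1) f - avg_pts (z_ NM.2) f = D NM) ->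
  D @ FF --> (0 : R) -> merging f.
Proof. by move=> fD; rewrite /merging (_ : (fun NM => _) = D)//; exact/funext. Qed.

Lemma mergingD f h : merging f -> merging h -> merging (fun x => f x + h x).
Proof.
move=> mf mh; apply: (@eq_merging _ (fun NM =>
  (avg_pts (s_ NM.1) f - avg_pts (z_ NM.2) f) +
  (avg_pts (s_ NM.1) h - avg_pts (z_ NM.2) h))) => [NM|].
  by rewrite !avg_ptsD opprD addrACA.
by rewrite -[0]addr0; apply: cvgD.
Qed.

Lemma mergingZ c f : merging f -> merging (fun x => c * f x).
Proof.
move=> mf; apply: (@eq_merging _ (fun NM =>
  c * (avg_pts (s_ NM.1) f - avg_pts (z_ NM.2) f))) => [NM|].
  by rewrite !avg_ptsZ -mulrBr.
by rewrite -[0](mulr0 c); apply: cvgMl_tmp.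
Qed.

Lemma merging_cst c : merging (fun=> c).
Proof.
apply: (@eq_merging _ (fun=> 0)) => [NM|]; last exact: cvg_cst.
by rewrite !avg_pts_cst ?(good_size gs, good_size gz)// subrr.
Qed.

Lemma merging_sum (I : Type) (r : seq I) (F : I -> R -> R) :
  (forall i, merging (F i)) -> merging (fun x => \sum_(i <- r) F i x).
Proof.
move=> mF; elim: r => [|i r IH].
  have -> : (fun x => \sum_(i <- [::]) F i x) = fun=> 0.
    by apply/funext => x; rewrite big_nil.
  exact: merging_cst.
have -> : (fun x => \sum_(j <- i :: r) F j x) = fun x => F i x + \sum_(j <- r) F j x.
  by apply/funext => x; rewrite big_cons.
exact: mergingD.
Qed.

Definition upow k (x : R) : R := (x + 2)^-1 ^+ k.

(** In the expansion of [1 / (x + 2 + d)] in powers of [d], the terms of order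
    below [k] merge by induction; the rest divided by [(- d) ^+ k] is the next power
    up to an error [d], uniformly in [x >= 0]. *)
Lemma merging_upow k : merging (upow k).
Proof.
elim/ltn_ind: k => -[_|k IH]; first by apply: merging_cst.
apply/cvgr0Pnorm_le => e e0.
pose j := Num.truncn (4 / e).
pose d : R := j.+1%:R^-1.
have d0 : 0 < d by rewrite invr_gt0.
have de : 4 * d <= e.
  rewrite ler_pdivrMr// mulrC -ler_pdivrMr//; apply/ltW/truncnS_gt.
pose f x := (- d)^-1 ^+ k * ((x + test_pt R 1 j)^-1 +
  \sum_(i < k) - ((- d) ^+ i) * upow i.+1 x).
have mf : merging f.
  apply/mergingZ/mergingD; first exact: merging_stieltjes.
  by apply: merging_sum => i; apply: mergingZ; apply: IH; rewrite ltnS ltn_ord.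
have fu (x : R) : 0 <= x -> `|upow k.+1 x - f x| <= d.
  move=> x0; have x2 : 0 < x + 2 by lra.
  have tE : x + test_pt R 1 j = x + 2 + d by rewrite /test_pt mul1r addrA.
  have x20 : x + 2 != 0 by rewrite gt_eqF.
  have xd0 : x + 2 + d != 0 by rewrite gt_eqF// (addr_gt0 x2 d0).
  rewrite /f tE (geometric_remainder k.+1 x20 xd0).
  pose S := \sum_(i < k) (- d) ^+ i * (x + 2)^-1 ^+ i.+1.
  rewrite (_ : \sum_(i < k) - ((- d) ^+ i) * upow i.+1 x = - S); last first.
    by rewrite -sumrN; apply: eq_bigr => i _; rewrite mulNr.
  rewrite big_ord_recr [in X in X + _]/= -/S -/(upow k.+1 x).
  have -> : upow k.+1 x - (- d)^-1 ^+ k * (S + (- d) ^+ k * upow k.+1 x +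
      (- d) ^+ k.+1 * upow k.+1 x / (x + 2 + d) - S) =
    d * (upow k.+1 x / (x + 2 + d)).
    have dk : (- d) ^+ k != 0 by rewrite expf_neq0// oppr_eq0 gt_eqF.
    rewrite exprS exprVn; field.
    by rewrite xd0 dk.
  rewrite normrM (gtr0_norm d0) -[leRHS]mulr1 ler_wpM2l ?(ltW d0)//.
  have u01 : 0 <= upow k.+1 x <= 1.
    have x21 : 0 <= (x + 2)^-1 <= 1 by rewrite invr_ge0 ltW// invf_le1//; lra.
    by case/andP: x21 => h0 h1; rewrite /upow exprn_ge0// exprn_ile1.
  case/andP: u01 => h0 h1; rewrite ger0_norm; last first.
    by rewrite divr_ge0// addr_ge0 ?ltW.
  by rewrite ler_pdivrMr ?(addr_gt0 x2 d0)// mul1r; lra.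
have fs s : (0 < size s)%N -> (forall y, y \in s -> 0 <= y) ->
    `|avg_pts s (upow k.+1) - avg_pts s f| <= d.
  move=> sz s0; have -> : avg_pts s (upow k.+1) - avg_pts s f =
    avg_pts s (fun x => upow k.+1 x + -1 * f x).
    by rewrite (avg_ptsD _ (upow k.+1)) (avg_ptsZ _ (-1) f) mulN1r.
  by apply: norm_avg_pts => // y /s0 y0; rewrite mulN1r fu.
have {fs} [fs fz] := (fun N => fs _ (good_size gs N) (@good_ge0 _ _ _ gs N),
  fun N => fs _ (good_size gz N) (@good_ge0 _ _ _ gz N)).
have e2 : 0 < e / 2 by rewrite divr_gt0.
move/cvgr0Pnorm_le : mf => /(_ _ e2); apply: filterS => -[N M] /= fNM.
have -> : avg_pts (s_ N) (upow k.+1) - avg_pts (z_ M) (upow k.+1) =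
  (avg_pts (s_ N) (upow k.+1) - avg_pts (s_ N) f) +
  (avg_pts (s_ N) f - avg_pts (z_ M) f) -
  (avg_pts (z_ M) (upow k.+1) - avg_pts (z_ M) f) by ring.
apply: le_trans (ler_normB _ _) _; apply: le_trans (lerD (ler_normD _ _) (fz M)) _.
have := lerD (lerD (fs N) fNM) (lexx d); move/le_trans; apply; lra.
Qed.

Lemma merging_horner (p : {poly R}) : merging (fun x => p.[(x + 2)^-1]).
Proof.
have -> : (fun x => p.[(x + 2)^-1]) = fun x => \sum_(i < size p) p`_i * upow i x.
  by apply/funext => x; rewrite horner_coef.
by apply: merging_sum => i; apply/mergingZ/merging_upow.
Qed.

End TwoGoodSequences.

(** * Polynomial approximation of a step *)

Section Steps.
Variable R : realType.
Implicit Types (z : R).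

Lemma bernoulli_ge z n : z <= 1 -> 1 - n%:R * z <= (1 - z) ^+ n.
Proof.
move=> z1; elim: n => [|n IH]; first by rewrite mul0r subr0 expr0.
rewrite exprS; apply: le_trans (ler_wpM2l _ IH); last by rewrite subr_ge0.
have n0 : 0 <= n%:R * z ^+ 2 by rewrite mulr_ge0// sqr_ge0.
by rewrite -natr1; lra.
Qed.

(** For large [m], [(1 - z ^+ m) ^+ (k ^ m)] is nearly 1 when [k z < 1] and nearly
    0 when [k z > 1]: this is the polynomial of [step_poly]. *)
Lemma step_value_ge z k m : 0 <= z <= 1 ->
  1 - (k%:R * z) ^+ m <= (1 - z ^+ m) ^+ (k ^ m).
Proof.
move=> /andP[z0 z1]; apply: le_trans (bernoulli_ge _ _); last exact: exprn_ile1.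
by rewrite exprMn natrX.
Qed.

Lemma step_value_le z k m : 0 <= z <= 1 -> 0 < k%:R * z ->
  (1 - z ^+ m) ^+ (k ^ m) <= (k%:R * z) ^- m.
Proof.
move=> /andP[z0 z1] kz0; have kzm : 0 < (k%:R * z) ^+ m by rewrite exprn_gt0.
have zm1 : z ^+ m <= 1 by exact: exprn_ile1.
rewrite -[leRHS]mul1r ler_pdivlMr//.
apply: le_trans (_ : (1 - z ^+ m) ^+ (k ^ m) * (1 + z ^+ m) ^+ (k ^ m) <= _).
  rewrite ler_wpM2l ?exprn_ge0 ?subr_ge0//.
  have := @bernoulli_ge (- z ^+ m) (k ^ m); rewrite opprK mulrN opprK => h.
  apply: le_trans (h _); first by rewrite exprMn natrX lerDr.
  by rewrite (le_trans _ ler01)// oppr_le0 exprn_ge0.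
have zm0 : 0 <= z ^+ m by rewrite exprn_ge0.
rewrite -exprMn exprn_ile1//.
  by rewrite mulr_ge0 ?subr_ge0// addr_ge0.
have -> : (1 - z ^+ m) * (1 + z ^+ m) = 1 - (z ^+ m) ^+ 2 by ring.
by rewrite lerBlDr lerDl sqr_ge0.
Qed.

Lemma step_poly (a b e : R) : 0 < a -> a < b -> 0 < e ->
  exists p : {poly R}, forall v : R, 0 <= v <= 2^-1 ->
    [/\ 0 <= p.[v] <= 1, v <= a -> 1 - e <= p.[v] & b <= v -> p.[v] <= e].
Proof.
move=> a0 ab e0.
pose th := (a + b) / 2.
have th0 : 0 < th by rewrite divr_gt0//; lra.
(* The slope k th >= 1/2 keeps z = v / (k th) in [0, 1] for v <= 1/2. *)
pose k := (Num.truncn (2 * th)^-1).+1.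
have kth : 2^-1 <= k%:R * th.
  have := truncnS_gt (2 * th)^-1; rewrite -/k => h.
  rewrite -ler_pdivrMr// -invfM; exact: ltW.
have k0 : 0 < k%:R * th by apply: lt_le_trans kth; rewrite invr_gt0.
have k00 : k%:R != 0 :> R by rewrite pnatr_eq0.
have cvg0 (r : R) : 0 <= r < 1 -> \forall m \near \oo, r ^+ m <= e.
  move=> /andP[r0 r1]; have := @cvg_expr R r; rewrite ger0_norm// => /(_ r1).
  move/cvgr0Pnorm_le => /(_ e e0); apply: filterS => m.
  by rewrite ger0_norm// exprn_ge0.
have ra : 0 <= a / th < 1.
  by rewrite divr_ge0 ?(ltW a0) ?(ltW th0)//= ltr_pdivrMr// mul1r /th; lra.
have rb : 0 <= th / b < 1.
  have b0 : 0 < b by lra.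
  by rewrite divr_ge0 ?(ltW b0) ?(ltW th0)//= ltr_pdivrMr// mul1r /th; lra.
have [m [ma mb]] : exists m, (a / th) ^+ m <= e /\ (th / b) ^+ m <= e.
  have [m _ mm] : \forall m \near \oo, (a / th) ^+ m <= e /\ (th / b) ^+ m <= e.
    by apply: filterI; exact: cvg0.
  by exists m; apply: mm => /=.
exists ((1 - ((k%:R * th)^-1 *: 'X) ^+ m) ^+ (k ^ m)) => v /andP[v0 v2].
rewrite horner_exp hornerD hornerN -polyC1 hornerC horner_exp hornerZ hornerX.
set z := _ * v.
have z01 : 0 <= z <= 1.
  rewrite mulr_ge0 ?invr_ge0 ?(ltW k0)//= ler_pdivrMl// mulr1.
  exact: le_trans v2 kth.
have kz : k%:R * z = v / th by rewrite /z; field; rewrite gt_eqF.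
have [z0 z1] := andP z01.
have zm : 0 <= 1 - z ^+ m <= 1.
  by rewrite subr_ge0 exprn_ile1//= lerBlDr lerDl exprn_ge0.
have [zm0 zm1] := andP zm.
split; first by rewrite exprn_ge0// exprn_ile1.
  move=> va; apply: le_trans (step_value_ge k m z01); rewrite kz lerD2l lerN2.
  have ath : v / th <= a / th by rewrite ler_pM2r ?invr_gt0.
  have vth : 0 <= v / th := divr_ge0 v0 (ltW th0).
  by apply: le_trans ma; rewrite lerXn2r ?nnegrE// (le_trans vth).
move=> bv; have v00 : 0 < v by lra.
apply: le_trans (step_value_le m z01 _) _; first by rewrite kz divr_gt0.
rewrite kz -exprVn invf_div; apply: le_trans mb.
have b0 : 0 < b by lra.
have tv : th / v <= th / b by rewrite ler_pM2l// lef_pV2 ?posrE.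
have tv0 : 0 <= th / v := divr_ge0 (ltW th0) v0.
by rewrite lerXn2r ?nnegrE// (le_trans tv0).
Qed.
End Steps.

(** * The limiting law of a good sequence *)

Section Interlacing.
Variables (R : realType) (g : R -> R) (s_ z_ : nat -> seq R).
Hypothesis gs : good_seq g s_.
Hypothesis gz : good_seq g z_.

(** A polynomial in [1 / (w + 2)], whose averages merge, is squeezed between the
    indicators of [w <= x] and [w <= y]. *)
Lemma edf_interlace x y e : x < y -> 0 < e ->
  \forall N \near \oo & M \near \oo, edf (s_ N) x <= edf (z_ M) y + e.
Proof.
move=> xy e0; have [x0|x0] := ltP x 0.
  near=> N M; rewrite (@edfN _ (s_ N))//; last exact: (good_ge0 gs).
  by rewrite addr_ge0 ?edf_ge0// ltW.
have y0 : 0 < y by exact: le_lt_trans xy.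
have a0 : 0 < (y + 2)^-1 by rewrite invr_gt0; lra.
have ab : (y + 2)^-1 < (x + 2)^-1 by rewrite ltf_pV2 ?posrE; lra.
have e3 : 0 < e / 3 by rewrite divr_gt0.
have [p pP] := step_poly a0 ab e3.
have uP (w : R) : 0 <= w -> 0 <= (w + 2)^-1 <= 2^-1.
  by move=> w0; rewrite invr_ge0 lef_pV2 ?posrE; lra.
have pA := merging_horner gs gz (1 - p).
have := pA; rewrite /merging => /cvgr0Pnorm_le /(_ _ e3).
apply: filterS => -[N M] /= pNM.
have q1 : edf (s_ N) x <= avg_pts (s_ N) (fun w => (1 - p).[(w + 2)^-1]) + e / 3.
  rewrite -[X in _ <= _ + X](avg_pts_cst _ (good_size gs N)) -avg_ptsD.
  apply: le_avg_pts => w ws; have w0 := good_ge0 gs ws.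
  have [/andP[p0 p1] _ p3] := pP _ (uP _ w0).
  rewrite hornerD hornerN -polyC1 hornerC; case: (leP w x) => [wx|_]; last by rewrite [nat_of_bool _]/= mulr0n; lra.
  have := p3 _; rewrite lef_pV2 ?posrE; [|lra|lra].
  by rewrite lerD2r => /(_ wx); rewrite [nat_of_bool _]/= mulr1n; lra.
have q2 : avg_pts (z_ M) (fun w => (1 - p).[(w + 2)^-1]) <= edf (z_ M) y + e / 3.
  rewrite -[X in _ <= _ + X](avg_pts_cst _ (good_size gz M)) -avg_ptsD.
  apply: le_avg_pts => w ws; have w0 := good_ge0 gz ws.
  have [/andP[p0 p1] p2 _] := pP _ (uP _ w0).
  rewrite hornerD hornerN -polyC1 hornerC; case: (leP w y) => [_|yw]; first by rewrite [nat_of_bool _]/= mulr1n; lra.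
  have := p2 _; rewrite lef_pV2 ?posrE; [|lra|lra].
  by rewrite lerD2r => /(_ (ltW yw)); rewrite [nat_of_bool _]/= mulr0n; lra.
move: pNM; rewrite ler_norml => /andP[_ pNM]; lra.
Unshelve. all: by end_near. Qed.

End Interlacing.

Section LimitDF.
Variables (R : realType) (g : R -> R) (s_ : nat -> seq R).
Hypothesis gs : good_seq g s_.

Definition eventual_bounds x : set R :=
  [set c | exists2 y, x < y & \forall N \near \oo, edf (s_ N) y <= c].

(** The infimum over [y > x] of the upper limits of the distribution functions at
    [y]; the passage to [y > x] makes it right continuous. *)
Definition limit_df x : R := inf (eventual_bounds x).

Lemma eventual_bounds1 x : eventual_bounds x 1.
Proof. by exists (x + 1); [lra|near=> N; exact: edf_le1]. Unshelve. all: by end_near. Qed.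

Lemma eventual_bounds_ge0 x c : eventual_bounds x c -> 0 <= c.
Proof. by move=> [y _ [N _ /(_ N (leqnn N))]]; apply: le_trans; exact: edf_ge0. Qed.

Lemma has_inf_bounds x : has_inf (eventual_bounds x).
Proof.
split; first by exists 1; exact: eventual_bounds1.
by exists 0 => c; exact: eventual_bounds_ge0.
Qed.

Lemma limit_df_le x c : eventual_bounds x c -> limit_df x <= c.
Proof. by apply: ge_inf; have [] := has_inf_bounds x. Qed.

Lemma limit_df_ge0 x : 0 <= limit_df x.
Proof.
apply: lb_le_inf; first by exists 1; exact: eventual_bounds1.
by move=> c; exact: eventual_bounds_ge0.
Qed.

Lemma limit_df_le1 x : limit_df x <= 1.
Proof. exact/limit_df_le/eventual_bounds1. Qed.

Lemma limit_df_nd : nondecreasing limit_df.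
Proof.
move=> x y xy; apply: lb_le_inf; first by exists 1; exact: eventual_bounds1.
by move=> c [z yz zc]; apply: limit_df_le; exists z => //; exact: le_lt_trans yz.
Qed.

Lemma limit_df_rc : right_continuous limit_df.
Proof.
move=> x; apply/cvgrPdist_le => e e0.
have [c [y xy yc] ce] := inf_adherent e0 (has_inf_bounds x).
near=> z; have xz : x <= z by near: z; exact: nbhs_right_ge.
have zy : z < y by near: z; exact: nbhs_right_lt.
have zc : limit_df z <= c by apply: limit_df_le; exists y.
have xz' : limit_df x <= limit_df z by exact: limit_df_nd.
rewrite distrC ger0_norm ?subr_ge0//.
rewrite lerBlDl; apply: le_trans zc _; exact: ltW.
Unshelve. all: by end_near. Qed.

Section AnyGood.
Variable z_ : nat -> seq R.
Hypothesis gz : good_seq g z_.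

(** Interlacing carries the defining bounds over from the reference sequence
    [s_] to every sequence with the same limits. *)
Lemma edf_limsup x e : 0 < e -> \forall N \near \oo, edf (z_ N) x <= limit_df x + e.
Proof.
move=> e0; have e2 : 0 < e / 2 by rewrite divr_gt0.
have [c [y xy yc] ce] := inf_adherent e2 (has_inf_bounds x).
have /= [[A B] [/= nA nB] AB] := edf_interlace gz gs xy e2.
have [M [BM Mc]] : exists M, B M /\ edf (s_ M) y <= c.
  have [M _ h] := filterI nB yc; exists M; exact: h (leqnn M).
move: nA; apply: filterS => N AN; have /= := AB (N, M) (conj AN BM).
by move=> h; rewrite -/(limit_df x) in ce; lra.
Qed.

Lemma edf_liminf x y e : x < y -> 0 < e ->
  \forall N \near \oo, limit_df x <= edf (z_ N) y + e.
Proof.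
move=> xy e0; pose m := (x + y) / 2.
have xm : x < m by rewrite /m; lra.
have my : m < y by rewrite /m; lra.
have /= [[A B] [/= nA nB] AB] := edf_interlace gs gz my e0.
move: nB; apply: filterS => N BN; apply: limit_df_le; exists m => //.
by move: nA; apply: filterS => M AM; exact: AB (M, N) (conj AM BN).
Qed.

Lemma edf_cvg x : {for x, continuous limit_df} -> edf (z_ N) x @[N --> \oo] --> limit_df x.
Proof.
move=> cx; apply/cvgrPdist_le => e e0; have e2 : 0 < e / 2 by rewrite divr_gt0.
have /cvgrPdist_le /(_ _ e2) := cx => -[d /= d0 dx].
have yx : x - d / 2 < x by lra.
have := dx (x - d / 2) _; rewrite /= opprB addrCA subrr addr0 gtr0_norm ?divr_gt0//.
have d2 : d / 2 < d by lra.
move=> /(_ d2); rewrite ler_norml => /andP[_ h].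
near=> N.
have h1 : edf (z_ N) x <= limit_df x + e by near: N; exact: edf_limsup.
have h2 : limit_df (x - d / 2) <= edf (z_ N) x + e / 2.
  by near: N; exact: edf_liminf.
rewrite ler_norml; apply/andP; split; lra.
Unshelve. all: by end_near. Qed.

End AnyGood.

Lemma limit_dfN x : x < 0 -> limit_df x = 0.
Proof.
move=> x0; apply/eqP; rewrite eq_le limit_df_ge0 andbT; apply: limit_df_le.
exists (x / 2); first lra.
near=> N; rewrite edfN//; first exact: (good_ge0 gs).
lra.
Unshelve. all: by end_near. Qed.

Hypothesis g_top : forall e, 0 < e -> exists2 t, 2 <= t & exists i, exists j,
  t = test_pt R i j /\ 1 - e <= t * g t.

(** No mass escapes to infinity, as [t / (w + t)] is at most the indicator of
    [w <= y] plus [t / (y + t)]. *)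
Lemma limit_df_top e : 0 < e -> exists y, 1 - e <= limit_df y.
Proof.
move=> e0; have e3 : 0 < e / 4 by rewrite divr_gt0.
have [t t2 [i [j [tE tg]]]] := g_top e3.
pose y := 4 * t / e; have y0 : 0 < y by rewrite divr_gt0// mulr_gt0//; lra.
exists y.
have t0 : 0 < t by lra.
have ty : t / (y + t) <= e / 4.
  rewrite ler_pdivrMr ?addr_gt0// mulrDr /y.
  have -> : e / 4 * (4 * t / e) = t by field; rewrite gt_eqF.
  by rewrite lerDl mulr_ge0 ?ltW.
have st N : t * stieltjes (s_ N) t <= edf (s_ N) y + e / 4.
  rewrite -avg_ptsZ -[X in _ <= _ + X](avg_pts_cst _ (good_size gs N)) -avg_ptsD.
  apply: le_avg_pts => w /(good_ge0 gs) w0.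
  have wt : 0 < w + t by lra.
  case: (leP w y) => wy; rewrite [nat_of_bool _]/= ?mulr1n ?mulr0n.
    have : t / (w + t) <= 1 by rewrite ler_pdivrMr// mul1r lerDr.
    by move=> h; apply: le_trans h _; lra.
  rewrite add0r; apply: le_trans ty; rewrite ler_pM2l// lef_pV2 ?posrE//; lra.
have e30 : 0 < e / 4 / t by rewrite divr_gt0.
have /cvgrPdist_le /(_ _ e30) := good_cvg gs i j; rewrite -tE => cg.
near \oo => N.
have h3 : `|g t - stieltjes (s_ N) t| <= e / 4 / t by near: N.
have h4 : edf (s_ N) y <= limit_df y + e / 4 by near: N; exact: edf_limsup.
have h5 : t * (g t - stieltjes (s_ N) t) <= e / 4.
  rewrite mulrC -ler_pdivlMr//; apply: le_trans h3; exact: ler_norm.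
have := st N; move: h5; rewrite mulrBr; lra.
Unshelve. all: by end_near. Qed.

Lemma limit_df_cvgNy : limit_df @ -oo --> (0 : R).
Proof.
apply: cvg_near_cst; near=> x; apply: limit_dfN; near: x; exact: nbhs_ninfty_lt.
Unshelve. all: by end_near. Qed.

Lemma limit_df_cvgy : limit_df @ +oo --> (1 : R).
Proof.
apply/cvgrPdist_le => e e0; have [y ye] := limit_df_top e0.
near=> x; rewrite ger0_norm ?subr_ge0 ?limit_df_le1//.
have : limit_df y <= limit_df x by apply: limit_df_nd; near: x; apply: nbhs_pinfty_ge; exact: num_real.
lra.
Unshelve. all: by end_near. Qed.

HB.instance Definition _ := isCumulative.Build R _ R limit_df limit_df_nd limit_df_rc.

HB.instance Definition _ := isCumulativeBounded.Build R 0 1 limit_df limit_df_cvgNy limit_df_cvgy.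

(* The Stieltjes measure lives on a copy of R carrying another display; the
   identity transports it to R itself. *)
Let idTR : measurableTypeR R -> R := idfun.

#[local] HB.instance Definition _ :=
  @isMeasurableFun.Build _ _ _ _ idTR (@measurable_id _ _ setT).

Definition limit_law : probability R R :=
  distribution (lebesgue_stieltjes_measure limit_df) idTR.

Lemma limit_lawE x : limit_law `]-oo, x]%classic = (limit_df x)%:E.
Proof. exact: cdf_lebesgue_stieltjes_id. Qed.

Lemma limit_law_df : distribution_function limit_law = limit_df.
Proof. by apply/funext => x; rewrite /distribution_function limit_lawE. Qed.

End LimitDF.

Definition inv_shift (R : realType) (t x : R) : R := (x + t)^-1.

Lemma inv_shiftE (R : realType) (t x : R) : inv_shift t x = (x + t)^-1.
Proof. by []. Qed.

Section LimitLaw.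
Variables (R : realType) (mu : probability R R) (F : R -> R).
Hypothesis muE : forall x, mu `]-oo, x]%classic = (F x)%:E.
Hypothesis F_neg : forall x : R, x < 0 -> F x = 0.

Lemma limit_law_neg : mu `]-oo, 0[%classic = 0%E.
Proof.
have -> : `]-oo, (0 : R)[%classic = \bigcup_n `]-oo, - n.+1%:R^-1]%classic.
  apply/seteqP; split=> x /=; rewrite in_itv/=.
    move=> x0; have /ltr_add_invr[k] : x < 0 := x0.
    by move=> xk; exists k => //=; rewrite in_itv/= -subr_le0 opprK ltW.
  by case=> k _ /=; rewrite in_itv/= => /le_lt_trans; apply; rewrite oppr_lt0.
apply: measure_negligible; first exact: bigcup_measurable.
apply: negligible_bigcup => k; apply/negligibleP => //.
by have := muE (- k.+1%:R^-1); rewrite F_neg ?oppr_lt0.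
Qed.

Local Notation D := (`[(0 : R), +oo[%classic).

Lemma limit_law_ge0 : mu D = 1%E.
Proof.
have -> : D = ~` `]-oo, (0 : R)[%classic by rewrite setCitvl.
by rewrite probability_setC// limit_law_neg sube0.
Qed.

Lemma limit_law_itv x : mu (`]-oo, x]%classic `&` D) = (F x)%:E.
Proof.
rewrite -muE; apply/esym.
have mI : measurable (`]-oo, x]%classic `&` D) by exact: measurableI.
rewrite [LHS](measureDI _ _ (B := D))//.
rewrite [X in (X + _)%E](_ : _ = 0%E) ?add0e//.
apply/eqP; rewrite eq_le measure_ge0 andbT -limit_law_neg.
apply: le_measure; rewrite ?inE//; first exact: measurableD.
by move=> y /= [_]; rewrite !in_itv/= andbT => /negP; rewrite -ltNge.
Qed.

Variable t : R.
Hypothesis t0 : 0 < t.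

Local Notation h := (inv_shift t).

(** For [0 < x <= K d], the value of [inv_shift t] at the last point of the grid
    [d * nat] strictly below [x]. Written with indicators, its integrals and averages only
    involve distribution functions. *)
Definition step_fun (d : R) K (x : R) : R :=
  \sum_(i < K) (h (i%:R * d) - h (i.+1%:R * d)) * (x <= i.+1%:R * d)%R%:R + h (K%:R * d).

Lemma step_fun0 d x : step_fun d 0 x = h 0.
Proof. by rewrite /step_fun big_ord0 add0r mul0r. Qed.

Lemma step_funS (d : R) K (x : R) : step_fun d K.+1 x =
  if x <= K.+1%:R * d then step_fun d K x
  else step_fun d K x - (h (K%:R * d) - h (K.+1%:R * d)).
Proof.
rewrite /step_fun big_ord_recr/=; case: ifP => _; rewrite ?mulr1 ?mulr0; ring.
Qed.

Lemma h_nincr (x y : R) : 0 <= x -> x <= y -> h y <= h x.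
Proof. by have t0' := t0; move=> x0 xy; rewrite !inv_shiftE lef_pV2 ?posrE; lra. Qed.

Lemma step_fun_last (d : R) K (x : R) : 0 <= d -> K%:R * d < x -> step_fun d K x = h (K%:R * d).
Proof.
move=> d0; elim: K => [|K IH] Kx; first by rewrite step_fun0 mul0r.
rewrite step_funS leNgt Kx/= IH; first by ring.
by apply: le_lt_trans Kx; rewrite ler_wpM2r// ler_nat.
Qed.

Lemma step_fun_ge (d : R) K (x : R) : 0 <= d -> 0 <= x -> h x <= step_fun d K x.
Proof.
move=> d0 x0; elim: K => [|K IH]; first by rewrite step_fun0 h_nincr.
rewrite step_funS; case: (leP x (K.+1%:R * d)) => // Kx.
rewrite step_fun_last//; last first.
  by apply: le_lt_trans Kx; rewrite ler_wpM2r// ler_nat.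
by rewrite opprB addrCA subrr addr0 h_nincr ?mulr_ge0// ltW.
Qed.

(** Moving back by one mesh compensates the rounding. *)
Lemma step_fun_le (d : R) K (x : R) : 0 <= d ->
  step_fun d K x <= h (K%:R * d) + h (Num.max 0 (x - d)).
Proof.
move=> d0; set x' := Num.max _ _.
have x'0 : 0 <= x' by rewrite le_max lexx.
have h0 (y : R) : 0 <= y -> 0 <= h y by have t0' := t0; move=> y0; rewrite inv_shiftE invr_ge0; lra.
suff : step_fun d K x <= h (K%:R * d) \/ step_fun d K x <= h x'.
  by case=> /le_trans; apply; rewrite ?lerDl ?lerDr h0// mulr_ge0.
elim: K => [|K IH]; first by left; rewrite step_fun0 mul0r.
rewrite step_funS; case: (leP x (K.+1%:R * d)) => Kx; last first.
  left; rewrite step_fun_last//; last first.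
    by apply: le_lt_trans Kx; rewrite ler_wpM2r// ler_nat.
  by rewrite opprB addrCA subrr addr0.
right; case: IH => // /le_trans; apply; apply: h_nincr => //.
rewrite /x' ge_max mulr_ge0//= lerBlDr.
by apply: le_trans Kx _; rewrite -natr1 mulrDl mul1r.
Qed.

Lemma h_lip (x y : R) : 0 <= x -> x <= y -> h x <= h y + (y - x) / t ^+ 2.
Proof.
have t0' := t0; move=> x0 xy; rewrite -lerBlDl.
have -> : h x - h y = (y - x) / ((x + t) * (y + t)).
  by rewrite !inv_shiftE; field; rewrite !gt_eqF//; lra.
rewrite ler_wpM2l ?subr_ge0// lef_pV2 ?posrE ?exprn_gt0 ?mulr_gt0//; [|lra|lra].
by rewrite expr2 ler_pM//; lra.
Qed.

Lemma step_fun_shift (d : R) K (x : R) : 0 <= d -> 0 <= x ->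
  step_fun d K (x - d) <= h x + (h (K%:R * d) + 2 * d / t ^+ 2).
Proof.
move=> d0 x0; apply: le_trans (step_fun_le _ _ d0) _.
set x' := Num.max _ _.
have x'0 : 0 <= x' by rewrite le_max lexx.
have x'x : x' <= x by rewrite /x' ge_max x0/=; lra.
have xx' : x - x' <= 2 * d.
  by rewrite lerBlDl -lerBlDr /x' le_max; apply/orP; right; lra.
have := h_lip x'0 x'x.
have : (x - x') / t ^+ 2 <= 2 * d / t ^+ 2.
  by rewrite ler_pM2r// invr_gt0 exprn_gt0.
lra.
Qed.

Lemma step_fun_mono (d : R) K (x : R) : 0 <= d -> step_fun d K x <= step_fun d K (x - d).
Proof.
move=> d0; rewrite lerD2r; apply: ler_sum => i _; rewrite ler_wpM2l//.
  by rewrite subr_ge0 h_nincr ?mulr_ge0// ler_wpM2r// ler_nat.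
by rewrite ler_nat; case: leP => //= xi; rewrite (le_trans _ xi)//; lra.
Qed.

Definition step_int d K : R :=
  \sum_(i < K) (h (i%:R * d) - h (i.+1%:R * d)) * F (i.+1%:R * d) + h (K%:R * d).

Lemma step_weight_ge0 (d : R) i : 0 <= d -> 0 <= h (i%:R * d) - h (i.+1%:R * d).
Proof. by move=> d0; rewrite subr_ge0 h_nincr ?mulr_ge0// ler_wpM2r// ler_nat. Qed.

Lemma itv_indic (c x : R) : (x <= c)%R%:R = \1_(`]-oo, c]%classic) x :> R.
Proof. by rewrite indicE mem_setE in_itv. Qed.

Lemma integral_step_fun (d : R) K : 0 <= d ->
  (\int[mu]_(x in D) (step_fun d K x)%:E = (step_int d K)%:E)%E.
Proof.
move=> d0; have mD : measurable D by exact: measurable_itv.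
pose w (i : 'I_K) := h (i%:R * d) - h (i.+1%:R * d).
have w0 i : 0 <= w i by exact: step_weight_ge0.
pose f (i : 'I_K) (x : R) : \bar R := (w i * \1_(`]-oo, i.+1%:R * d]%classic) x)%:E.
have mi (c : R) : measurable_fun D (\1_(`]-oo, c]%classic) : R -> R).
  exact: measurable_indic.
have mf i : measurable_fun D (f i).
  by apply/measurable_EFinP; apply: measurable_funM.
have f0 i x : D x -> (0 <= f i x)%E.
  by move=> _; rewrite /f lee_fin mulr_ge0.
have hK : 0 <= h (K%:R * d).
  by rewrite inv_shiftE invr_ge0 addr_ge0 ?mulr_ge0// ltW.
transitivity (\int[mu]_(x in D) (\sum_(i < K) f i x + (h (K%:R * d))%:E))%E.
  apply: eq_integral => x _; rewrite /step_fun EFinD -sumEFin; congr (_ + _)%E.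
  by apply: eq_bigr => i _; rewrite itv_indic.
rewrite ge0_integralD//.
- rewrite integral_cst// [X in (_ + _ * X)%E](_ : _ = 1%E); last exact: limit_law_ge0.
  rewrite mule1 ge0_integral_sum// /step_int EFinD -sumEFin.
  congr (_ + _)%E; apply: eq_bigr => i _.
  under eq_integral do rewrite /f EFinM.
  rewrite ge0_integralZl_EFin//; last by apply/measurable_EFinP; exact: mi.
  rewrite integral_indic// EFinM; congr (_ * _)%E; exact: limit_law_itv.
- move=> x Dx; apply: sume_ge0 => i _; exact: f0.
- by apply: emeasurable_sum => i; exact: mf.
Qed.

Lemma measurable_inv_shift : measurable_fun D h.
Proof.
apply: (eq_measurable_fun (fun x : R => h (Num.max 0 x))).
  by move=> x; rewrite inE/= in_itv/= andbT => x0; rewrite max_r.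
apply: nonincreasing_measurable => // x y xy; apply: h_nincr; first by rewrite le_max lexx.
by rewrite ge_max !le_max lexx xy orbT.
Qed.

Lemma step_int_bounds (d : R) K : 0 <= d ->
  exists2 I : R, (\int[mu]_(x in D) (h x)%:E = I%:E)%E &
    I <= step_int d K <= I + (h (K%:R * d) + 2 * d / t ^+ 2).
Proof.
move=> d0; have mD : measurable D by exact: measurable_itv.
have mh : measurable_fun D (fun x => (h x)%:E) by apply/measurable_EFinP; exact: measurable_inv_shift.
have h0 x : 0 <= x -> 0 <= h x by move=> x0; rewrite inv_shiftE invr_ge0 addr_ge0// ltW.
have D0 x : D x -> 0 <= x by rewrite /= in_itv/= andbT.
have s0 x : D x -> 0 <= step_fun d K x.
  by move=> /D0 x0; apply: le_trans (step_fun_ge K d0 x0); exact: h0.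
have ms : measurable_fun D (fun x => (step_fun d K x)%:E).
  apply/measurable_EFinP; apply: measurable_funD; last exact: measurable_cst.
  apply: measurable_sum => i; apply: measurable_funM; first exact: measurable_cst.
  under [X in measurable_fun _ X]eq_fun do rewrite itv_indic.
  exact: measurable_indic.
set e := h _ + _; have e0 : 0 <= e.
  rewrite addr_ge0 ?h0 ?mulr_ge0// ?invr_ge0 ?exprn_ge0 ?(ltW t0)//.
have I1 : (\int[mu]_(x in D) (h x)%:E <= (step_int d K)%:E)%E.
  rewrite -integral_step_fun//; apply: ge0_le_integral => //.
  - by move=> x /D0 x0; rewrite lee_fin h0.
  - by move=> x /D0 x0; rewrite lee_fin step_fun_ge.
have I2 : ((step_int d K)%:E <= \int[mu]_(x in D) (h x)%:E + e%:E)%E.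
  have -> : e%:E = (\int[mu]_(x in D) (cst e%:E) x)%E.
    by rewrite integral_cst// [X in (_ * X)%E](_ : _ = 1%E) ?mule1//; exact: limit_law_ge0.
  rewrite -integral_step_fun// -ge0_integralD//; last first.
    by move=> x /D0 x0; rewrite lee_fin h0.
  apply: ge0_le_integral => //.
  - exact: emeasurable_funD.
  - move=> x /D0 x0; rewrite -EFinD lee_fin.
    exact: le_trans (step_fun_mono K x d0) (step_fun_shift K d0 x0).
have Ifin : (\int[mu]_(x in D) (h x)%:E)%E \is a fin_num.
  rewrite ge0_fin_numE; first exact: le_lt_trans I1 (ltry _).
  by apply: integral_ge0 => x /D0 x0; rewrite lee_fin h0.
exists (fine (\int[mu]_(x in D) (h x)%:E)%E); first by rewrite fineK.
move: I1 I2; rewrite -(fineK Ifin) -EFinD !lee_fin => -> ->//.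
Qed.

Variable z_ : nat -> seq R.
Hypothesis z_size : forall N, (0 < size (z_ N))%N.
Hypothesis z_ge0 : forall N x, x \in z_ N -> 0 <= x.
Hypothesis z_limsup : forall x e, 0 < e ->
  \forall N \near \oo, edf (z_ N) x <= F x + e.
Hypothesis z_liminf : forall x y e, x < y -> 0 < e ->
  \forall N \near \oo, F x <= edf (z_ N) y + e.
Variable gt : R.
Hypothesis z_cvg : stieltjes (z_ N) t @[N --> \oo] --> gt.

Lemma avg_step_fun s (d : R) K (c : R) : (0 < size s)%N ->
  avg_pts s (fun x => step_fun d K (x - c)) =
  \sum_(i < K) (h (i%:R * d) - h (i.+1%:R * d)) * edf s (i.+1%:R * d + c) + h (K%:R * d).
Proof.
move=> s0; rewrite /step_fun avg_ptsD avg_pts_cst// avg_pts_sum; congr (_ + _).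
apply: eq_bigr => i _; rewrite avg_ptsZ; congr (_ * _).
by apply: eq_avg_pts => x _; rewrite lerBlDr.
Qed.

Lemma step_weight_sum (d : R) K : 0 <= d ->
  \sum_(i < K) (h (i%:R * d) - h (i.+1%:R * d)) <= t^-1.
Proof.
move=> d0; have -> : \sum_(i < K) (h (i%:R * d) - h (i.+1%:R * d)) = h 0 - h (K%:R * d).
  elim: K => [|K IH]; first by rewrite big_ord0 mul0r subrr.
  by rewrite big_ord_recr/= IH; ring.
rewrite inv_shiftE add0r lerBlDr lerDl invr_ge0 addr_ge0 ?mulr_ge0//; exact: ltW.
Qed.

Lemma gt_le_step_int (d : R) K : 0 <= d -> gt <= step_int d K.
Proof.
move=> d0; apply/ler_addgt0Pr => e e0.
have et : 0 < e * t by rewrite mulr_gt0.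
apply: (cvgr_to_le (z_cvg)); near=> N.
apply: le_trans (_ : avg_pts (z_ N) (fun x => step_fun d K (x - 0)) <= _).
  by apply: le_avg_pts => x /z_ge0 x0; rewrite subr0; exact: step_fun_ge.
rewrite avg_step_fun// /step_int addrAC lerD2r.
apply: le_trans (_ : \sum_(i < K) (h (i%:R * d) - h (i.+1%:R * d)) * (F (i.+1%:R * d) + e * t) <= _).
  apply: ler_sum => i _; rewrite ler_wpM2l ?step_weight_ge0// addr0.
  have : forall i : 'I_K, edf (z_ N) (i.+1%:R * d) <= F (i.+1%:R * d) + e * t.
    by near: N; apply: filter_forall => j; exact: z_limsup.
  exact.
under eq_bigr do rewrite mulrDr.
rewrite big_split/= lerD2l -mulr_suml mulrCA -[leRHS]mulr1 ler_pM2l//.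
rewrite mulrC -ler_pdivlMl// mulr1; exact: step_weight_sum.
Unshelve. all: by end_near. Qed.

Lemma step_int_le_gt (d : R) K : 0 < d ->
  step_int d K <= gt + (h (K%:R * d) + 2 * d / t ^+ 2).
Proof.
move=> d0; apply/ler_addgt0Pr => e e0.
have et : 0 < e * t by rewrite mulr_gt0.
rewrite -lerBlDr -lerBlDr.
apply: (cvgr_to_ge (z_cvg)); near=> N.
rewrite lerBlDr lerBlDr.
apply: le_trans (_ : avg_pts (z_ N) (fun x => step_fun d K (x - d)) + e <= _); last first.
  rewrite lerD2r -[X in _ <= _ + X](avg_pts_cst _ (z_size N)) -avg_ptsD.
  by apply: le_avg_pts => x /z_ge0 x0; apply: step_fun_shift => //; exact: ltW.
rewrite avg_step_fun// /step_int addrAC lerD2r.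
apply: le_trans (_ : \sum_(i < K) (h (i%:R * d) - h (i.+1%:R * d)) * (edf (z_ N) (i.+1%:R * d + d) + e * t) <= _).
  apply: ler_sum => i _; rewrite ler_wpM2l ?step_weight_ge0 ?(ltW d0)//.
  have : forall i : 'I_K, F (i.+1%:R * d) <= edf (z_ N) (i.+1%:R * d + d) + e * t.
    by near: N; apply: filter_forall => j; apply: z_liminf => //; rewrite ltrDl.
  exact.
under eq_bigr do rewrite mulrDr.
rewrite big_split/= lerD2l -mulr_suml mulrCA -[leRHS]mulr1 ler_pM2l//.
rewrite mulrC -ler_pdivlMl// mulr1; exact/step_weight_sum/ltW.
Unshelve. all: by end_near. Qed.

(** The integral and the limit [gt] differ from [step_int d K] by an error
    that vanishes as [d] tends to 0 and [K d] to infinity. *)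
Lemma integral_inv_shift : (\int[mu]_(x in D) (h x)%:E = gt%:E)%E.
Proof.
have small (e : R) : 0 < e -> exists d K, 0 < d /\ h (K%:R * d) + 2 * d / t ^+ 2 <= e.
  move=> e0; have t0' := t0.
  pose d := e / 4 * t ^+ 2; have d0 : 0 < d by rewrite mulr_gt0 ?divr_gt0 ?exprn_gt0.
  pose K := (Num.truncn (2 / e / d)).+1.
  exists d, K; split => //.
  have -> : 2 * d / t ^+ 2 = e / 2 by rewrite /d; field; rewrite gt_eqF.
  have KD : 2 / e <= K%:R * d.
    by rewrite -ler_pdivrMr//; apply/ltW/truncnS_gt.
  suff : h (K%:R * d) <= e / 2 by lra.
  rewrite inv_shiftE -[e / 2]invrK lef_pV2 ?posrE ?invr_gt0 ?divr_gt0//.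
    by rewrite invf_div; lra.
  by apply: ltr_wpDl => //; apply: le_trans KD; rewrite divr_ge0// ltW.
have [I IE _] := step_int_bounds 0 (lexx 0).
rewrite IE; congr (_%:E); apply/eqP; rewrite eq_le; apply/andP; split.
  apply/ler_addgt0Pr => e /small[d [K [d0 dK]]].
  have [I' I'E /andP[I1 _]] := step_int_bounds K (ltW d0).
  move: I'E; rewrite IE => -[II']; have := step_int_le_gt K d0; lra.
apply/ler_addgt0Pr => e /small[d [K [d0 dK]]].
have [I' I'E /andP[_ I2]] := step_int_bounds K (ltW d0).
move: I'E; rewrite IE => -[II']; have := gt_le_step_int K (ltW d0); lra.
Qed.

End LimitLaw.

(** * Moments from the transform *)

Section Moments.
Variables (R : realType) (mu : probability R R) (g : R -> R) (m : nat -> R).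
Local Notation D := (`[(0 : R), +oo[%classic).
Hypothesis g_int : forall n : nat,
  (\int[mu]_(x in D) (inv_shift n.+2%:R x)%:E = (g n.+2%:R)%:E)%E.
Hypothesis g_exp : forall K, exists2 M : R, 0 <= M & forall t, 2 <= t ->
  `|g t - \sum_(k < K.+1) (-1) ^+ k * m k / t ^+ k.+1| <= M / t ^+ K.+2.

Let mD : measurable D. Proof. exact: measurable_itv. Qed.
Let D0 x : D x -> 0 <= x. Proof. by rewrite /= in_itv/= andbT. Qed.

Lemma integrable_of_integral (f : R -> R) (c : R) : measurable_fun D f ->
  (forall x, 0 <= x -> 0 <= f x) -> (\int[mu]_(x in D) (f x)%:E = c%:E)%E ->
  mu.-integrable D (EFin \o f).
Proof.
move=> mf f0 fc; apply/integrableP; split; first exact/measurable_EFinP.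
rewrite (eq_integral (fun x => (f x)%:E)) ?fc ?ltry// => x; rewrite inE => /D0 x0.
by rewrite /= ger0_norm// f0.
Qed.

(** As [t] tends to infinity, [x ^+ k * (t / (x + t))] increases to [x ^+ k].
    Dividing [x ^+ k] by [x + t] expresses it by [t ^+ k.+1 / (x + t)] and
    smaller powers, whose integrals are known by [g_int] and by induction; the
    expansion [g_exp] identifies the limit. *)
Lemma integral_moment k : (\int[mu]_(x in D) (x ^+ k)%:E = (m k)%:E)%E.
Proof.
elim/ltn_ind: k => k IH.
pose t n : R := n.+2%:R.
have t0 n : 0 < t n by rewrite ltr0n.
have t2 n : 2 <= t n by rewrite ler_nat.
have t_large (M e : R) : 0 < e -> \forall n \near \oo, M / t n <= e.
  move=> e0; near=> n; rewrite ler_pdivrMr// mulrC -ler_pdivrMr// ltW//.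
  have : (Num.truncn (M / e) <= n)%N by near: n; exact: nbhs_infty_ge.
  rewrite /t => h; apply: lt_trans (truncnS_gt _) _; rewrite ltr_nat.
  by rewrite ltnS ltnS.
pose q n (x : R) := x ^+ k * (t n * inv_shift (t n) x).
pose c n j : R := - ((-1) ^+ k * t n ^+ k.+1 * ((-1) ^+ j / t n ^+ j.+1)).
have qE n x : 0 <= x -> q n x = ((-1) ^+ k * t n ^+ k.+1) * inv_shift (t n) x +
    \sum_(j < k) c n j * x ^+ j.
  move=> x0; have xt : t n + x != 0 by rewrite gt_eqF// ltr_wpDr.
  have tn : t n != 0 by rewrite gt_eqF.
  have := geometric_remainder k tn xt => E.
  set S := \sum_(i < k) _ in E.
  have -> : \sum_(j < k) c n j * x ^+ j = - ((-1) ^+ k * t n ^+ k.+1 * S).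
    rewrite mulr_sumr -sumrN; apply: eq_bigr => j _.
    by rewrite /c [(- x) ^+ j]exprNn exprVn; ring.
  rewrite /q !inv_shiftE [x + t n]addrC; set w := (t n + x)^-1 in E *.
  have E' : w - S = (- x) ^+ k * (t n)^-1 ^+ k * w by rewrite {1}E addrAC subrr add0r.
  rewrite -mulrN -mulrDr E' [(- x) ^+ k]exprNn.
  have ss : (-1) ^+ k * (-1) ^+ k = 1 :> R by rewrite -exprMn mulrNN mulr1 expr1n.
  have tk : t n ^+ k * (t n)^-1 ^+ k = 1 by rewrite -exprMn mulfV// expr1n.
  transitivity (((-1) ^+ k * (-1) ^+ k) * (t n ^+ k * (t n)^-1 ^+ k) * (x ^+ k * (t n * w))).
    by rewrite ss tk !mul1r.
  by rewrite exprS; ring.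
have hpos n x : 0 <= x -> 0 <= inv_shift (t n) x.
  by move=> x0; rewrite inv_shiftE invr_ge0 addr_ge0// ltW.
have mh n : measurable_fun D (inv_shift (t n)) by exact: measurable_inv_shift.
have mX j : measurable_fun D (fun x : R => x ^+ j).
  by apply: measurable_funTS; exact: exprn_measurable.
have ih n : mu.-integrable D (EFin \o inv_shift (t n)).
  apply: (integrable_of_integral (mh n) _ (g_int n)) => x; exact: hpos.
have iX (j : 'I_k) : mu.-integrable D (EFin \o (fun x : R => x ^+ j)).
  apply: (integrable_of_integral (mX j) _ (IH j (ltn_ord j))) => x; exact: exprn_ge0.
pose v n : R := (-1) ^+ k * t n ^+ k.+1 *
  (g (t n) - \sum_(j < k) (-1) ^+ j * m j / t n ^+ j.+1).
have qI n : (\int[mu]_(x in D) (q n x)%:E = (v n)%:E)%E.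
  rewrite (eq_integral (fun x => ((-1) ^+ k * t n ^+ k.+1)%:E * (inv_shift (t n) x)%:E +
      \sum_(j < k) ((c n j)%:E * (x ^+ j)%:E)))%E; last first.
    move=> x; rewrite inE => /D0 x0; rewrite qE// EFinD EFinM -sumEFin.
    by congr (_ + _)%E; apply: eq_bigr => j _; rewrite EFinM.
  rewrite integralD//; last 2 first.
  - by apply: integrableZl => //; exact: (ih n).
  - apply: integrable_sum => // j _; apply: integrableZl => //; exact: (iX j).
  rewrite integralZl//; last exact: (ih n).
  rewrite integral_sum//; last by move=> j; apply: integrableZl => //; exact: (iX j).
  rewrite g_int -EFinM.
  rewrite (eq_bigr (fun j : 'I_k => (c n j * m j)%:E)); last first.
    by move=> j _; rewrite integralZl//; [rewrite IH|exact: (iX j)].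
  rewrite sumEFin -EFinD /v; congr (_%:E).
  rewrite mulrBr mulr_sumr -sumrN; congr (_ + _); apply: eq_bigr => j _.
  by rewrite /c; ring.
have v_cvg : v n @[n --> \oo] --> m k.
  have [M M0 gM] := g_exp k.
  apply/cvgrPdist_le => e e0; near=> n.
  have nM : M / t n <= e by near: n; exact: t_large.
  apply: le_trans nM.
  have -> : m k - v n = - ((-1) ^+ k * t n ^+ k.+1 *
      (g (t n) - \sum_(j < k.+1) (-1) ^+ j * m j / t n ^+ j.+1)).
    rewrite big_ord_recr/= /v.
    have ss : (-1) ^+ k * (-1) ^+ k = 1 :> R by rewrite -exprMn mulrNN mulr1 expr1n.
    have tk : t n ^+ k.+1 / t n ^+ k.+1 = 1 by rewrite mulfV// gt_eqF ?exprn_gt0.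
    have {1}-> : m k = ((-1) ^+ k * (-1) ^+ k) * (t n ^+ k.+1 / t n ^+ k.+1) * m k.
      by rewrite ss tk !mul1r.
    ring.
  rewrite normrN !normrM normrX normrN1 expr1n mul1r gtr0_norm ?exprn_gt0//.
  apply: le_trans (ler_wpM2l _ (gM _ (t2 n))) _; first by rewrite exprn_ge0// ltW.
  have cancel_pow (s : R) : s != 0 -> s ^+ k.+1 * (M / s ^+ k.+2) = M / s.
    by move=> s0; rewrite [s ^+ k.+2]exprS; field; rewrite s0 expf_neq0.
  by rewrite cancel_pow// gt_eqF.
have mono : (\int[mu]_(x in D) (q n x)%:E)%E @[n --> \oo] -->
    (\int[mu]_(x in D) (x ^+ k)%:E)%E.
  have qlim x : D x -> (q n x)%:E @[n --> \oo] --> (x ^+ k)%:E.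
    move=> /D0 x0; apply/cvg_EFin; first by near=> n.
    apply/cvgrPdist_le => e e0; near=> n.
    have nM : x ^+ k.+1 / t n <= e by near: n; exact: t_large.
    apply: le_trans nM.
    have xt : 0 < x + t n by rewrite ltr_wpDl.
    have -> : x ^+ k - q n x = x ^+ k.+1 / (x + t n).
      have key (s : R) : x + s != 0 -> x ^+ k - x ^+ k * (s / (x + s)) = x ^+ k.+1 / (x + s).
        by move=> xs; rewrite exprS; field.
      by rewrite /q inv_shiftE key// gt_eqF.
    rewrite ger0_norm ?divr_ge0 ?exprn_ge0 ?(ltW xt)// ler_wpM2l ?exprn_ge0//.
    by rewrite lef_pV2 ?posrE// lerDr.
  have -> : (\int[mu]_(x in D) (x ^+ k)%:E = \int[mu]_(x in D) limn (fun n => (q n x)%:E))%E.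
    by apply: eq_integral => x; rewrite inE => Dx; apply/esym/cvg_lim => //; exact: qlim.
  apply: cvg_monotone_convergence => //.
  - move=> n; apply/measurable_EFinP; apply: measurable_funM; first exact: mX.
    by apply: measurable_funM => //; exact: measurable_cst.
  - by move=> n x /D0 x0; rewrite lee_fin !mulr_ge0 ?exprn_ge0 ?hpos// ltW.
  - move=> x /D0 x0 n n' nn'; rewrite lee_fin ler_wpM2l ?exprn_ge0//.
    have xt j : 0 < x + t j by rewrite ltr_wpDl.
    rewrite !inv_shiftE ler_pdivrMr// mulrAC ler_pdivlMr// -subr_ge0.
    have tt : t n <= t n' by rewrite ler_nat.
    have key (a b : R) : b * (x + a) - a * (x + b) = (b - a) * x by ring.
    by rewrite key mulr_ge0// subr_ge0.
apply: (cvg_unique _ mono) => //.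
rewrite (_ : (fun n => \int[mu]_(x in D) (q n x)%:E)%E = EFin \o v); last first.
  by apply/funext => n; exact: qI.
by apply/cvg_EFin => //; near=> n.
Unshelve. all: by end_near. Qed.

End Moments.

(** * Discretization of square integrable variables *)

Section SquareApprox.
Import HBSimple HBNNSimple.
Context d (S : measurableType d) (R : realType) (P : probability S R).

Lemma simple_approx_pos (f : S -> R) : measurable_fun [set: S] f ->
  (forall x, 0 <= f x) -> exists g : nat -> S -> R,
  [/\ forall n, measurable_fun [set: S] (g n), forall n, finite_set (range (g n)),
      forall n x, 0 <= g n x <= f x & forall x, g n x @[n --> \oo] --> f x].
Proof.
move=> mf f0; have mF : measurable_fun [set: S] (EFin \o f) by exact/measurable_EFinP.
have F0 x : [set: S] x -> (0 <= (EFin \o f) x)%E by rewrite lee_fin.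
exists (fun n => nnsfun_approx measurableT mF n); split.
- by move=> n; exact: measurable_funPT.
- by move=> n; exact: fimfunP.
- move=> n x; apply/andP; split; first exact: fun_ge0.
  by rewrite -lee_fin nnsfun_approxE; exact: le_approx.
- by move=> x; apply: (fine_cvg (cvg_nnsfun_approx measurableT mF F0 I)).
Qed.

Variable f : S -> R.
Hypothesis mf : measurable_fun [set: S] f.
Hypothesis f2 : (\int[P]_x ((f x) ^+ 2)%:E < +oo)%E.

Lemma simple_square_approx (e : R) : 0 < e -> exists g : S -> R,
  [/\ measurable_fun [set: S] g, finite_set (range g) &
      (\int[P]_x ((f x - g x) ^+ 2)%:E <= e%:E)%E].
Proof.
move=> e0.
have [||a [ma fa la ca]] := @simple_approx_pos (fun x => Num.max (f x) 0).
- exact: measurable_maxr.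
- by move=> x; rewrite le_max lexx orbT.
have [||b [mb fb lb cb]] := @simple_approx_pos (fun x => Num.max (- f x) 0).
- by apply: measurable_maxr => //; exact: measurable_funN.
- by move=> x; rewrite le_max lexx orbT.
pose g n x := a n x - b n x.
have mg n : measurable_fun [set: S] (g n) by exact: measurable_funB.
have fg n : finite_set (range (g n)).
  have h : finite_set [set x.1 - x.2 | x in range (a n) `*` range (b n)].
    by apply: finite_image; apply: finite_setX.
  apply: sub_finite_set h => _ [x _ <-]; exists (a n x, b n x) => //=; by split; exists x.
have fE x : f x = Num.max (f x) 0 - Num.max (- f x) 0.
  by case: (leP (f x) 0) => h; case: (leP (- f x) 0) => h'; lra.
have g_cvg x : g n x @[n --> \oo] --> f x by rewrite [X in _ --> X]fE; apply: cvgB.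
have g_le n x : (f x - g n x) ^+ 2 <= f x ^+ 2.
  have /andP[a0 a1] := la n x; have /andP[b0 b1] := lb n x.
  rewrite /g -ler_sqrt ?sqr_ge0// !sqrtr_sqr.
  move: a1 b1; case: (leP (f x) 0) => h; case: (leP (- f x) 0) => h' a1 b1;
    rewrite ler_norml; apply/andP; rewrite ?(ler0_norm h) ?(gtr0_norm h); split; lra.
have i0 : (\int[P]_x ((f x - g n x) ^+ 2)%:E)%E @[n --> \oo] --> 0%E.
  rewrite -[X in _ --> X](integral0 P [set: S]).
  apply: (@dominated_cvg _ _ _ _ _ measurableT _ _ (fun x => (f x ^+ 2)%:E)) => //.
  - move=> n; apply/measurable_EFinP; apply: measurable_funX; exact: measurable_funB.
  - move=> x _; apply/cvg_EFin; first by near=> n.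
    have : (f x - g n x) ^+ 2 @[n --> \oo] --> (f x - f x) ^+ 2.
      apply: (@cvg_comp _ _ _ (fun n => f x - g n x) (fun y => y ^+ 2)).
        by apply: cvgB => //; exact: cvg_cst.
      exact: exprn_continuous.
    by rewrite subrr expr0n.
  - apply/integrableP; split.
      by apply/measurable_EFinP; apply: measurable_funX.
    rewrite (eq_integral (fun x => (f x ^+ 2)%:E))// => x _.
    by rewrite gee0_abs// lee_fin sqr_ge0.
  - move=> n x _; rewrite gee0_abs ?lee_fin ?sqr_ge0//; exact: g_le.
have : \forall n \near \oo, (\int[P]_x ((f x - g n x) ^+ 2)%:E < e%:E)%E.
  by apply: (i0 (fun u => (u < e%:E)%E)); apply: open_ereal_lt'; rewrite lte_fin.
case=> n _ /(_ n (leqnn n)) hn; exists (g n); split => //; exact: ltW.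
Unshelve. all: by end_near. Qed.

End SquareApprox.

Lemma integral_probability_cst d (S : measurableType d) (R : realType)
  (P : probability S R) (c : R) : (\int[P]_x c%:E = c%:E)%E.
Proof. by rewrite integral_cst// [X in (_ * X)%E](_ : _ = 1%E) ?mule1//; exact: probability_setT. Qed.

Section FiniteValued.
Context d (S : measurableType d) (R : realType) (P : probability S R).
Variables (V : finType) (phi : S -> V).
Hypothesis mphi : forall v, measurable (phi @^-1` [set v]).

Definition cell_mass v : R := fine (P (phi @^-1` [set v])).

Lemma cell_massE v : P (phi @^-1` [set v]) = (cell_mass v)%:E.
Proof. by rewrite fineK// fin_num_measure. Qed.

Lemma cell_mass_ge0 v : 0 <= cell_mass v.
Proof. exact: fine_ge0. Qed.

Lemma finite_valuedE (f : V -> R) x :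
  f (phi x) = \sum_v f v * \1_(phi @^-1` [set v]) x.
Proof.
rewrite (bigD1 (phi x))//= big1 ?addr0.
  by rewrite indicE mem_set// mulr1.
move=> v vx; rewrite indicE memNset ?mulr0// => h.
by move: vx; rewrite -h eqxx.
Qed.

Lemma measurable_finite_valued (f : V -> R) : measurable_fun [set: S] (f \o phi).
Proof.
have -> : f \o phi = fun x => \sum_v f v * \1_(phi @^-1` [set v]) x.
  by apply/funext => x; rewrite /= finite_valuedE.
apply: measurable_sum => v; apply: measurable_funM; first exact: measurable_cst.
exact: measurable_indic.
Qed.

Lemma integrable_finite_valued (f : V -> R) :
  P.-integrable [set: S] (fun x => (f (phi x))%:E).
Proof.
have -> : (fun x => (f (phi x))%:E) =
    (fun x => \sum_v (f v)%:E * (\1_(phi @^-1` [set v]) x)%:E)%E.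
  apply/funext => x; rewrite finite_valuedE -sumEFin.
  by apply: eq_bigr => v _; rewrite EFinM.
apply: integrable_sum => // v _; apply: integrableZl => //.
exact: integrable_indic.
Qed.

Lemma integral_finite_valued (f : V -> R) :
  (\int[P]_x (f (phi x))%:E = (\sum_v cell_mass v * f v)%:E)%E.
Proof.
rewrite (eq_integral (fun x => \sum_v (f v)%:E * (\1_(phi @^-1` [set v]) x)%:E)%E).
  rewrite integral_sum//; last first.
    by move=> v; apply: integrableZl => //; exact: integrable_indic.
  rewrite -sumEFin; apply: eq_bigr => v _.
  rewrite integralZl//; last exact: integrable_indic.
  rewrite integral_indic// setIT mulrC EFinM; congr (_ * _)%E; exact: cell_massE.
move=> x _; rewrite finite_valuedE -sumEFin.
by apply: eq_bigr => v _; rewrite EFinM.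
Qed.

Lemma cell_mass_sum : \sum_v cell_mass v = 1.
Proof.
have := integral_finite_valued (fun=> 1); rewrite integral_probability_cst => -[->].
by apply: eq_bigr => v _; rewrite mulr1.
Qed.

End FiniteValued.

(** A finitely valued approximation of the pair [(f1, f2)] in mean square which
    keeps both means equal to 0. *)
Record discretization d (S : measurableType d) (R : realType) (P : probability S R)
    (f1 f2 : S -> R) (e : R) := Discretization {
  dcell : finType;
  dmap : S -> dcell;
  dval1 : dcell -> R;
  dval2 : dcell -> R;
  dmeas : forall v, measurable (dmap @^-1` [set v]);
  dmean1 : (\int[P]_x (dval1 (dmap x))%:E = 0)%E;
  dmean2 : (\int[P]_x (dval2 (dmap x))%:E = 0)%E;
  derr : (\int[P]_x ((f1 x - dval1 (dmap x)) ^+ 2 + (f2 x - dval2 (dmap x)) ^+ 2)%:E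
          <= e%:E)%E }.

Section DiscretizationExists.
Context d (S : measurableType d) (R : realType) (P : probability S R).

Definition centred_l2 (f : S -> R) := [/\ measurable_fun [set: S] f,
  (\int[P]_x ((f x) ^+ 2)%:E < +oo)%E & (\int[P]_x (f x)%:E = 0)%E].

Lemma integrable_l2 (f : S -> R) : measurable_fun [set: S] f ->
  (\int[P]_x ((f x) ^+ 2)%:E < +oo)%E -> P.-integrable [set: S] (fun x => (f x)%:E).
Proof.
move=> mf f2.
have i2 : P.-integrable [set: S] (fun x => (f x ^+ 2 + 1)%:E).
  have -> : (fun x => (f x ^+ 2 + 1)%:E) = ((fun x => (f x ^+ 2)%:E) \+ cst 1%:E)%E by [].
  apply: integrableD => //.
    apply/integrableP; split; first by apply/measurable_EFinP; exact: measurable_funX.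
    rewrite (eq_integral (fun x => (f x ^+ 2)%:E))// => x _.
    by rewrite gee0_abs// lee_fin sqr_ge0.
  exact: finite_measure_integrable_cst.
apply: (le_integrable _ _ _ i2) => //; first exact/measurable_EFinP.
move=> x _; rewrite /= lee_fin [leRHS]ger0_norm ?addr_ge0 ?sqr_ge0//.
rewrite -(real_normK (num_real (f x))); move: (`|f x|) => y.
have := sqr_ge0 (2 * y - 1); rewrite -subr_ge0 => h.
have := sqr_ge0 (y - 2^-1); lra.
Qed.

(** Subtracting its mean brings an approximation closer to [f], whose mean is
    0. *)
Lemma centred_simple_approx (f : S -> R) (e : R) : centred_l2 f -> 0 < e ->
  exists g : S -> R,
  [/\ measurable_fun [set: S] g, finite_set (range g), (\int[P]_x (g x)%:E = 0)%E &
      (\int[P]_x ((f x - g x) ^+ 2)%:E <= e%:E)%E].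
Proof.
move=> [mf f2 f0] e0; have [g [mg fg ge]] := simple_square_approx mf f2 e0.
pose h x := f x - g x.
have mh : measurable_fun [set: S] h by exact: measurable_funB.
have h2 : (\int[P]_x ((h x) ^+ 2)%:E < +oo)%E by exact: le_lt_trans ge (ltry _).
have ih := integrable_l2 mh h2; have if_ := integrable_l2 mf f2.
have ig : P.-integrable [set: S] (fun x => (g x)%:E).
  have -> : (fun x => (g x)%:E) = ((fun x => (f x)%:E) \- (fun x => (h x)%:E))%E.
    by apply/funext => x; rewrite /h -EFinB; congr (_%:E); ring.
  exact: integrableB.
pose c := fine (\int[P]_x (g x)%:E)%E.
have cE : (\int[P]_x (g x)%:E = c%:E)%E by rewrite fineK//; exact: integrable_fin_num.
exists (fun x => g x - c); split.
- by apply: measurable_funB => //; exact: measurable_cst.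
- have : finite_set [set y - c | y in range g] by exact: finite_image.
  by apply: sub_finite_set => _ [x _ <-]; exists (g x) => //; exists x.
- have -> : (fun x => (g x - c)%:E) = ((fun x => (g x)%:E) \- cst c%:E)%E by [].
  rewrite integralB//; last exact: finite_measure_integrable_cst.
  by rewrite integral_probability_cst cE subee.
have hE : (\int[P]_x (h x)%:E = (- c)%:E)%E.
  rewrite (eq_integral (fun x => (f x)%:E - (g x)%:E)%E) => [|x _]; last by rewrite EFinB.
  by rewrite integralB// f0 cE sub0e EFinN.
have ih2 : P.-integrable [set: S] (fun x => (h x ^+ 2)%:E).
  apply/integrableP; split; first by apply/measurable_EFinP; exact: measurable_funX.
  rewrite (eq_integral (fun x => (h x ^+ 2)%:E))// => x _.
  by rewrite gee0_abs// lee_fin sqr_ge0.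
rewrite (eq_integral (fun x => (h x ^+ 2)%:E + ((2 * c)%:E * (h x)%:E + cst (c ^+ 2)%:E x))%E).
  rewrite integralD//; last first.
    apply: integrableD => //; first exact: integrableZl.
    exact: finite_measure_integrable_cst.
  rewrite integralD//; [|exact: integrableZl|exact: finite_measure_integrable_cst].
  rewrite integralZl// hE integral_probability_cst -EFinM -EFinD.
  apply: le_trans (_ : (_ + 0%:E <= _)%E); last by rewrite adde0; exact: ge.
  rewrite leeD2l// lee_fin; have := sqr_ge0 c; lra.
move=> x _; rewrite /= -EFinM -!EFinD; congr (_%:E); rewrite /h; ring.
Qed.

Lemma discretization_exists (f1 f2 : S -> R) (e : R) : 0 < e ->
  centred_l2 f1 -> centred_l2 f2 -> inhabited (discretization P f1 f2 e).
Proof.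
move=> e0 h1 h2; have e2 : 0 < e / 2 by rewrite divr_gt0.
have [g1 [mg1 fg1 mean1 err1]] := centred_simple_approx h1 e2.
have [g2 [mg2 fg2 mean2 err2]] := centred_simple_approx h2 e2.
have [mf1 _ _] := h1; have [mf2 _ _] := h2.
pose G x := (g1 x, g2 x).
have fG : finite_set (range G).
  apply: sub_finite_set (finite_setX fg1 fg2) => _ [x _ <-] /=.
  by split; exists x.
pose A : {fset R * R} := fset_set (range G).
have GA x : G x \in A by rewrite in_fset_set// inE; exists x.
pose phi x : A := [` GA x]%fset.
apply: inhabits; apply: (@Discretization _ S R P f1 f2 e A phi
  (fun v => (fsval v).1) (fun v => (fsval v).2)) => //.
- move=> v; have -> : phi @^-1` [set v] =
    g1 @^-1` [set (fsval v).1] `&` g2 @^-1` [set (fsval v).2].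
    apply/seteqP; split=> x /=; first by move=> <-.
    by case=> ? ?; apply: val_inj; rewrite /= /G [RHS]surjective_pairing; congr pair.
  apply: measurableI; rewrite -[X in measurable X]setTI.
    exact: mg1.
  exact: mg2.
- under eq_integral do rewrite EFinD.
  rewrite ge0_integralD//.
  + have -> : e = e / 2 + e / 2 by field.
    by rewrite EFinD leeD.
  + by move=> x _; rewrite lee_fin sqr_ge0.
  + by apply/measurable_EFinP; apply: measurable_funX; exact: measurable_funB.
  + by move=> x _; rewrite lee_fin sqr_ge0.
  + by apply/measurable_EFinP; apply: measurable_funX; exact: measurable_funB.
Qed.

End DiscretizationExists.

(** * Finite arrays of independent entries *)

Section Configurations.
Context d d' (T : measurableType d) (S : measurableType d') (R : realType).
Variables (P : probability T R) (Y : nat * nat -> T -> S).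
Hypothesis Y_iid : iid P Y.

Let mY ij : measurable_fun [set: T] (Y ij). Proof. by case: Y_iid. Qed.

HB.instance Definition _ ij := @isMeasurableFun.Build _ _ _ _ (Y ij) (mY ij).

Definition entry_law : probability S R := distribution P (Y (0%N, 0%N)).

Lemma entry_lawE ij (B : set S) : measurable B -> P (Y ij @^-1` B) = entry_law B.
Proof. by case: Y_iid => _ _ idd mB; exact: (idd ij (0%N, 0%N)). Qed.

Lemma integral_entry ij (f : S -> R) : measurable_fun [set: S] f ->
  (forall x, 0 <= f x) ->
  (\int[P]_w (f (Y ij w))%:E = \int[entry_law]_x (f x)%:E)%E.
Proof.
move=> mf f0.
have mF : measurable_fun [set: S] (EFin \o f) by exact/measurable_EFinP.
have F0 y : (0 <= (EFin \o f) y)%E by rewrite lee_fin.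
rewrite -[LHS](@ge0_integral_distribution _ _ _ _ _ P (Y ij) (EFin \o f) mF F0).
apply: eq_measure_integral => A mA _; exact: (entry_lawE ij mA).
Qed.

Variables (V : finType) (phi : S -> V).
Hypothesis mphi : forall v, measurable (phi @^-1` [set v]).

Variable n : nat.
Local Notation Om := {ffun 'I_n -> {ffun 'I_n -> V}}.

(** The cells of the first [n * n] entries: a random point of a finite product
    space. *)
Definition config (w : T) : Om := [ffun i : 'I_n => [ffun j : 'I_n => phi (Y (val i, val j) w)]].

Definition square_idx : seq (nat * nat) :=
  [seq (val i, val j) | i <- enum 'I_n, j <- enum 'I_n].

Lemma square_idx_uniq : uniq square_idx.
Proof.
apply: allpairs_uniq; rewrite ?enum_uniq// => -[i j] [i' j'] _ _ [].
by move=> /val_inj -> /val_inj ->.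
Qed.

Lemma config_mass (s : Om) : P (config @^-1` [set s]) =
  (weight (weight (cell_mass entry_law phi) : {ffun 'I_n -> V} -> R) s)%:E.
Proof.
pose B (ij : nat * nat) : set S :=
  if (insub ij.1, insub ij.2) is (Some i, Some j) then phi @^-1` [set s i j] else setT.
have BE (i j : 'I_n) : B (val i, val j) = phi @^-1` [set s i j].
  by rewrite /B /= !valK.
have mB ij : measurable (B ij).
  rewrite /B; case: (insub ij.1 : option 'I_n) => [i|//].
  by case: (insub ij.2 : option 'I_n) => [j|].
pose J : {fset nat * nat} := seq_fset tt square_idx.
have JE ij : (ij \in J) = (ij \in square_idx) by rewrite seq_fsetE.
have -> : config @^-1` [set s] = \bigcap_(ij in [set` J]) (Y ij @^-1` B ij).
  apply/seteqP; split=> w /=.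
    move=> ws ij /=; rewrite JE => /allpairsP[[i j] [_ _ ->]] /=.
    by rewrite BE /= -ws !ffunE.
  move=> h; apply/ffunP => i; apply/ffunP => j; rewrite !ffunE.
  have := h (val i, val j); rewrite /= BE; apply.
  by rewrite JE; apply/allpairsP; exists (i, j); rewrite !mem_enum.
case: Y_iid => _ indep _; rewrite indep//.
have PB ij : P (Y ij @^-1` B ij) = (fine (entry_law (B ij)))%:E.
  by rewrite fineK ?fin_num_measure//; exact: entry_lawE.
under eq_bigr do rewrite PB.
rewrite prodEFin; congr (_%:E).
rewrite (perm_big square_idx)/=; last first.
  have := seq_fset_perm tt square_idx; rewrite undup_id//; exact: square_idx_uniq.
rewrite big_allpairs_dep big_enum/=; apply: eq_bigr => i _.
by rewrite big_enum/=; apply: eq_bigr => j _; rewrite BE.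
Qed.

Lemma measurable_config (s : Om) : measurable (config @^-1` [set s]).
Proof.
have -> : config @^-1` [set s] =
  \bigcap_(ij in [set: 'I_n * 'I_n]) (Y (val ij.1, val ij.2) @^-1` (phi @^-1` [set s ij.1 ij.2])).
  apply/seteqP; split=> w /=; first by move=> <- [i j] _ /=; rewrite !ffunE.
  by move=> h; apply/ffunP => i; apply/ffunP => j; rewrite !ffunE; exact: (h (i, j) I).
apply: fin_bigcap_measurable; first exact: finite_finset.
by move=> ij _; rewrite -[X in measurable X]setTI; exact: mY.
Qed.

Lemma measurable_config_pred (Q : pred Om) : measurable [set w | Q (config w)].
Proof.
have := measurable_finite_valued measurable_config (fun s => (Q s)%:R : R)
  measurableT (measurable_set1 1).
rewrite setTI; congr (measurable _); apply/seteqP; split=> w /=.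
  by case: (Q _) => // /eqP; rewrite eq_sym oner_eq0.
by move=> ->.
Qed.

Lemma config_pred_mass (Q : pred Om) : P [set w | Q (config w)] =
  (\sum_(s : Om | Q s) weight (weight (cell_mass entry_law phi) : {ffun 'I_n -> V} -> R) s)%:E.
Proof.
have mc := measurable_config; have mQ := measurable_config_pred Q.
have := integral_indic P measurableT mQ; rewrite setIT => <-.
rewrite (eq_integral (fun w => ((Q (config w))%:R : R)%:E)); last first.
  move=> w _; rewrite indicE; congr (_%:R%:E); congr nat_of_bool.
  by apply/idP/idP; rewrite inE.
rewrite (integral_finite_valued P mc (fun s => (Q s)%:R : R)) [in RHS]big_mkcond; congr (_%:E).
apply: eq_bigr => s _; rewrite /cell_mass config_mass /=.
by case: (Q s); rewrite ?mulr1 ?mulr0.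
Qed.

End Configurations.

(** * A fine and a coarse discretization of the entries *)

Section Sharpen.
Variable R : realType.

Lemma norm2_sub (u v h k a : R) : 0 < a ->
  `|(u ^+ 2 + v ^+ 2) - ((u - h) ^+ 2 + (v - k) ^+ 2)| <=
  a * (u ^+ 2 + v ^+ 2) + (1 + a^-1) * (h ^+ 2 + k ^+ 2).
Proof.
move=> a0; have young (x y s : R) : `|s| = 1 -> 2 * s * x * y <= a * x ^+ 2 + a^-1 * y ^+ 2.
  move=> s1; have s2 : s ^+ 2 = 1 by rewrite -(real_normK (num_real s)) s1 expr1n.
  have := mulr_ge0 (ltW (divr_gt0 ltr01 a0)) (sqr_ge0 (a * x - s * y)).
  rewrite -subr_ge0 => h0; rewrite -subr_ge0.
  suff -> : a * x ^+ 2 + a^-1 * y ^+ 2 - 2 * s * x * y = 1 / a * (a * x - s * y) ^+ 2 - 0 by [].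
  have -> : a^-1 * y ^+ 2 = a^-1 * (s ^+ 2 * y ^+ 2) by rewrite s2 mul1r.
  by field; rewrite gt_eqF.
have N1 : `|-1 : R| = 1 by rewrite normrN normr1.
have P1 := normr1 R.
have y1 := young u h _ P1; have y2 := young u h _ N1.
have y3 := young v k _ P1; have y4 := young v k _ N1.
have h2 := sqr_ge0 h; have k2 := sqr_ge0 k.
rewrite ler_norml; apply/andP; split; lra.
Qed.

End Sharpen.

Section PairCells.
Context d (S : measurableType d) (R : realType) (nu : probability S R).
Variables (f1 f2 : S -> R) (e1 e2 : R).
Hypotheses (f1_l2 : centred_l2 nu f1) (f2_l2 : centred_l2 nu f2).
Hypothesis f_unit : (\int[nu]_x (f1 x ^+ 2 + f2 x ^+ 2)%:E = 1)%E.
Variables (D1 : discretization nu f1 f2 e1) (D2 : discretization nu f1 f2 e2).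

Definition pair_cell : finType := (dcell D1 * dcell D2)%type.

Definition pair_map (x : S) : pair_cell := (dmap D1 x, dmap D2 x).

Lemma measurable_pair_map v : measurable (pair_map @^-1` [set v]).
Proof.
case: v => v1 v2; have -> : pair_map @^-1` [set (v1, v2)] =
    (dmap D1 @^-1` [set v1]) `&` (dmap D2 @^-1` [set v2]).
  by apply/seteqP; split=> x /=; [case=> -> ->|case=> <- <-].
by apply: measurableI; exact: dmeas.
Qed.

(** The fine values are close to the entries but their range depends on the
    accuracy; the coarse ones stay fixed, so that one bound serves for all
    [N]. *)
Definition fine_val (v : pair_cell) : R[i] := Complex (dval1 v.1) (dval2 v.1).
Definition coarse_val (v : pair_cell) : R[i] := Complex (dval1 v.2) (dval2 v.2).

Local Notation mass := (cell_mass nu pair_map).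

Lemma coarse_mean : \sum_v (mass v)%:C%C * coarse_val v = 0.
Proof.
have i1 := integral_finite_valued nu measurable_pair_map (fun v => dval1 v.2).
have i2 := integral_finite_valued nu measurable_pair_map (fun v => dval2 v.2).
have m1 : \sum_v mass v * dval1 v.2 = 0 by apply: EFin_inj; rewrite -i1; exact: dmean1.
have m2 : \sum_v mass v * dval2 v.2 = 0 by apply: EFin_inj; rewrite -i2; exact: dmean2.
apply/eqP; rewrite eq_complex !raddf_sum/=; apply/andP; split; apply/eqP.
  by rewrite -[RHS]m1; apply: eq_bigr => v _; rewrite mul0r subr0.
by rewrite -[RHS]m2; apply: eq_bigr => v _; rewrite mul0r addr0.
Qed.

Lemma normcE2 (z : R[i]) : Normc.normc z ^+ 2 = complex.Re z ^+ 2 + complex.Im z ^+ 2.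
Proof. by case: z => a b; rewrite /= sqr_sqrtr// addr_ge0 ?sqr_ge0. Qed.

Let mf1 : measurable_fun [set: S] f1. Proof. by case: f1_l2. Qed.
Let mf2 : measurable_fun [set: S] f2. Proof. by case: f2_l2. Qed.
Let mpv (h : pair_cell -> R) : measurable_fun [set: S] (fun x => h (pair_map x)).
Proof. exact: (measurable_finite_valued measurable_pair_map). Qed.

Let merr (u v : pair_cell -> R) : measurable_fun [set: S]
  (fun x => (f1 x - u (pair_map x)) ^+ 2 + (f2 x - v (pair_map x)) ^+ 2).
Proof. by apply: measurable_funD; apply: measurable_funX; apply: measurable_funB. Qed.
Let err2 x := (f1 x - dval1 (pair_map x).2) ^+ 2 + (f2 x - dval2 (pair_map x).2) ^+ 2.
Let merr2 : measurable_fun [set: S] err2.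
Proof. exact: (merr (fun v => dval1 v.2) (fun v => dval2 v.2)). Qed.
Let err1 x := (f1 x - dval1 (pair_map x).1) ^+ 2 + (f2 x - dval2 (pair_map x).1) ^+ 2.
Let merr1 : measurable_fun [set: S] err1.
Proof. exact: (merr (fun v => dval1 v.1) (fun v => dval2 v.1)). Qed.

Lemma coarse_fine_dist :
  \sum_v mass v * Normc.normc (fine_val v - coarse_val v) ^+ 2 <= 2 * e1 + 2 * e2.
Proof.
rewrite -lee_fin -(integral_finite_valued nu measurable_pair_map
  (fun v => Normc.normc (fine_val v - coarse_val v) ^+ 2)).
have err_ge0 (u v : R) : (0 <= (u ^+ 2 + v ^+ 2)%:E)%E by rewrite lee_fin addr_ge0 ?sqr_ge0.
apply: (@le_trans _ _ (\int[nu]_x (2%:E * (err1 x)%:E + 2%:E * (err2 x)%:E))%E).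
  apply: ge0_le_integral => //.
  - by move=> x _; rewrite lee_fin sqr_ge0.
  - apply/measurable_EFinP; exact: (mpv (fun v => Normc.normc (fine_val v - coarse_val v) ^+ 2)).
  - apply: emeasurable_funD; apply: measurable_funeM; exact/measurable_EFinP.
  move=> x _; rewrite -!EFinM -EFinD lee_fin normcE2/= /err1 /err2 /=.
  move: (dval1 _) (dval2 _) (dval1 _) (dval2 _) => a b c d'.
  have := sqr_ge0 (f1 x - a + (f1 x - c)); have := sqr_ge0 (f2 x - b + (f2 x - d')).
  nra.
rewrite ge0_integralD//; last 4 first.
- by move=> x _; rewrite mule_ge0// err_ge0.
- apply: measurable_funeM; exact/measurable_EFinP.
- by move=> x _; rewrite mule_ge0// err_ge0.
- apply: measurable_funeM; exact/measurable_EFinP.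
rewrite !ge0_integralZl//;
  [|exact/measurable_EFinP|by move=> x _; exact: err_ge0
   |exact/measurable_EFinP|by move=> x _; exact: err_ge0].
rewrite [leRHS](_ : _ = (2%:E * e1%:E + 2%:E * e2%:E)%E); last by rewrite -!EFinM -EFinD.
by apply: leeD; rewrite lee_pmul2l//; exact: derr.
Qed.

Lemma coarse_var (a : R) : 0 < a ->
  `|1 - \sum_v mass v * Normc.normc (coarse_val v) ^+ 2| <= a + (1 + a^-1) * e2.
Proof.
move=> a0; set s2 := \sum_v _.
have s2E : (\int[nu]_x (Normc.normc (coarse_val (pair_map x)) ^+ 2)%:E = s2%:E)%E.
  exact: (integral_finite_valued nu measurable_pair_map (fun v => Normc.normc (coarse_val v) ^+ 2)).
have err_ge0 (u v : R) : (0 <= (u ^+ 2 + v ^+ 2)%:E)%E by rewrite lee_fin addr_ge0 ?sqr_ge0.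
have ic : nu.-integrable [set: S] (fun x => (Normc.normc (coarse_val (pair_map x)) ^+ 2)%:E).
  exact: (integrable_finite_valued nu measurable_pair_map (fun v => Normc.normc (coarse_val v) ^+ 2)).
have iu : nu.-integrable [set: S] (fun x => (f1 x ^+ 2 + f2 x ^+ 2)%:E).
  apply/integrableP; split.
    by apply/measurable_EFinP; apply: measurable_funD; exact: measurable_funX.
  rewrite (eq_integral (fun x => (f1 x ^+ 2 + f2 x ^+ 2)%:E)); first by rewrite f_unit ltry.
  by move=> x _; rewrite gee0_abs// err_ge0.
pose H x := (f1 x ^+ 2 + f2 x ^+ 2) - Normc.normc (coarse_val (pair_map x)) ^+ 2.
have iH : (\int[nu]_x (H x)%:E = (1 - s2)%:E)%E.
  rewrite (eq_integral (fun x => (f1 x ^+ 2 + f2 x ^+ 2)%:E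
     - (Normc.normc (coarse_val (pair_map x)) ^+ 2)%:E)%E) => [|x _]; last by rewrite -EFinB.
  by rewrite integralB//; rewrite [X in (X - _)%E]f_unit s2E.
have mH : measurable_fun [set: S] H.
  apply: measurable_funB; first by apply: measurable_funD; exact: measurable_funX.
  exact: (mpv (fun v => Normc.normc (coarse_val v) ^+ 2)).
rewrite -lee_fin -abse_EFin -iH; apply: le_trans (le_abse_integral _ measurableT _) _.
  exact/measurable_EFinP.
apply: (@le_trans _ _ (\int[nu]_x (a%:E * (f1 x ^+ 2 + f2 x ^+ 2)%:E + (1 + a^-1)%:E * (err2 x)%:E))%E).
  have a1 : (0 <= (1 + a^-1)%:E)%E by rewrite lee_fin addr_ge0// invr_ge0 ltW.
  apply: ge0_le_integral => //.
  - by apply: measurableT_comp => //; exact/measurable_EFinP.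
  - apply: emeasurable_funD; apply: measurable_funeM; apply/measurable_EFinP => //.
    by apply: measurable_funD; exact: measurable_funX.
  move=> x _; rewrite abse_EFin -!EFinM -EFinD lee_fin /H normcE2 /err2 /=.
  have := norm2_sub (f1 x) (f2 x) (f1 x - dval1 (dmap D2 x)) (f2 x - dval2 (dmap D2 x)) a0.
  by rewrite !subKr.
have a1 : (0 <= (1 + a^-1)%:E)%E by rewrite lee_fin addr_ge0// invr_ge0 ltW.
have a00 : (0 <= a%:E)%E by rewrite lee_fin ltW.
rewrite ge0_integralD//; last 4 first.
- by move=> x _; rewrite mule_ge0// err_ge0.
- apply: measurable_funeM; apply/measurable_EFinP.
  by apply: measurable_funD; exact: measurable_funX.
- by move=> x _; rewrite mule_ge0// err_ge0.
- apply: measurable_funeM; exact/measurable_EFinP.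
have mu12 : measurable_fun [set: S] (fun x => (f1 x ^+ 2 + f2 x ^+ 2)%:E).
  by apply/measurable_EFinP; apply: measurable_funD; exact: measurable_funX.
rewrite !ge0_integralZl//; try by move=> x _; exact: err_ge0.
  all: try exact/measurable_EFinP.
rewrite [X in (_ * X + _)%E]f_unit mule1 [leRHS](_ : _ = (a%:E + (1 + a^-1)%:E * e2%:E)%E); last by rewrite -EFinM.
apply: leeD => //.
by apply: lee_wpmul2l => //; exact: derr.
Qed.

End PairCells.

Lemma coarse_bounded d (S : measurableType d) (R : realType) (nu : probability S R)
  (f1 f2 : S -> R) (e2 : R) (D2 : discretization nu f1 f2 e2) :
  exists B : R, forall e1 (D1 : discretization nu f1 f2 e1) (v : pair_cell D1 D2),
    `|coarse_val v| <= B%:C%C.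
Proof.
pose b (u : dcell D2) := Normc.normc (Complex (dval1 u) (dval2 u)).
exists (\sum_u b u) => e1 D1 v.
rewrite [leLHS](_ : _ = (b v.2)%:C%C)// lecR (bigD1 v.2)//= lerDl.
by apply: sumr_ge0 => w _; exact: sqrtr_ge0.
Qed.

(** * Two probability estimates *)

Section ProbabilityTools.
Context d (T : measurableType d) (R : realType) (P : probability T R).

Lemma markov_ge0 (f : T -> R) (c b : R) : measurable_fun [set: T] f ->
  (forall w, 0 <= f w) -> 0 < c -> (\int[P]_w (f w)%:E <= b%:E)%E ->
  (P [set w | (c <= f w)%R] <= (b / c)%:E)%E.
Proof.
move=> mf f0 c0 fb.
have mA : measurable [set w | c <= f w].
  rewrite [X in measurable X](_ : _ = f @^-1` `[c, +oo[%classic); last first.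
    by apply/seteqP; split=> w /=; rewrite in_itv/= andbT.
  by rewrite -[X in measurable X]setTI; exact: mf.
rewrite -(@lee_pmul2l _ c%:E)// ?lte_fin// -[leRHS]EFinM mulrCA mulfV ?gt_eqF// mulr1.
apply: le_trans fb; have := integral_indic P measurableT mA; rewrite setIT => <-.
rewrite -ge0_integralZl//; last 2 first.
- by apply/measurable_EFinP; exact: measurable_indic.
- by rewrite lee_fin ltW.
apply: ge0_le_integral => //.
- by move=> x _; rewrite mule_ge0// lee_fin ltW.
- apply: measurable_funeM; apply/measurable_EFinP; exact: measurable_indic.
- exact/measurable_EFinP.
move=> w _; rewrite -EFinM lee_fin indicE; case: (boolP (w \in _)) => [|_].
  by rewrite inE /= mulr1.
by rewrite mulr0.
Qed.

(** The Borel-Cantelli lemma with a geometric bound. *)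
Lemma ae_eventually_not (A : nat -> set T) (a q : R) : (forall N, measurable (A N)) ->
  0 <= a -> 0 <= q < 1 -> (forall N, (P (A N) <= (a * q ^+ N)%:E)%E) ->
  {ae P, forall w, \forall N \near \oo, ~ A N w}.
Proof.
move=> mA a0 /andP[q0 q1] PA.
have lim0 : P (lim_sup_set A) = 0%E.
  apply: lim_sup_set_cvg0 => //; apply: le_lt_trans (ltry (a / (1 - q))).
  apply: lime_le; first exact: is_cvg_nneseries.
  apply: nearW => n; apply: le_trans (_ : (\sum_(0 <= i < n) (a * q ^+ i)%:E <= _)%E).
    by apply: lee_sum => i _; exact: PA.
  rewrite sumEFin lee_fin.
  have := @geometric_seriesE R a q; rewrite lt_eqF// => /(_ isT)/(congr1 (fun f => f n)).
  rewrite seriesEnat /= => ->.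
  rewrite ler_wpM2r ?invr_ge0 ?subr_ge0 ?(ltW q1)//.
  by rewrite -[leRHS]mulr1 ler_wpM2l// lerBlDr lerDl exprn_ge0.
exists (lim_sup_set A); split => //.
  by apply: bigcap_measurable => // n _; exact: bigcup_measurable.
move=> w /= nw n _; apply: contrapT => h; apply: nw; exists n => // N /= nN AN.
by apply: h; exists N.
Qed.

End ProbabilityTools.

(** * Blocks of a dilated diagram *)

Section Blocks.
Variables (R : realType) (la : int_partition) (N : nat).
Local Notation l := (plength la).
Hypothesis N0 : (0 < N)%N.

Lemma lt_plength i : (i < plength la)%N = (0 < la i)%N.
Proof.
rewrite /plength; case: ex_minnP => m /eqP m0 mmin; apply/idP/idP => [im|i0].
  by rewrite lt0n; apply/negP => /mmin; rewrite leqNgt im.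
rewrite ltnNge; apply/negP => /(part_noninc la); rewrite m0 leqn0 => /eqP i1.
by rewrite i1 in i0.
Qed.

Lemma in_diagramE (mu : int_partition) i j : (forall k, (k < plength mu)%N = (0 < mu k)%N) ->
  in_diagram mu i j = (j < mu i)%N.
Proof.
move=> h; rewrite /in_diagram h; apply/andP/idP => [[]//|ji]; split => //.
exact: leq_ltn_trans ji.
Qed.

Lemma block_subproof (i : 'I_(N * l)) : (i %/ N < l)%N.
Proof. by rewrite ltn_divLR// [X in (_ < X)%N]mulnC. Qed.

Definition block (i : 'I_(N * l)) : 'I_l := Ordinal (block_subproof i).

Lemma sum_blocks (F : 'I_l -> R) : \sum_(j < N * l) F (block j) = N%:R * \sum_b F b.
Proof.
pose G k := oapp F 0 (insub k).
have GE (b : 'I_l) : G b = F b by rewrite /G valK.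
transitivity (\sum_(0 <= j < N * l) G (j %/ N)%N).
  by rewrite big_mkord; apply: eq_bigr => j _; rewrite -GE.
transitivity (N%:R * \sum_(0 <= b < l) G b); last first.
  by rewrite big_mkord; congr (_ * _); apply: eq_bigr => b _; rewrite GE.
elim: (l) => [|k IH]; first by rewrite muln0 !big_geq// mulr0.
rewrite big_nat_recr//= mulrDr -IH mulnSr.
rewrite (big_cat_nat (n := (N * k)%N))//= ?leq_addr//; congr (_ + _).
rewrite -{1}[(N * k)%N]add0n big_addn addnC addnK.
rewrite (eq_big_nat _ _ (F2 := fun=> G k)); last first.
  by move=> i /andP[_ iN]; rewrite addnC mulnC divnMDl// divn_small// addn0.
by rewrite sumr_const_nat subn0 mulr_natl.
Qed.

End Blocks.

Section DilatedMask.
Variables (R : realType) (la : int_partition) (N : nat).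
Local Notation l := (plength la).
Hypothesis la_sc : self_conjugate la.
Hypothesis N0 : (0 < N)%N.

Definition dilated_mask (i j : 'I_(N * l)) := in_diagram (dilate N la) i j.

Lemma dilated_maskE i j : dilated_mask i j = linked (block N0 i) (block N0 j).
Proof.
rewrite /dilated_mask /linked la_sc andbb la_sc.
rewrite (in_diagramE _ _ (lt_plength (dilate N la))) (in_diagramE _ _ (lt_plength la)) /=.
by rewrite /dilate_part ltn_divLR// (mulnC (la _)).
Qed.

Lemma dilated_mask_sym : symmetric dilated_mask.
Proof. by move=> i j; rewrite !dilated_maskE /linked andbC. Qed.

Lemma block_fixed_point (t : R) (T : 'I_l -> R) :
  (forall a, T a * (1 + (l%:R * t)^-1 * \sum_(b | linked a b) T b) = 1) ->
  forall i, T (block N0 i) * (1 + ((N * l)%:R * t)^-1 *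
    \sum_(j | dilated_mask i j) T (block N0 j)) = 1.
Proof.
move=> Tfix i; rewrite -[RHS](Tfix (block N0 i)); congr (_ * (1 + _)).
have -> : \sum_(j | dilated_mask i j) T (block N0 j) =
    N%:R * \sum_(b | linked (block N0 i) b) T b.
  rewrite [X in _ * X]big_mkcond -(sum_blocks N0 (fun b => if linked (block N0 i) b then T b else 0)).
  by rewrite big_mkcond; apply: eq_bigr => j _; rewrite dilated_maskE.
by rewrite natrM -mulrA invfM mulrACA mulVf ?mul1r// pnatr_eq0 -lt0n.
Qed.

Lemma block_trace (t : R) (T : 'I_l -> R) :
  ((N * l)%:R * t)^-1 * \sum_i T (block N0 i) = (l%:R * t)^-1 * \sum_a T a.
Proof.
by rewrite sum_blocks natrM -mulrA invfM mulrACA mulVf ?mul1r// pnatr_eq0 -lt0n.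
Qed.

End DilatedMask.

(** * Almost sure convergence of the resolvent trace *)

Section ErrorTerms.
Variable R : realType.

Lemma resolvent_trace_perturb n (t tau k : R) (A B : 'M[R[i]]_n) : (0 < n)%N ->
  2 <= t -> tau = n%:R * t -> 0 < k ->
  `|resolvent_trace tau A - resolvent_trace tau B| <=
  k * (\sum_i \sum_j Normc.normc (A i j - B i j) ^+ 2) + n%:R / (k * tau ^+ 3).
Proof.
move=> n0 t2 tauE k0; have t0 : 0 < t by apply: lt_le_trans t2; rewrite ltr0n.
have tauC0 : 0 < tau%:C%C :> R[i] by rewrite ltcR tauE mulr_gt0// ltr0n.
have kC0 : 0 < k%:C%C :> R[i] by rewrite ltcR.
rewrite -lecR (resolvent_traceB n0 t2 tauE).
apply: le_trans (gres_trace_perturb tauC0 kC0 A B) _.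
rewrite [leRHS]rmorphD !rmorphM/= fmorphV/= rmorphM rmorphXn/= rmorph_nat.
rewrite lerD2r ler_pM2l// /frob rmorph_sum; apply: ler_sum => i _.
by rewrite rmorph_sum; apply: ler_sum => j _; rewrite !mxE rmorphXn.
Qed.

Lemma inv_cube_le (t e : R) : 2 <= t -> 0 <= e -> e / 8 * t ^- 3 <= e / 64.
Proof.
move=> t2 e0; have t0 : 0 < t by lra.
have u3 : t ^- 3 <= 2^-1 ^+ 3.
  by rewrite -exprVn lerXn2r ?nnegrE ?invr_ge0 ?(ltW t0)// lef_pV2 ?posrE.
have e80 : 0 <= e / 8 by rewrite divr_ge0.
have := ler_wpM2l e80 u3; lra.
Qed.

(** The bound of [array_trace_bias] for [k = 8 / (n ^+ 2 * e)], [eta = e / 32],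
    [dl = 2 * e1 + 2 * (e ^+ 2 / 1000)], and for [s] the bound of [coarse_var]
    with [a = e / 16]. *)
Lemma bias_terms (n t e b e1 s : R) : 0 < n -> 2 <= t -> 0 < e -> e <= 1 -> 0 <= b ->
  0 <= s -> s <= e / 16 + (1 + (e / 16)^-1) * (e ^+ 2 / 1000) ->
  8 / (n ^+ 2 * e) * (n ^+ 2 * (2 * e1 + 2 * (e ^+ 2 / 1000))) +
    n / (8 / (n ^+ 2 * e) * (n * t) ^+ 3) +
  2 * (e / 32 + 8 * b * n / (n * t) ^+ 2 / (e / 32) + (n * t)^-1 + s * (n / (n * t))) <=
  e / 4 + 16 * e1 / e + (128 * b / e + 1) / n.
Proof.
move=> n0 t2 e0 e_le1 b0 s0 sle.
have t0 : 0 < t by lra.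
have -> : 8 / (n ^+ 2 * e) * (n ^+ 2 * (2 * e1 + 2 * (e ^+ 2 / 1000))) =
    16 * e1 / e + 16 * e / 1000 by field; rewrite !gt_eqF.
have -> : n / (8 / (n ^+ 2 * e) * (n * t) ^+ 3) = e / 8 * t ^- 3.
  by field; rewrite !gt_eqF.
have -> : 8 * b * n / (n * t) ^+ 2 / (e / 32) = 256 * (b / e / n) * t ^- 2.
  by field; rewrite !gt_eqF.
have -> : n / (n * t) = t^-1 by field; rewrite !gt_eqF.
have -> : (n * t)^-1 = n^-1 * t^-1 by rewrite invfM.
have -> : (128 * b / e + 1) / n = 128 * (b / e / n) + n^-1 by field; rewrite !gt_eqF.
have u0 : 0 <= t^-1 by rewrite invr_ge0 ltW.
have u1 : t^-1 <= 2^-1 by rewrite lef_pV2 ?posrE.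
have u2 : t ^- 2 <= 4^-1.
  rewrite -exprVn expr2; apply: le_trans (ler_pM u0 u0 u1 u1) _; lra.
have c0 : 0 <= b / e / n by rewrite !divr_ge0// ltW.
have x3 := inv_cube_le t2 (ltW e0).
have x2 : 256 * (b / e / n) * t ^- 2 <= 256 * (b / e / n) * 4^-1.
  by apply: ler_wpM2l u2; apply: mulr_ge0 c0; rewrite ler0n.
have x1 : n^-1 * t^-1 <= n^-1 * 2^-1 by rewrite ler_wpM2l// invr_ge0 ltW.
have x0 : s * t^-1 <= s * 2^-1 by rewrite ler_wpM2l.
have sle2 : s <= e / 16 + e ^+ 2 / 1000 + 16 * e / 1000.
  apply: le_trans sle _; rewrite le_eqVlt; apply/orP; left; apply/eqP.
  by field; rewrite gt_eqF.
have e2 : e ^+ 2 <= e by rewrite expr2 ler_piMr// ltW.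
lra.
Qed.

End ErrorTerms.

Section TraceConvergence.
Context d (T : measurableType d) (R : realType) (P : probability T R).
Variable Y : nat * nat -> T -> R * R.
Hypothesis Y_iid : iid P Y.
Hypothesis Y_mean1 : (\int[P]_w ((Y (0%N, 0%N) w).1)%:E = 0)%E.
Hypothesis Y_mean2 : (\int[P]_w ((Y (0%N, 0%N) w).2)%:E = 0)%E.
Hypothesis Y_unit :
  (\int[P]_w ((Y (0%N, 0%N) w).1 ^+ 2 + (Y (0%N, 0%N) w).2 ^+ 2)%:E = 1)%E.

Local Notation nu := (entry_law Y_iid).
Local Notation f1 := (@fst R R).
Local Notation f2 := (@snd R R).

Let mY ij : measurable_fun [set: T] (Y ij). Proof. by case: Y_iid. Qed.

Lemma entry_law_unit : (\int[nu]_x (f1 x ^+ 2 + f2 x ^+ 2)%:E = 1)%E.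
Proof.
rewrite -(integral_entry Y_iid (0%N, 0%N) (f := fun x => f1 x ^+ 2 + f2 x ^+ 2))//.
  by apply: measurable_funD; apply: measurable_funX; [exact: measurable_fst|exact: measurable_snd].
by move=> x; rewrite addr_ge0 ?sqr_ge0.
Qed.

Lemma entry_law_centred (f : R * R -> R) : measurable_fun [set: R * R] f ->
  (forall x, f x ^+ 2 <= f1 x ^+ 2 + f2 x ^+ 2) ->
  (\int[P]_w (f (Y (0%N, 0%N) w))%:E = 0)%E -> centred_l2 nu f.
Proof.
move=> mf fle f0.
have f2oo : (\int[nu]_x (f x ^+ 2)%:E < +oo)%E.
  apply: le_lt_trans (ltry 1); rewrite -[leRHS]/(1%E) -entry_law_unit.
  apply: ge0_le_integral => //.
  - by move=> x _; rewrite lee_fin sqr_ge0.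
  - by apply/measurable_EFinP; exact: measurable_funX.
  - by apply/measurable_EFinP; apply: measurable_funD; apply: measurable_funX;
      [exact: measurable_fst|exact: measurable_snd].
  - by move=> x _; rewrite lee_fin.
split => //; rewrite -f0.
pose Y0 : T -> R * R := Y (0%N, 0%N).
have mY0 : measurable_fun [set: T] Y0 by exact: mY.
have mF : measurable_fun [set: R * R] (EFin \o f) by exact/measurable_EFinP.
have int : P.-integrable (Y0 @^-1` setT) ((EFin \o f) \o Y0).
  rewrite preimage_setT; apply: (@integrable_l2 _ _ _ P (f \o Y0)); first exact: measurableT_comp.
  rewrite (integral_entry Y_iid (0%N, 0%N) (f := fun x => f x ^+ 2))//.
  - exact: measurable_funX.
  - by move=> x; exact: sqr_ge0.
have := integral_pushforward mY0 mF int measurableT; rewrite preimage_setT => <-.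
by apply: eq_measure_integral => A mA _.
Qed.

Lemma fst_centred : centred_l2 nu f1.
Proof.
apply: entry_law_centred => //; last by move=> x; rewrite lerDl sqr_ge0.
Qed.

Lemma snd_centred : centred_l2 nu f2.
Proof.
apply: entry_law_centred => //; last by move=> x; rewrite lerDr sqr_ge0.
Qed.

Lemma discretizations e : 0 < e -> inhabited (discretization nu f1 f2 e).
Proof. by move=> e0; exact: discretization_exists fst_centred snd_centred. Qed.

Section Discretized.
Variables (e1 e2 : R) (D1 : discretization nu f1 f2 e1) (D2 : discretization nu f1 f2 e2).

Definition discretization_error (x : R * R) : R :=
  (x.1 - dval1 (dmap D1 x)) ^+ 2 + (x.2 - dval2 (dmap D1 x)) ^+ 2.

Lemma discretization_error_ge0 x : 0 <= discretization_error x.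
Proof. by rewrite addr_ge0 ?sqr_ge0. Qed.

Lemma measurable_discretization_error :
  measurable_fun [set: R * R] discretization_error.
Proof.
have m1 : measurable_fun [set: R * R] (fun x => dval1 (dmap D1 x)).
  exact: (measurable_finite_valued (@dmeas _ _ _ _ _ _ _ D1)).
have m2 : measurable_fun [set: R * R] (fun x => dval2 (dmap D1 x)).
  exact: (measurable_finite_valued (@dmeas _ _ _ _ _ _ _ D1)).
by apply: measurable_funD; apply: measurable_funX; apply: measurable_funB.
Qed.

Definition total_error n (w : T) : R :=
  \sum_(i < n) \sum_(j < n) discretization_error (Y (val i, val j) w).

Lemma measurable_total_error n : measurable_fun [set: T] (total_error n).
Proof.
apply: measurable_sum => i; apply: measurable_sum => j.
by apply: measurableT_comp; [exact: measurable_discretization_error|exact: mY].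
Qed.

Lemma integral_total_error n : (\int[P]_w (total_error n w)%:E <= (n%:R ^+ 2 * e1)%:E)%E.
Proof.
have m1 ij : measurable_fun [set: T] (fun w => (discretization_error (Y ij w))%:E).
  apply/measurable_EFinP; apply: measurableT_comp; last exact: mY.
  exact: measurable_discretization_error.
have p1 ij w : (0 <= (discretization_error (Y ij w))%:E)%E.
  by rewrite lee_fin discretization_error_ge0.
rewrite (eq_integral (fun w => \sum_(i < n) \sum_(j < n)
    (discretization_error (Y (val i, val j) w))%:E)%E); last first.
  by move=> w _; rewrite /total_error -sumEFin; apply: eq_bigr => i _; rewrite -sumEFin.
rewrite ge0_integral_sum//; last 2 first.
- by move=> i; apply: emeasurable_sum => j; exact: m1.
- by move=> i w _; apply: sume_ge0 => j _; exact: p1.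
apply: (@le_trans _ _ (\sum_(i < n) \sum_(j < n) e1%:E)%E).
  apply: lee_sum => i _; rewrite ge0_integral_sum//; apply: lee_sum => j _.
  rewrite (integral_entry Y_iid _ measurable_discretization_error discretization_error_ge0).
  exact: derr.
under eq_bigr do rewrite sumEFin.
rewrite sumEFin lee_fin !sumr_const !card_ord -[e1 *+ n]mulr_natl -[_ *+ n]mulr_natl.
by rewrite expr2 -mulrA.
Qed.

End Discretized.

Variable la : int_partition.
Local Notation l := (plength la).
Hypothesis la_sc : self_conjugate la.
Hypothesis l0 : (0 < l)%N.
Variable t : R.
Hypothesis t2 : 2 <= t.
Variable Tr : 'I_l -> R.
Hypothesis Tr01 : forall a, 0 <= Tr a <= 1.
Hypothesis Tr_fix : forall a, Tr a * (1 + (l%:R * t)^-1 * \sum_(b | linked a b) Tr b) = 1.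

Definition entry_matrix N w : 'M[R[i]]_(N * l) := \matrix_(i, j)
  if @dilated_mask la N i j
  then Complex (Y (val i, val j) w).1 (Y (val i, val j) w).2 else 0.

Local Notation fine_of D1 D2 := (@fine_val _ _ _ _ _ _ _ _ D1 D2).
Local Notation limit_trace := ((l%:R * t)^-1 * \sum_a Tr a).

(** Outside the two exceptional events, that of a large discretization error and
    that of a large deviation of the discretized trace, the error splits into a
    perturbation, a fluctuation and a bias. *)
Lemma trace_close_of_good N w (e b e1 : R) (D1 : discretization nu f1 f2 e1)
  (D2 : discretization nu f1 f2 (e ^+ 2 / 1000)) (n := (N.+1 * l)%N) (tau := n%:R * t)
  (mask := @dilated_mask la N.+1)
  (p := cell_mass nu (pair_map D1 D2)) :
  0 < e -> e <= 1 -> (forall v : pair_cell D1 D2, `|coarse_val v| <= b%:C%C) ->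
  total_error D1 n w < n%:R ^+ 2 * 2^-1 ^+ N ->
  `|array_trace mask tau (fine_of D1 D2) (config Y (pair_map D1 D2) n w) -
    expect (weight p : {ffun 'I_n -> pair_cell D1 D2} -> R) (array_trace mask tau (fine_of D1 D2))| < e / 4 ->
  `|resolvent_trace tau (entry_matrix N.+1 w) - limit_trace| <=
    e / 64 + 8 / e * 2^-1 ^+ N + e / 4 + (e / 4 + 16 * e1 / e + (128 * b ^+ 4 / e + 1) / n%:R).
Proof.
move=> e0 e_le1 bB err conc; have t0 : 0 < t by apply: lt_le_trans t2; rewrite ltr0n.
have n0 : (0 < n)%N by rewrite muln_gt0.
have nR0 : 0 < n%:R :> R by rewrite ltr0n.
have p0 v : 0 <= p v by exact: cell_mass_ge0.
have p1 : \sum_v p v = 1 by apply: cell_mass_sum; exact: measurable_pair_map.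
pose k := 8 / (n%:R ^+ 2 * e).
have k0 : 0 < k by rewrite divr_gt0// mulr_gt0// exprn_gt0.
pose y := fine_of D1 D2.
pose c := config Y (pair_map D1 D2) n w.
move: conc; set mean := expect _ _ => conc.
rewrite (_ : _ - _ = (resolvent_trace tau (entry_matrix N.+1 w) - array_trace mask tau y c) +
  (array_trace mask tau y c - mean) + (mean - limit_trace)); last by rewrite !addrA !subrK.
apply: le_trans (ler_normD _ _) _; apply: lerD; first apply: le_trans (ler_normD _ _) _; first apply: lerD.
- apply: le_trans (resolvent_trace_perturb _ _ n0 t2 erefl k0) _.
  rewrite addrC; apply: lerD.
    have -> : n%:R / (k * tau ^+ 3) = e / 8 * t ^- 3.
      by rewrite /k /tau; field; rewrite ?gt_eqF ?mulr_gt0 ?exprn_gt0.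
    exact: inv_cube_le (ltW e0).
  apply: le_trans (_ : k * (n%:R ^+ 2 * 2^-1 ^+ N) <= _); last first.
    by rewrite le_eqVlt /k; apply/orP; left; apply/eqP; field; rewrite ?gt_eqF ?mulr_gt0 ?exprn_gt0.
  rewrite ler_pM2l//; apply: le_trans (ltW err).
  apply: ler_sum => i _; apply: ler_sum => j _; rewrite !mxE !ffunE /mask.
  case: (dilated_mask i j); first by rewrite normcE2.
  by rewrite subrr normcE2 expr0n addr0 discretization_error_ge0.
- exact: ltW.
have h := array_trace_bias p0 p1 n0 t2 erefl bB (coarse_mean D1 D2) erefl
  (coarse_fine_dist fst_centred snd_centred D1 D2) (divr_gt0 e0 (ltr0Sn R 31)) k0
  (fun i => Tr01 (block (ltn0Sn N) i)) (block_fixed_point la_sc (ltn0Sn N) Tr_fix)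
  (dilated_mask_sym la_sc (ltn0Sn N)).
rewrite -(block_trace (ltn0Sn N)).
apply: le_trans h _.
apply: bias_terms => //; first by rewrite exprn_even_ge0.
apply: coarse_var; [exact: fst_centred|exact: snd_centred|exact: entry_law_unit|].
by rewrite divr_gt0.
Qed.

Lemma ae_trace_close (e : R) : 0 < e -> e <= 1 -> {ae P, forall w, \forall N \near \oo,
  `|resolvent_trace ((N.+1 * l)%:R * t) (entry_matrix N.+1 w) - limit_trace| <= e}.
Proof.
move=> e0 e_le1.
have eps0 : 0 < e ^+ 2 / 1000 by apply: divr_gt0; [exact: exprn_gt0|rewrite ltr0n].
have [D2] := discretizations eps0.
have [b bB] := coarse_bounded D2.
have rate0 N : 0 < 4^-1 ^+ N :> R by rewrite exprn_gt0.
have quarter : 4^-1 = 2^-1 * 2^-1 :> R by lra.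
have half : 0 <= (2^-1 : R) < 1 by apply/andP; split; lra.
have quarter_le : 4^-1 <= (2^-1 : R) by lra.
have cancel (x h : R) : 0 < x -> 0 < h -> x * (h * h) / (x * h) = 1 * h.
  by move=> x0 h0; field; rewrite !gt_eqF.
have e41 : e / 4 <= 1 by lra.
have D1 N : discretization nu f1 f2 (4^-1 ^+ N).
  by apply: inhabited_witness; exact: discretizations.
pose n N := (N.+1 * l)%N.
pose p N := cell_mass nu (pair_map (D1 N) D2).
pose E N := expect (weight (p N) : {ffun 'I_(n N) -> pair_cell (D1 N) D2} -> R)
  (array_trace (@dilated_mask la N.+1) ((n N)%:R * t) (fine_of (D1 N) D2)).
pose Q N (c : {ffun 'I_(n N) -> {ffun 'I_(n N) -> pair_cell (D1 N) D2}}) := e / 4 <=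
  `|array_trace (@dilated_mask la N.+1) ((n N)%:R * t) (fine_of (D1 N) D2) c - E N|.
(* The two exceptional events, both of geometrically small probability. *)
pose A1 N := [set w | (n N)%:R ^+ 2 * 2^-1 ^+ N <= total_error (D1 N) (n N) w].
pose A2 N := [set w | Q N (config Y (pair_map (D1 N) D2) (n N) w)].
have n0 N : (0 < n N)%N by rewrite muln_gt0.
have nN N : (N.+1 <= n N)%N by rewrite leq_pmulr.
have ae1 : {ae P, forall w, \forall N \near \oo, ~ A1 N w}.
  apply: (@ae_eventually_not _ _ _ _ _ 1 2^-1) => //.
  - move=> N; rewrite /A1; set c := _ * _.
    rewrite [X in measurable X](_ : _ = total_error (D1 N) (n N) @^-1` `[c, +oo[%classic); last first.
      by apply/seteqP; split=> w /=; rewrite in_itv/= andbT.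
    by rewrite -[X in measurable X]setTI; exact: measurable_total_error.
  move=> N; have h2 : 0 < 2^-1 ^+ N :> R by rewrite exprn_gt0.
  have nR : 0 < (n N)%:R ^+ 2 :> R by rewrite exprn_gt0// ltr0n.
  have := markov_ge0 (measurable_total_error (D1 N) (n N)) _ (mulr_gt0 nR h2)
    (integral_total_error (D1 N) (n N)).
  have -> : (n N)%:R ^+ 2 * 4^-1 ^+ N / ((n N)%:R ^+ 2 * 2^-1 ^+ N) = 1 * 2^-1 ^+ N :> R.
    by rewrite quarter exprMn cancel.
  apply => w; apply: sumr_ge0 => i _; apply: sumr_ge0 => j _; exact: discretization_error_ge0.
have ae2 : {ae P, forall w, \forall N \near \oo, ~ A2 N w}.
  have e40 : 0 < e / 4 by rewrite divr_gt0.
  apply: (@ae_eventually_not _ _ _ _ _ 2 (expR (- ((e / 4) ^+ 2 / 8)))) => //.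
  - by move=> N; apply: (measurable_config_pred Y_iid (measurable_pair_map (D1:=_) (D2:=_))).
  - by rewrite expR_ge0/= expR_lt1 oppr_lt0 divr_gt0// exprn_gt0.
  move=> N; rewrite /A2 (config_pred_mass Y_iid (measurable_pair_map (D1:=_) (D2:=_))) lee_fin.
  have p0 v : 0 <= p N v by exact: cell_mass_ge0.
  have p1 : \sum_v p N v = 1 by apply: cell_mass_sum; exact: measurable_pair_map.
  apply: le_trans (array_trace_concentration (@dilated_mask la N.+1) p0 p1 (n0 N) t2 erefl
    (fine_of (D1 N) D2) e40 e41) _.
  rewrite ler_wpM2l// ler_wiXn2l ?expR_ge0//; last exact: ltnW.
  by rewrite expR_le1 oppr_le0 divr_ge0// sqr_ge0.
have small : \forall N \near \oo, 24 / e * 2^-1 ^+ N + (128 * b ^+ 4 / e + 1) * N.+1%:R^-1 <= e / 4.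
  have h : (fun N => 24 / e * 2^-1 ^+ N + (128 * b ^+ 4 / e + 1) * N.+1%:R^-1) @ \oo --> (0 : R).
    rewrite -[0]addr0; apply: cvgD.
      apply: (@cvg_geometric R (24 / e) 2^-1); rewrite ger0_norm//; by case/andP: half.
    rewrite -[0](mulr0 (128 * b ^+ 4 / e + 1)); apply: cvgMl_tmp; exact: cvg_harmonic.
  have e40 : 0 < e / 4 by rewrite divr_gt0.
  move/cvgrPdist_le: h => /(_ _ e40); apply: filterS => N; rewrite sub0r normrN.
  exact: le_trans (ler_norm _).
near=> w.
have g1 : \forall N \near \oo, ~ A1 N w by near: w.
have g2 : \forall N \near \oo, ~ A2 N w by near: w.
near=> N.
have h1 : ~ A1 N w by near: N.
have h2 : ~ A2 N w by near: N.
have h3 : 24 / e * 2^-1 ^+ N + (128 * b ^+ 4 / e + 1) * N.+1%:R^-1 <= e / 4 by near: N.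
apply: le_trans (@trace_close_of_good N w e b _ (D1 N) D2 e0 e_le1 (bB _ (D1 N)) _ _) _.
- by rewrite ltNge; apply/negP.
- by rewrite ltNge; apply/negP.
have i4 : 4^-1 ^+ N <= 2^-1 ^+ N :> R by rewrite lerXn2r ?nnegrE.
have j4 : 16 * 4^-1 ^+ N / e <= 16 / e * 2^-1 ^+ N.
  by rewrite mulrAC ler_wpM2l// divr_ge0 ?(ltW e0).
have b4 : 0 <= 128 * b ^+ 4 / e + 1.
  apply: addr_ge0 => //; apply: divr_ge0 (ltW e0); apply: mulr_ge0; first by rewrite ler0n.
  exact: exprn_even_ge0.
have m4 : (128 * b ^+ 4 / e + 1) / (n N)%:R <= (128 * b ^+ 4 / e + 1) * N.+1%:R^-1.
  by rewrite ler_wpM2l// lef_pV2 ?posrE ?ltr0n// ler_nat.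
have e24 : 24 / e = 8 / e + 16 / e by rewrite -mulrDl -natrD.
move: h3 m4 j4; rewrite e24 mulrDl /n.
move: (_ / (N.+1 * l)%:R) (_ / N.+1%:R) (8 / e * _) (16 / e * _) (16 * _ / e) => u v x y z.
lra.
Unshelve. all: by end_near. Qed.

Lemma ae_trace_cvg : {ae P, forall w,
  resolvent_trace ((N.+1 * l)%:R * t) (entry_matrix N.+1 w) @[N --> \oo] --> limit_trace}.
Proof.
have h m : {ae P, forall w, \forall N \near \oo,
    `|resolvent_trace ((N.+1 * l)%:R * t) (entry_matrix N.+1 w) - limit_trace| <= m.+1%:R^-1}.
  by apply: ae_trace_close; rewrite ?invr_gt0// invf_le1// ler1n.
have := ae_foralln h; apply: filterS => w hw.
apply/cvgrPdist_le => e e0.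
have [m me] : exists m : nat, m.+1%:R^-1 <= e.
  exists (Num.truncn e^-1); rewrite invf_ple ?posrE//; exact/ltW/truncnS_gt.
by have := hw m; apply: filterS => N; rewrite distrC => /le_trans; exact.
Qed.

End TraceConvergence.

(** * Eigenvalues of sample covariance matrices *)

Section Eigenvalues.
Variables (C : numClosedFieldType) (n : nat).

Lemma char_poly_conj (Q D : 'M[C]_n) : Q \in unitmx ->
  char_poly (invmx Q *m D *m Q) = char_poly D.
Proof.
move=> Qu; rewrite /char_poly /char_poly_mx.
have QP : map_mx polyC (invmx Q) *m map_mx polyC Q = 1%:M.
  by rewrite -map_mxM mulVmx// map_mx1.
have -> : 'X%:M - map_mx polyC (invmx Q *m D *m Q) =
   map_mx polyC (invmx Q) *m ('X%:M - map_mx polyC D) *m map_mx polyC Q.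
  rewrite mulmxBr mulmxBl !map_mxM; congr (_ - _).
  by rewrite mul_mx_scalar -scalemxAl QP scalemx1.
by rewrite !det_mulmx mulrAC -det_mulmx QP det1 mul1r.
Qed.

Lemma eigenvalues_prod (A : 'M[C]_n) :
  char_poly A = \prod_(z <- eigenvalues A) ('X - z%:P).
Proof.
rewrite /eigenvalues; case: closed_field_poly_normal => r /= {1}->.
by rewrite (monicP (char_poly_monic A)) scale1r.
Qed.

Variables (X : 'M[C]_n) (t : C).
Hypothesis t0 : 0 < t.
Hypothesis n0 : (0 < n)%N.

Let W : 'M[C]_n := n%:R^-1 *: (X *m adjmx X).

Let W_herm : W \is hermsymmx.
Proof.
apply/is_hermitianmxP; rewrite expr0 scale1r /W.
apply/matrixP => i j; rewrite !mxE rmorphM rmorph_sum/= fmorphV rmorph_nat.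
congr (_ * _); apply: eq_bigr => k _; rewrite !mxE rmorphM/= conjCK mulrC //.
Qed.

Let Q := spectralmx W.
Let dg := spectral_diag W.

Let WE : W = invmx Q *m diag_mx dg *m Q.
Proof. exact/orthomx_spectralP/hermitian_normalmx. Qed.

Let Qu : Q \in unitmx. Proof. exact/unitarymx_unit/spectral_unitarymx. Qed.

Let QV : invmx Q = adjmx Q.
Proof. by rewrite invmx_unitary ?spectral_unitarymx// /adjmx map_trmx. Qed.

Let dg_ge0 i : 0 <= dg 0 i.
Proof.
have E : diag_mx dg = n%:R^-1 *: ((Q *m X) *m adjmx (Q *m X)).
  have <- : Q *m W *m invmx Q = diag_mx dg.
    by rewrite {1}WE !mulmxA mulmxV// mul1mx -mulmxA mulmxV// mulmx1.
  by rewrite /W adjmxM -QV -scalemxAr -scalemxAl !mulmxA.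
have -> : dg 0 i = diag_mx dg i i by rewrite mxE eqxx mulr1n.
rewrite E mxE mulr_ge0 ?invr_ge0// mxE sumr_ge0// => k _.
by rewrite adjmxE -normCK exprn_ge0.
Qed.

Lemma eigenvalues_wishart_perm :
  perm_eq (eigenvalues W) [seq dg 0 i | i : 'I_n].
Proof.
apply: prod_XsubC_eq; rewrite -eigenvalues_prod {1}WE char_poly_conj//.
rewrite char_poly_trig ?diag_mx_is_trig// big_map big_enum/=.
by apply: eq_bigr => i _; rewrite mxE eqxx mulr1n.
Qed.

Lemma eigenvalues_wishart_ge0 z : z \in eigenvalues W -> 0 <= z.
Proof. by rewrite (perm_mem eigenvalues_wishart_perm) => /mapP[i _ ->]. Qed.

Lemma size_eigenvalues_wishart : size (eigenvalues W) = n.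
Proof. by rewrite (perm_size eigenvalues_wishart_perm) size_map size_enum_ord. Qed.

(** In a unitary eigenbasis of [W] the resolvent of [X X^*] is diagonal. *)
Lemma trace_gres_eigenvalues :
  \tr (gres (n%:R * t) (adjmx X)) = n%:R^-1 * \sum_(z <- eigenvalues W) (z + t)^-1.
Proof.
have nt0 : 0 < n%:R * t by rewrite mulr_gt0// ltr0n.
pose dt : 'rV[C]_n := \row_i (dg 0 i + t)^-1.
have -> : gres (n%:R * t) (adjmx X) = n%:R^-1 *: (invmx Q *m diag_mx dt *m Q).
  apply/esym/gres_uniq => //.
  have -> : gram (n%:R * t) (adjmx X) = n%:R *: (W + t%:M).
    rewrite /gram adjmxK scalerDr scalerA mulfV ?scale1r ?scale_scalar_mx//.
    by rewrite pnatr_eq0 -lt0n.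
  rewrite -scalemxAl -scalemxAr scalerA mulfV ?scale1r; last by rewrite pnatr_eq0 -lt0n.
  have -> : W + t%:M = invmx Q *m (diag_mx dg + t%:M) *m Q.
    by rewrite mulmxDr mulmxDl -WE mul_mx_scalar -scalemxAl mulVmx// scalemx1.
  rewrite !mulmxA -(mulmxA _ Q) mulmxV// mulmx1 -(mulmxA (invmx Q)).
  have -> : (diag_mx dg + t%:M) *m diag_mx dt = 1%:M.
    apply/matrixP => i j; rewrite mul_mx_diag !mxE.
    have [->|ij] := eqVneq i j; rewrite ?mulr1n ?mulr0n ?addr0 ?mul0r//.
    by rewrite mulfV// gt_eqF// ltr_wpDl.
  by rewrite mulmx1 mulVmx.
rewrite mxtraceZ mxtrace_mulC mulmxA mulmxV// mul1mx mxtrace_diag.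
congr (_ * _); rewrite (perm_big _ eigenvalues_wishart_perm) big_map big_enum/=.
by apply: eq_bigr => i _; rewrite mxE.
Qed.

End Eigenvalues.

(** * The limiting transform *)

Section TreeTransform.
Variables (R : realType) (la : int_partition).
Local Notation l := (plength la).
Hypothesis l0 : (0 < l)%N.

Lemma label_solution_exists (t : R) : exists T : 'I_l -> R, 2 <= t ->
  (forall a, 0 <= T a <= 1) /\
  forall a, T a * (1 + (l%:R * t)^-1 * \sum_(b | linked a b) T b) = 1.
Proof.
have [t2|t2] := leP 2 t; last by exists (fun=> 0).
have t0 : 0 < t by apply: lt_le_trans t2; rewrite ltr0n.
have lR : 0 < l%:R :> R by rewrite ltr0n.
have [||T hT] := @tree_fixed_point R l (@linked la) (l%:R * t)^-1.
- by rewrite invr_ge0 mulr_ge0// ltW.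
- by rewrite invfM mulrAC mulVf ?gt_eqF// mul1r lef_pV2 ?posrE.
by exists T.
Qed.

Definition label_solution (t : R) : 'I_l -> R := sval (cid (label_solution_exists t)).

Definition tree_transform (t : R) : R := (l%:R * t)^-1 * \sum_a label_solution t a.

Definition tree_moment (k : nat) : R := (num_lambda_trees la k)%:R / l%:R ^+ k.+1.

(** Up to order [K], the solution agrees with its Picard iterate, whose low
    coefficients are the signed tree numbers; the remaining coefficients are
    absorbed in the error. *)
Lemma tree_transform_expansion K : exists2 M : R, 0 <= M & forall t, 2 <= t ->
  `|tree_transform t - \sum_(k < K.+1) (-1) ^+ k * tree_moment k / t ^+ k.+1| <= M / t ^+ K.+2.
Proof.
have [M0 M00 hM0] := @picard_dist R l (@linked la) K.
pose p a := picard R (@linked la) K a.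
pose q a := drop_poly K.+1 (p a).
have /fin_all_exists[M1 hM1] : forall a, exists M, 0 <= M /\
    forall x, 0 <= x <= 1 -> `|(q a).[x]| <= M.
  by move=> a; have [M ? ?] := horner_bounded (q a); exists M.
have M01 a : 0 <= M0 + M1 a by rewrite addr_ge0//; have [] := hM1 a.
exists (\sum_a (M0 + M1 a)); first exact: sumr_ge0.
move=> t t2; have [T01 T_fix] := svalP (cid (label_solution_exists t)) t2.
rewrite -/(label_solution t) in T01 T_fix.
have t0 : 0 < t by apply: lt_le_trans t2; rewrite ltr0n.
have lR : 0 < l%:R :> R by rewrite ltr0n.
pose x := (l%:R * t)^-1.
have x0 : 0 <= x by rewrite invr_ge0 mulr_ge0// ltW.
have xt : x <= t^-1 by rewrite lef_pV2 ?posrE ?mulr_gt0// ler_peMl ?(ltW t0)// ler1n.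
have x1 : x <= 1 by apply: le_trans xt _; rewrite invf_le1//; apply: le_trans t2; rewrite ler1n.
have x01 : 0 <= x <= 1 by rewrite x0.
have pE a : (p a).[x] = \sum_(k < K.+1) (-1) ^+ k * (num_rooted a k)%:R * x ^+ k + (q a).[x] * x ^+ K.+1.
  rewrite -[in LHS](poly_take_drop K.+1 (p a)) hornerD hornerM hornerXn; congr (_ + _).
  rewrite horner_poly; apply: eq_bigr => k _.
  by rewrite (coef_picard R (@num_rooted0 la) (@num_rootedS la)) // -ltnS.
have -> : \sum_(k < K.+1) (-1) ^+ k * tree_moment k / t ^+ k.+1 =
    x * \sum_(a < l) \sum_(k < K.+1) (-1) ^+ k * (num_rooted a k)%:R * x ^+ k.
  rewrite exchange_big/= mulr_sumr; apply: eq_bigr => k _.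
  rewrite -mulr_suml -mulr_sumr -natr_sum -num_lambda_treesE /tree_moment.
  rewrite [RHS]mulrCA -[x * _]mulrC -!mulrA -[x ^+ k * x]exprSr; congr (_ * (_ * _)).
  by rewrite /x exprVn exprMn invfM.
rewrite /tree_transform -/x -mulrBr -sumrB normrM (ger0_norm x0).
apply: (@le_trans _ _ (x * (\sum_a (M0 + M1 a) * x ^+ K.+1))).
  rewrite ler_wpM2l//; apply: le_trans (ler_norm_sum _ _ _) _; apply: ler_sum => a _.
  rewrite (_ : _ - _ = (label_solution t a - (p a).[x]) + (q a).[x] * x ^+ K.+1); last by rewrite pE; ring.
  apply: le_trans (ler_normD _ _) _; rewrite mulrDl; apply: lerD.
    exact: hM0.
  rewrite normrM [X in _ * X <= _]ger0_norm ?exprn_ge0// ler_wpM2r ?exprn_ge0//.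
  by have [_] := hM1 a; apply.
rewrite -mulr_suml mulrCA -exprS ler_wpM2l ?sumr_ge0// -exprVn lerXn2r ?nnegrE//.
by rewrite invr_ge0 ltW.
Qed.

Lemma tree_moment0 : tree_moment 0 = 1.
Proof.
rewrite /tree_moment num_lambda_treesE; under eq_bigr do rewrite num_rooted0.
by rewrite sum1_card card_ord expr1 mulfV// pnatr_eq0 -lt0n.
Qed.

Lemma tree_transform_top (e : R) : 0 < e -> exists2 t, 2 <= t & exists i, exists j,
  t = test_pt R i j /\ 1 - e <= t * tree_transform t.
Proof.
move=> e0; have [M M0 hM] := tree_transform_expansion 0.
pose i := (Num.truncn (M / e)).+1; exists (test_pt R i 0).
  by rewrite lerDl divr_ge0.
exists i, 0%N; split=> //; set t := test_pt R i 0.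
have t2 : 2 <= t by rewrite lerDl divr_ge0.
have t0 : 0 < t by apply: lt_le_trans t2; rewrite ltr0n.
have Mt : M / t <= e.
  rewrite ler_pdivrMr// mulrC -ler_pdivrMr//; apply: le_trans (ltW (truncnS_gt _)) _.
  by rewrite /t /test_pt divr1 lerDr.
have := hM t t2; rewrite big_ord1 expr0 mul1r tree_moment0 expr1.
rewrite distrC ler_norml => /andP[_ h].
have := ler_wpM2l (ltW t0) h; rewrite mulrBr.
have -> : t * (1 / t) = 1 by rewrite mulrC divfK// gt_eqF.
have -> : t * (M / t ^+ 2) = M / t by field; rewrite gt_eqF.
lra.
Qed.

End TreeTransform.

(** * Spectra of the random matrices *)

Section Spectra.
Variables (R : realType) (T : Type) (la : int_partition) (X : nat -> nat -> T -> R[i]).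
Local Notation l := (plength la).

Definition spectrum N w : seq R :=
  [seq complex.Re z | z <- eigenvalues (wishart_matrix la X N w)].

Variables (N : nat) (w : T).
Hypothesis n0 : (0 < N * l)%N.

Lemma wishart_eigenvalue z : z \in eigenvalues (wishart_matrix la X N w) ->
  0 <= complex.Re z /\ z = (complex.Re z)%:C%C.
Proof.
move=> /eigenvalues_wishart_ge0 z0; have zE : z = (complex.Re z)%:C%C.
  by rewrite RRe_real// ger0_real.
by split=> //; rewrite -lecR -zE.
Qed.

Lemma size_spectrum : size (spectrum N w) = (N * l)%N.
Proof. by rewrite size_map size_eigenvalues_wishart. Qed.

Lemma spectrum_ge0 x : x \in spectrum N w -> 0 <= x.
Proof. by move=> /mapP[z /wishart_eigenvalue[? _] ->]. Qed.

Lemma edf_spectrum x : edf (spectrum N w) x = empirical_df (wishart_matrix la X N w) x.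
Proof.
rewrite /edf /avg_pts size_spectrum /empirical_df; congr (_ * _).
rewrite big_map -sumn_count sumnE natr_sum big_map big_seq [RHS]big_seq.
apply: eq_bigr => z /wishart_eigenvalue[_ zE]; congr (nat_of_bool _)%:R.
by rewrite [in RHS]zE lecR.
Qed.

Lemma stieltjes_spectrum t : 2 <= t ->
  stieltjes (spectrum N w) t = resolvent_trace ((N * l)%:R * t) (random_matrix la X N w).
Proof.
move=> t2; have tC0 : 0 < t%:C%C :> R[i].
  by rewrite ltcR; apply: lt_le_trans t2; rewrite ltr0n.
apply: (@complexI R).
have trE : \tr (gres ((N * l)%:R * t)%:C%C (random_matrix la X N w)) =
    \tr (gres ((N * l)%:R * t%:C%C) (adjmx (random_matrix la X N w))).
  by rewrite gres_adj_trace_square ?mulr_gt0 ?ltr0n// rmorphM/= rmorph_nat.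
rewrite (resolvent_traceE n0 t2 erefl) trE trace_gres_eigenvalues// /stieltjes /avg_pts size_spectrum big_map.
rewrite rmorphM/= fmorphV/= rmorph_nat rmorph_sum; congr (_ * _).
rewrite big_seq [RHS]big_seq; apply: eq_bigr => z /wishart_eigenvalue[_ zE].
by rewrite [in RHS]zE -rmorphD -fmorphV.
Qed.

End Spectra.

(** * Convergence of the spectra *)

Lemma good_spectra (R : realType) (la : int_partition) (la_sc : self_conjugate la)
    (l0 : (0 < plength la)%N) d (T : measurableType d) (P : probability T R)
    (X : nat -> nat -> T -> R[i])
    (X_iid : iid P (fun (ij : nat * nat) w => complex_pair (X ij.1 ij.2 w))) :
  (\int[P]_w (complex.Re (X 0 0 w))%:E = 0)%E ->
  (\int[P]_w (complex.Im (X 0 0 w))%:E = 0)%E ->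
  (\int[P]_w (Normc.normc (X 0 0 w) ^+ 2)%:E = 1)%E ->
  {ae P, forall w, good_seq (tree_transform l0) (fun N => spectrum la X N.+1 w)}.
Proof.
move=> mean1 mean2 unit.
have unit2 : (\int[P]_w ((complex.Re (X 0 0 w)) ^+ 2 + (complex.Im (X 0 0 w)) ^+ 2)%:E = 1)%E.
  by rewrite -unit; apply: eq_integral => w _; rewrite normcE2.
have matE N w : entry_matrix (fun ij w => complex_pair (X ij.1 ij.2 w)) la N w =
    random_matrix la X N w.
  apply/matrixP => a b; rewrite !mxE /dilated_mask.
  by case: (in_diagram _ _ _) => //=; case: (X _ _ w).
have t2 i j : 2 <= test_pt R i j by rewrite lerDl divr_ge0.
have cvg_at i j : {ae P, forall w, resolvent_trace ((N.+1 * plength la)%:R * test_pt R i j)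
    (random_matrix la X N.+1 w) @[N --> \oo] --> tree_transform l0 (test_pt R i j)}.
  have [T01 T_fix] := svalP (cid (label_solution_exists l0 (test_pt R i j))) (t2 i j).
  rewrite -/(label_solution l0 (test_pt R i j)) in T01 T_fix.
  have := ae_trace_cvg X_iid mean1 mean2 unit2 la_sc l0 (t2 i j) T01 T_fix.
  apply: filterS => w h; under eq_fun do rewrite -matE; exact: h.
have := ae_foralln (fun i => ae_foralln (cvg_at i)); apply: filterS => w hw.
have n0 N : (0 < N.+1 * plength la)%N by rewrite muln_gt0.
split=> [N|N x|i j].
- by rewrite size_spectrum.
- exact: spectrum_ge0.
under eq_fun do rewrite (stieltjes_spectrum _ _ (n0 _) (t2 i j)); exact: hw.
Qed.

Theorem theorem3p4 (R : realType) (la : int_partition)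
    (la_nonempty : exists i j, in_diagram la i j)
    (la_selfconj : self_conjugate la)
    (d : measure_display) (T : measurableType d) (P : probability T R)
    (X : nat -> nat -> T -> R[i])
    (X_iid : iid P (fun (ij : nat * nat) w => complex_pair (X ij.1 ij.2 w)))
    (X_mean_re : forall i j, ('E_P[fun w => complex.Re (X i j w)] = 0)%E)
    (X_mean_im : forall i j, ('E_P[fun w => complex.Im (X i j w)] = 0)%E)
    (X_var : forall i j, ('E_P[fun w => (Normc.normc (X i j w) ^+ 2)%R] = 1)%E) :
  exists mu : probability R R,
    [/\ mu `[0%R, +oo[%classic = 1%E,
        forall k : nat, (\int[mu]_(x in `[0%R, +oo[%classic) (x ^+ k)%:E =
          ((num_lambda_trees la k)%:R / (plength la)%:R ^+ k.+1)%:E)%E &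
        {ae P, forall w,
          weak_cvg_df (fun N => empirical_df (wishart_matrix la X N w))
                      (distribution_function mu)}].
Proof.
have l0 : (0 < plength la)%N.
  by have [i [j /andP[il _]]] := la_nonempty; exact: leq_ltn_trans il.
have mean1 := X_mean_re 0 0; rewrite unlock in mean1.
have mean2 := X_mean_im 0 0; rewrite unlock in mean2.
have unit := X_var 0 0; rewrite unlock in unit.
have ae_good := good_spectra la_selfconj l0 X_iid mean1 mean2 unit.
(* One good outcome defines the law; all the others converge to it. *)
have [w0 good0] : exists w0, good_seq (tree_transform l0) (fun N => spectrum la X N.+1 w0).
  have [A [mA PA0 subA]] := ae_good; apply: contrapT => no.
  have AT : A = setT.
    by apply/seteqP; split=> // w _; apply: subA => gw; apply: no; exists w.
  have := probability_setT P; rewrite -[X in P X]AT => /eqP.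
  by rewrite [X in X == _]PA0 eq_sym onee_eq0.
have top := @tree_transform_top R la l0.
pose mu := limit_law good0 top.
have muE x := limit_lawE good0 top x.
have F_neg := @limit_dfN _ _ _ good0.
exists mu; split.
- exact: (limit_law_ge0 muE F_neg).
- apply: (integral_moment _ (tree_transform_expansion R l0)) => n.
  have tE : n.+2%:R = test_pt R n 0 by rewrite /test_pt divr1 -natrD.
  apply: (integral_inv_shift muE F_neg _ (good_size good0) (good_ge0 good0)
    (edf_limsup good0 good0) (edf_liminf good0 good0)) => //.
  by rewrite tE; exact: good_cvg.
move: ae_good; apply: filterS => w gw x; rewrite limit_law_df => cx.
have n0 N : (0 < N.+1 * plength la)%N by rewrite muln_gt0.
have h := edf_cvg good0 gw cx; rewrite -cvg_shiftS.
under eq_fun do rewrite -edf_spectrum//.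
exact: h.
Qed.
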